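(* Let $R$ be a commutative ring with identity and let $G$ be a path-connected topological group acting continuously on a path-connected topological space $X$. Then the following diagram commutes: $$\begin{array}{ccc}\widetilde H^*(BG,R)\otimes H^*(X_{hG},R)&\xrightarrow{\ \widetilde S\ }&H^{*-1}(G\times X,R)\\ {\scriptstyle k}\downarrow&&\downarrow\\ I^*(X,R)&\xrightarrow{\ S\ }&H^{*-1}(G\times X,R)/M_X^{*-1}\end{array}$$ where the right vertical arrow is the quotient map, $k(x\otimes y)=\beta^*(x)\smile y$ and $\widetilde S(x\otimes y)=\bar\gamma(x)\times\alpha^*(y)$.
   Context: $EG\to BG$ is the universal principal $G$-bundle (free right action); $X_{hG}=(X\times EG)/G$ with $g(x,e)=(gx,eg^{-1})$; $\alpha\colon X\to X_{hG}$ is the natural map, $\beta\colon X_{hG}\to BG$ the projection. $\varphi,p_2\colon G\times X\to X$ are the action and the projection. $M_X^*=\mathrm{Im}(\varphi^*-p_2^*\colon H^*(X,R)\to H^*(G\times X,R))$. $I^*(X,R)=\ker(\alpha^*\colon H^*(X_{hG},R)\to H^*(X,R))$. The naive homotopy quotient $X_{nG}$ is the homotopy coequaliser of $\varphi$ and $p_2$: the quotient of $(G\times X\times[0,1])\sqcup X$ by $(g,x,0)\sim x$, $(g,x,1)\sim gx$. There is a long exact sequence $$\cdots\to H^{*-1}(X,R)\xrightarrow{\varphi^*-p_2^*}H^{*-1}(G\times X,R)\xrightarrow{\delta}H^*(X_{nG},R)\to H^*(X,R)\to\cdots$$ with $\delta$ induced by the map $X_{nG}\to\Sigma(G\times X)_+$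 collapsing $X$ (composed with the suspension isomorphism). $\gamma'_X\colon X_{nG}\simeq(X\times EG)_{nG}\to(X\times EG)/G=X_{hG}$ is the natural map; its composite with $X\to X_{nG}$ is $\alpha$. The map $S\colon I^*(X,R)\to H^{*-1}(G\times X,R)/M_X^{*-1}$ sends $x$ to the unique element mapped to $(\gamma'_X)^*(x)$ by the map induced by $\delta$. $\gamma\colon\Sigma G\to BG$ is adjoint to the canonical equivalence $G\simeq\Omega BG$ (if $F\colon EG\times[0,1]\to EG$ is a homotopy from the constant map at a base point $e_0$ to the identity, $\gamma$ is induced by $(g,t)\mapsto[F(e_0\cdot g,t)]$); $\bar\gamma$ is the composite $H^*(BG,R)\xrightarrow{\gamma^*}H^*(\Sigma G,R)\to\widetilde H^*(\Sigma G_+,R)\cong H^{*-1}(G,R)$, the middle map being induced by $G_+\to G$ and the last one being the suspension isomorphism. *)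

(* Defs.v *)
From HB Require Import structures.
From Stdlib Require Import Relation_Operators.
From mathcomp Require Import all_boot all_order all_algebra ring_quotient.
From mathcomp Require Import all_classical reals topology normedtype.

Set Implicit Arguments.
Unset Strict Implicit.
Unset Printing Implicit Defensive.

Import Order.TTheory GRing.Theory Num.Theory.
Import numFieldNormedType.Exports.

Local Open Scope classical_set_scope.
Local Open Scope ring_scope.
Local Open Scope quotient_scope.

(* Singular cohomology H^n(X, R) of arbitrary topological spaces, the Borel
   construction X_hG, the naive homotopy quotient X_nG, and the maps between
   their cohomology groups.  [K] is the field of real numbers and [R] the
   coefficient ring. *)

Section UnitTopology.

Let unit_open (U : set unit) : Prop := True.

Let unit_openT : unit_open setT. Proof. by []. Qed.

Let unit_openI : setI_closed unit_open. Proof. by []. Qed.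

Let unit_open_bigcup (I : Type) (f : I -> set unit) :
  (forall i, unit_open (f i)) -> unit_open (\bigcup_i f i).
Proof. by []. Qed.

HB.instance Definition _ :=
  isOpenTopological.Build unit unit_openT unit_openI unit_open_bigcup.

End UnitTopology.

Section SumTopology.
Variables A B : topologicalType.

Definition sum_open (U : set (A + B)) : Prop :=
  open (inl @^-1` U) /\ open (inr @^-1` U).

Let sum_openT : sum_open setT. Proof. by split; exact: openT. Qed.

Let sum_openI : setI_closed sum_open.
Proof.
by move=> U V [Ul Ur] [Vl Vr]; split; rewrite preimage_setI; exact: openI.
Qed.

Let sum_open_bigcup (I : Type) (f : I -> set (A + B)) :
  (forall i, sum_open (f i)) -> sum_open (\bigcup_i f i).
Proof.
by move=> fo; split; rewrite preimage_bigcup; apply: bigcup_open => i _;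
  have [] := fo i.
Qed.

HB.instance Definition _ :=
  isOpenTopological.Build (A + B)%type sum_openT sum_openI sum_open_bigcup.

Lemma inl_continuous : continuous (inl : A -> A + B).
Proof. by apply/continuousP => U []. Qed.

Lemma inr_continuous : continuous (inr : B -> A + B).
Proof. by apply/continuousP => U []. Qed.

Lemma sum_continuous (Z : topologicalType) (f : A + B -> Z) :
  continuous (f \o inl) -> continuous (f \o inr) -> continuous f.
Proof.
move=> /continuousP fl /continuousP fr; apply/continuousP => U oU.
by split; [exact: fl|exact: fr].
Qed.

End SumTopology.

(* [tquot r] is the quotient of [T] by the equivalence relation generated by
   [r], with the quotient topology. *)
Section Quotient.
Variables (T : topologicalType) (r : T -> T -> Prop).

Definition gen_equiv : rel T := fun x y => `[< clos_refl_sym_trans T r x y >].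

Let gen_equiv_refl : reflexive gen_equiv.
Proof. by move=> x; apply/asboolP; exact: rst_refl. Qed.

Let gen_equiv_sym : symmetric gen_equiv.
Proof. by move=> x y; apply/asboolP/asboolP; exact: rst_sym. Qed.

Let gen_equiv_trans : transitive gen_equiv.
Proof.
by move=> y x z /asboolP xy /asboolP yz; apply/asboolP; exact: rst_trans xy yz.
Qed.

Canonical gen_equiv_rel :=
  EquivRel gen_equiv gen_equiv_refl gen_equiv_sym gen_equiv_trans.

Definition tquot : topologicalType :=
  quotient_topology {eq_quot gen_equiv_rel}.

Definition tproj (x : T) : tquot :=
  \pi_(quotient_topology {eq_quot gen_equiv_rel}) x.

Definition trepr (x : tquot) : T :=
  repr (x : quotient_topology {eq_quot gen_equiv_rel}).

Lemma treprK : cancel trepr tproj.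
Proof. exact: reprK. Qed.

Lemma tproj_continuous : continuous tproj.
Proof. exact: pi_continuous. Qed.

Lemma tproj_rel x y : r x y -> tproj x = tproj y.
Proof.
move=> rxy; apply/eqmodP; apply/asboolP; exact: rst_step.
Qed.

Lemma tprojP x y : tproj x = tproj y <-> clos_refl_sym_trans T r x y.
Proof.
split; last by move=> xy; apply/eqmodP; exact/asboolP.
by move=> /eqmodP /asboolP.
Qed.

Section Lift.
Variables (Z : topologicalType) (f : T -> Z).
Hypothesis fc : continuous f.
Hypothesis fr : forall x y, r x y -> f x = f y.

Definition tlift_fun (x : tquot) : Z := f (trepr x).

Lemma tlift_funE x : tlift_fun (tproj x) = f x.
Proof.
have fE a b : clos_refl_sym_trans T r a b -> f a = f b.
  by elim => [c e /fr||c e _ ->|c e g _ -> _] //.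
by apply: fE; apply/tprojP; rewrite treprK.
Qed.

Lemma tlift_continuous : continuous tlift_fun.
Proof.
apply/quotient_continuous; rewrite [X in continuous X](_ : _ = f) //.
by apply/funext => x; exact: tlift_funE.
Qed.

Definition tlift : continuousType tquot Z := mkcts tlift_continuous.

Lemma tliftE x : tlift (tproj x) = f x. Proof. exact: tlift_funE. Qed.

End Lift.
End Quotient.

Lemma pair_continuous (T A B : topologicalType) (f : T -> A) (g : T -> B) :
  continuous f -> continuous g -> continuous (fun x => (f x, g x)).
Proof. by move=> fc gc x; apply: cvg_pair; [exact: fc|exact: gc]. Qed.

Lemma fst_continuous (A B : topologicalType) : continuous (@fst A B).
Proof. by move=> x; exact: cvg_fst. Qed.

Lemma snd_continuous (A B : topologicalType) : continuous (@snd A B).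
Proof. by move=> x; exact: cvg_snd. Qed.

Lemma compT_continuous (A B C : topologicalType) (f : A -> B) (g : B -> C) :
  continuous f -> continuous g -> continuous (g \o f).
Proof. by move=> fc gc x; apply: continuous_comp; [exact: fc|exact: gc]. Qed.

Section Homotopy.
Variable K : realType.

Definition unit_interval : topologicalType :=
  set_type [set t : K | 0 <= t <= 1].

Lemma izero_subproof : (0 : K) \in [set t : K | 0 <= t <= 1].
Proof. by apply/mem_set; rewrite /= lexx ler01. Qed.

Lemma ione_subproof : (1 : K) \in [set t : K | 0 <= t <= 1].
Proof. by apply/mem_set; rewrite /= lexx ler01. Qed.

Definition izero : unit_interval :=
  exist (fun t => t \in [set t : K | 0 <= t <= 1]) 0 izero_subproof.

Definition ione : unit_interval :=
  exist (fun t => t \in [set t : K | 0 <= t <= 1]) 1 ione_subproof.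

Definition path_connected (X : topologicalType) : Prop :=
  forall x y : X, exists p : continuousType unit_interval X,
    p izero = x /\ p ione = y.

Definition homotopic (X Y : topologicalType) (f g : continuousType X Y) : Prop :=
  exists H : continuousType (X * unit_interval)%type Y,
    forall x, H (x, izero) = f x /\ H (x, ione) = g x.

Definition homotopy_inverse (X Y : topologicalType)
    (f : continuousType X Y) (g : continuousType Y X) : Prop :=
  homotopic (g \o f) idfun /\ homotopic (f \o g) idfun.

(* Reduced suspension of a pointed space: (Z x {0,1}) u ({z0} x [0,1]) is
   collapsed to the base point [susp_base]. *)
Section Suspension.
Variables (Z : topologicalType) (z0 : Z).

Definition susp_collapsed (p : Z * unit_interval) : Prop :=
  p.1 = z0 \/ p.2 = izero \/ p.2 = ione.

Definition susp : topologicalType :=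
  @tquot (Z * unit_interval)%type
    (fun p q => susp_collapsed p /\ susp_collapsed q).

Definition susp_proj : continuousType (Z * unit_interval)%type susp :=
  mkcts (@tproj_continuous _ _).

Definition susp_base : susp := susp_proj (z0, izero).

End Suspension.

Section SuspensionMap.
Variables (Z W : topologicalType) (z0 : Z) (w0 : W).
Variables (f : continuousType Z W) (f0 : f z0 = w0).

Definition susp_map_fun (p : Z * unit_interval) : susp w0 :=
  susp_proj w0 (f p.1, p.2).

Lemma susp_map_fun_continuous : continuous susp_map_fun.
Proof.
apply: compT_continuous; last exact: cts_fun.
apply: pair_continuous; last exact: snd_continuous.
by apply: compT_continuous; [exact: fst_continuous|exact: cts_fun].
Qed.

Lemma susp_map_fun_rel p q : susp_collapsed z0 p /\ susp_collapsed z0 q ->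
  susp_map_fun p = susp_map_fun q.
Proof.
move=> [cp cq]; apply: tproj_rel.
by split; [case: cp => [->|]|case: cq => [->|]]; [left|right|left|right].
Qed.

Definition susp_map : continuousType (susp z0) (susp w0) :=
  tlift susp_map_fun_continuous susp_map_fun_rel.

End SuspensionMap.

(* Y_+, with base point [inr tt]. *)
Definition plus (Y : topologicalType) : topologicalType := (Y + unit)%type.

Definition susp_plus (Y : topologicalType) : topologicalType :=
  @susp (plus Y) (inr tt).

Section Cylinder.
Variable Y : topologicalType.

Lemma cyl_end_continuous (t : unit_interval) : continuous (fun y : Y => (y, t)).
Proof. by apply: pair_continuous => x; [exact: cvg_id|exact: cvg_cst]. Qed.

Definition cyl_end (t : unit_interval) :
  continuousType Y (Y * unit_interval)%type := mkcts (@cyl_end_continuous t).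

Lemma cyl_susp_plus_continuous : continuous
  (fun p : Y * unit_interval => susp_proj (inr tt : plus Y) (inl p.1, p.2)).
Proof.
have ic : continuous (fun p : Y * unit_interval => (inl p.1 : plus Y, p.2)).
  apply: pair_continuous; last exact: snd_continuous.
  exact: compT_continuous (@fst_continuous _ _) (@inl_continuous Y unit).
exact: compT_continuous ic (@cts_fun _ _ (susp_proj (inr tt : plus Y))).
Qed.

Definition cyl_susp_plus : continuousType (Y * unit_interval)%type (susp_plus Y) :=
  mkcts cyl_susp_plus_continuous.

End Cylinder.
End Homotopy.

HB.mixin Record isTopologicalGroup G of Topological G & Group G := {
  mulg_continuous : continuous (fun p : G * G => (p.1 * p.2)%g);
  invg_continuous : continuous (fun x : G => (x^-1)%g)
}.

#[short(type="topologicalGroupType")]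
HB.structure Definition TopologicalGroup :=
  {G of Topological G & Group G & isTopologicalGroup G}.

Record left_action (G : topologicalGroupType) (X : topologicalType) := LeftAction {
  lact :> G -> X -> X;
  lact1 : forall x, lact 1%g x = x;
  lactM : forall g h x, lact (g * h)%g x = lact g (lact h x);
  lact_continuous : continuous (fun p : G * X => lact p.1 p.2) }.

Record right_action (G : topologicalGroupType) (E : topologicalType) := RightAction {
  ract :> E -> G -> E;
  ract1 : forall e, ract e 1%g = e;
  ractM : forall e g h, ract e (g * h)%g = ract (ract e g) h;
  ract_continuous : continuous (fun p : E * G => ract p.1 p.2) }.

(* Principal G-bundle E -> B.  Local triviality: over U, the maps
   (x, g) |-> s(x) g and e |-> (pb_proj e, h(e)) are inverse G-homeomorphisms
   between U x G and the preimage of U. *)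
Record principal_bundle (G : topologicalGroupType) (E B : topologicalType) :=
  PrincipalBundle {
    pb_act : right_action G E;
    pb_proj : continuousType E B;
    pb_free : forall e g, pb_act e g = e -> g = 1%g;
    pb_projM : forall e g, pb_proj (pb_act e g) = pb_proj e;
    pb_locally_trivial : forall b : B,
      exists (U : set B) (s : B -> E) (h : E -> G),
        [/\ open U /\ U b,
            forall x, U x -> {for x, continuous s} /\ pb_proj (s x) = x,
            forall e, U (pb_proj e) ->
              {for e, continuous h} /\ pb_act (s (pb_proj e)) (h e) = e &
            forall x g, U x -> h (pb_act (s x) g) = g] }.

Definition orbit_space (G : topologicalGroupType) (X : topologicalType)
    (a : left_action G X) : topologicalType :=
  @tquot X (fun x y => exists g, y = a g x).

Section DiagonalAction.
Variables (G : topologicalGroupType) (X E B : topologicalType).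
Variables (a : left_action G X) (xi : principal_bundle G E B).

Definition diag_lact (g : G) (p : X * E) : X * E :=
  (a g p.1, pb_act xi p.2 (g^-1)%g).

Lemma diag_lact1 p : diag_lact 1%g p = p.
Proof. by case: p => x e; rewrite /diag_lact lact1 invg1 ract1. Qed.

Lemma diag_lactM g h p : diag_lact (g * h)%g p = diag_lact g (diag_lact h p).
Proof. by rewrite /diag_lact lactM invgM ractM. Qed.

Lemma diag_lact_continuous :
  continuous (fun p : G * (X * E) => diag_lact p.1 p.2).
Proof.
have c1 := @fst_continuous G (X * E)%type.
have c2 := @snd_continuous G (X * E)%type.
apply: pair_continuous.
- apply: (@compT_continuous _ (G * X)%type _ (fun p => (p.1, p.2.1)) _ _
    (lact_continuous (l := a))).
  by apply: pair_continuous => //; apply: compT_continuous c2 (@fst_continuous _ _).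
- apply: (@compT_continuous _ (E * G)%type _ (fun p => (p.2.2, (p.1^-1)%g)) _ _
    (ract_continuous (r := pb_act xi))).
  apply: pair_continuous.
    by apply: compT_continuous c2 (@snd_continuous _ _).
  by apply: compT_continuous c1 (@invg_continuous _).
Qed.

Definition diag_action : left_action G (X * E)%type :=
  LeftAction diag_lact1 diag_lactM diag_lact_continuous.

(* X_hG = (X x EG)/G for the action g(x, e) = (g x, e g^-1). *)
Definition hquot : topologicalType := orbit_space diag_action.

(* [hquot_incl e0] is alpha : X -> X_hG, using the fibre inclusion x |-> (x, e0);
   [hquot_proj] is beta : X_hG -> BG. *)
Lemma hquot_incl_continuous (e0 : E) :
  continuous (fun x : X => tproj _ (x, e0) : hquot).
Proof.
apply: (@compT_continuous _ (X * E)%type _ _ _ _ (@tproj_continuous _ _)).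
by apply: pair_continuous => x; [exact: cvg_id|exact: cvg_cst].
Qed.

Definition hquot_incl (e0 : E) : continuousType X hquot :=
  mkcts (@hquot_incl_continuous e0).

Lemma hquot_proj_continuous : continuous (fun p : X * E => pb_proj xi p.2).
Proof.
by apply: compT_continuous; [exact: snd_continuous|exact: cts_fun].
Qed.

Lemma hquot_proj_rel (p q : X * E) :
  (exists g, q = diag_action g p) -> pb_proj xi p.2 = pb_proj xi q.2.
Proof. by move=> [g ->] /=; rewrite pb_projM. Qed.

Definition hquot_proj : continuousType hquot B :=
  tlift hquot_proj_continuous hquot_proj_rel.

End DiagonalAction.

(* [nquot K a] is X_nG for the action [a]. *)
Section NaiveQuotient.
Variable K : realType.
Local Notation I01 := (unit_interval K).

Section Def.
Variables (G : topologicalGroupType) (X : topologicalType) (a : left_action G X).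

Inductive nquot_rel : (G * X * I01) + X -> (G * X * I01) + X -> Prop :=
  | NquotZero g x : nquot_rel (inl (g, x, izero K)) (inr x)
  | NquotOne g x : nquot_rel (inl (g, x, ione K)) (inr (a g x)).

Definition nquot : topologicalType :=
  @tquot ((G * X * I01) + X)%type nquot_rel.

(* [act_map] is phi and [snd_map] is p_2. *)
Definition act_map : continuousType (G * X)%type X :=
  mkcts (lact_continuous (l := a)).

Definition snd_map : continuousType (G * X)%type X :=
  mkcts (@snd_continuous G X).

(* The map X_nG -> Sigma((G x X)_+) collapsing X. *)
Definition nquot_collapse_fun (u : (G * X * I01) + X) : susp_plus K (G * X)%type :=
  match u with
  | inl p => cyl_susp_plus K (G * X)%type p
  | inr _ => susp_base K (inr tt)
  end.

Lemma nquot_collapse_fun_continuous : continuous nquot_collapse_fun.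
Proof.
apply: sum_continuous => [|x]; last exact: cvg_cst.
exact: (@cyl_susp_plus_continuous K (G * X)%type).
Qed.

Lemma nquot_collapse_fun_rel u v : nquot_rel u v ->
  nquot_collapse_fun u = nquot_collapse_fun v.
Proof.
case=> [g x|g x]; apply: tproj_rel; split; rewrite /susp_collapsed /=; auto.
Qed.

Definition nquot_collapse : continuousType nquot (susp_plus K (G * X)%type) :=
  tlift nquot_collapse_fun_continuous nquot_collapse_fun_rel.

(* The natural map X_nG -> X/G. *)
Definition nquot_orbit_fun (u : (G * X * I01) + X) : orbit_space a :=
  match u with
  | inl p => tproj _ p.1.2
  | inr x => tproj _ x
  end.

Lemma nquot_orbit_fun_continuous : continuous nquot_orbit_fun.
Proof.
apply: sum_continuous; last exact: tproj_continuous.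
apply: (@compT_continuous _ X _ (fun p => p.1.2) _ _ (@tproj_continuous _ _)).
by apply: compT_continuous (@fst_continuous _ _) (@snd_continuous _ _).
Qed.

Lemma nquot_orbit_fun_rel u v : nquot_rel u v ->
  nquot_orbit_fun u = nquot_orbit_fun v.
Proof. by case=> [//|g x]; apply: tproj_rel; exists g. Qed.

Definition nquot_orbit : continuousType nquot (orbit_space a) :=
  tlift nquot_orbit_fun_continuous nquot_orbit_fun_rel.

End Def.

Section Map.
Variables (G : topologicalGroupType) (X Y : topologicalType).
Variables (a : left_action G X) (b : left_action G Y) (f : continuousType X Y).
Hypothesis fE : forall g x, f (a g x) = b g (f x).

Definition nquot_map_fun (u : (G * X * I01) + X) : nquot b :=
  match u with
  | inl p => tproj _ (inl (p.1.1, f p.1.2, p.2))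
  | inr x => tproj _ (inr (f x))
  end.

Lemma nquot_map_fun_continuous : continuous nquot_map_fun.
Proof.
apply: sum_continuous.
  apply: (@compT_continuous _ _ _ _ _ _ (@tproj_continuous _ _)).
  apply: (@compT_continuous _ (G * Y * I01)%type _
    (fun p : G * X * I01 => (p.1.1, f p.1.2, p.2)) _ _ (@inl_continuous _ _)).
  apply: pair_continuous; last exact: snd_continuous.
  apply: pair_continuous.
    by apply: compT_continuous (@fst_continuous _ _) (@fst_continuous _ _).
  apply: compT_continuous (@cts_fun _ _ f).
  by apply: compT_continuous (@fst_continuous _ _) (@snd_continuous _ _).
apply: (@compT_continuous _ _ _ _ _ _ (@tproj_continuous _ _)).
by apply: compT_continuous (@cts_fun _ _ f) (@inr_continuous _ _).
Qed.

Lemma nquot_map_fun_rel u v : nquot_rel a u v ->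
  nquot_map_fun u = nquot_map_fun v.
Proof.
by case=> [g x|g x]; apply: tproj_rel; rewrite ?fE; constructor.
Qed.

Definition nquot_map : continuousType (nquot a) (nquot b) :=
  tlift nquot_map_fun_continuous nquot_map_fun_rel.

End Map.

Section Borel.
Variables (G : topologicalGroupType) (X E B : topologicalType).
Variables (a : left_action G X) (xi : principal_bundle G E B).

Definition nquot_fst : continuousType (nquot (diag_action a xi)) (nquot a) :=
  @nquot_map G _ _ (diag_action a xi) a (mkcts (@fst_continuous X E))
    (fun _ _ => erefl).

(* gamma'_X : X_nG -> (X x EG)_nG -> (X x EG)/G, where [j] is a homotopy inverse
   of the projection [nquot_fst]. *)
Definition borel_map (j : continuousType (nquot a) (nquot (diag_action a xi))) :
    continuousType (nquot a) (hquot a xi) :=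
  nquot_orbit (diag_action a xi) \o j.

Definition plus_group_fun (u : plus G) : G :=
  match u with inl g => g | inr _ => 1%g end.

Lemma plus_group_fun_continuous : continuous plus_group_fun.
Proof.
apply: sum_continuous.
  exact: (@cts_fun _ _ (idfun : G -> G)).
exact: (@cts_fun _ _ (cst 1%g : unit -> G)).
Qed.

Definition plus_group : continuousType (plus G) G :=
  mkcts plus_group_fun_continuous.

Definition susp_plus_group : continuousType (susp_plus K G) (susp K (1%g : G)) :=
  susp_map K (f := plus_group) erefl.

(* [F] is a homotopy from the constant map e0 to the identity of EG; a principal
   bundle with contractible total space is universal. *)
Definition contracts_to (e0 : E) (F : continuousType (E * I01)%type E) : Prop :=
  forall e, F (e, izero K) = e0 /\ F (e, ione K) = e.

(* The adjoint G -> Omega BG of [gam] : Sigma G -> BG, g |-> (t |-> gam [g, t]),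
   is homotopic, through maps to the loop space Omega BG, to the canonical
   equivalence g |-> (t |-> [F(e0 g, t)]).  The homotopy may be constant, in
   which case gam is induced by (g, t) |-> [F(e0 g, t)]. *)
Definition canonical_adjoint (e0 : E) (F : continuousType (E * I01)%type E)
    (gam : continuousType (susp K (1%g : G)) B) : Prop :=
  exists L : continuousType (G * I01 * I01)%type B,
    [/\ forall g t, L (g, t, izero K) = gam (susp_proj K 1%g (g, t)),
        forall g t, L (g, t, ione K) = pb_proj xi (F (pb_act xi e0 g, t)) &
        forall g s, L (g, izero K, s) = pb_proj xi e0 /\
                    L (g, ione K, s) = pb_proj xi e0].

End Borel.
End NaiveQuotient.

Section Simplex.
Variable K : realType.

Definition std_simplex (n : nat) : set 'rV[K]_n.+1 :=
  [set v | (forall i, 0 <= v ord0 i) /\ \sum_i v ord0 i = 1].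

Definition simplex (n : nat) : topologicalType := set_type (@std_simplex n).

Section Smap.
Variables (m n : nat) (f : 'I_m.+1 -> 'I_n.+1).

Definition smap_row (v : 'rV[K]_m.+1) : 'rV[K]_n.+1 :=
  \row_j \sum_(i | f i == j) v ord0 i.

Lemma smap_subproof (v : simplex m) : smap_row (\val v) \in @std_simplex n.
Proof.
case: v => v /= /set_mem [v0 v1]; apply/mem_set; split=> [i|].
  by rewrite mxE sumr_ge0.
under eq_bigr do rewrite mxE.
by rewrite -[RHS]v1 [RHS](partition_big f xpredT).
Qed.

Definition smap_fun (v : simplex m) : simplex n :=
  exist (fun w => w \in @std_simplex n) _ (smap_subproof v).

Lemma smap_row_continuous : continuous smap_row.
Proof.
move=> u A [P Pn PA].
have cj j : continuous (fun w => smap_row w ord0 j).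
  have -> : (fun w => smap_row w ord0 j) = (fun w => \sum_(i | f i == j) w ord0 i).
    by apply/funext => w; rewrite mxE.
  apply: (@continuous_big K _ +%R) => [|i _]; last exact: coord_continuous.
  exact: add_continuous.
have : forall j, nbhs u [set w | P ord0 j (smap_row w ord0 j)].
  by move=> j; exact: cj.
move=> /filter_forall H; apply: (filterS _ H) => w /= Hw.
by apply: PA => i j; rewrite (ord1 i).
Qed.

Lemma smap_continuous : continuous smap_fun.
Proof.
apply: continuous_comp_initial => v.
apply: (@continuous_comp _ _ _ set_val smap_row).
  exact: initial_continuous.
exact: smap_row_continuous.
Qed.

Definition smap : continuousType (simplex m) (simplex n) := mkcts smap_continuous.
End Smap.
End Simplex.

Section SingularSimplices.
Variable K : realType.

Definition singular (n : nat) (X : topologicalType) :=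
  continuousType (simplex K n) X.

(* The simplex of X spanned by the vertices f 0, ..., f m of [s]. *)
Definition srestr (n m : nat) (X : topologicalType) (f : nat -> nat)
    (s : singular n X) : singular m X :=
  s \o smap K (fun i : 'I_m.+1 => inord (f i) : 'I_n.+1).

Lemma smap_comp l m n (g : 'I_m.+1 -> 'I_n.+1) (f : 'I_l.+1 -> 'I_m.+1) v :
  smap K g (smap K f v) = smap K (g \o f) v.
Proof.
apply: val_inj; apply/rowP => k; rewrite !mxE /=.
rewrite [RHS](partition_big f (fun i => g i == k)) //=.
apply: eq_bigr => i gi; rewrite mxE; apply: eq_bigl => j.
by case: eqP => [->|]; rewrite ?gi ?andbF.
Qed.

Lemma srestr_comp l m n X (g f : nat -> nat) (s : singular n X) :
  (forall i, i <= l -> f i <= m)%N ->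
  srestr l f (srestr m g s) = srestr l (g \o f) s.
Proof.
move=> fm; apply/continuousEP => v /=; rewrite smap_comp.
congr (s (smap K _ _)); apply/funext => i /=.
by rewrite inordK // ltnS fm // -ltnS.
Qed.

Lemma eq_srestr m n X (f g : nat -> nat) (s : singular n X) :
  (forall i, i <= m -> f i = g i)%N -> srestr m f s = srestr m g s.
Proof.
move=> fg; apply/continuousEP => v /=; congr (s (smap K _ _)).
by apply/funext => i; rewrite fg // -ltnS.
Qed.

End SingularSimplices.

Section Cochains.
Variables (K : realType) (R : comPzRingType).

Definition cochain (n : nat) (X : topologicalType) : zmodType :=
  (singular K n X -> R).

Definition codiff n X (c : cochain n X) : cochain n.+1 X :=
  fun s => \sum_(i < n.+2) (-1) ^+ i * c (srestr n (bump i) s).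

Lemma codiffB n X : {morph @codiff n X : c e / c - e}.
Proof.
move=> c e; apply/funext => s; rewrite /codiff.
rewrite [RHS](_ : _ = codiff c s - codiff e s) // /codiff -sumrB.
by apply: eq_bigr => i _; rewrite -mulrBr.
Qed.

Lemma codiff0 n X : codiff (0 : cochain n X) = 0.
Proof. by rewrite -(subrr 0) codiffB subrr. Qed.

Definition is_cocycle n X : {pred cochain n X} := fun c => `[< codiff c = 0 >].

Lemma cocycleP n X (c : cochain n X) :
  reflect (codiff c = 0) (c \in @is_cocycle n X).
Proof. exact: asboolP. Qed.

Lemma is_cocycle_zmod_closed n X : zmod_closed (@is_cocycle n X).
Proof.
split=> [|c e /cocycleP dc /cocycleP de]; apply/cocycleP; first exact: codiff0.
by rewrite codiffB dc de subrr.
Qed.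

HB.instance Definition _ n X :=
  GRing.isZmodClosed.Build (cochain n X) (@is_cocycle n X)
    (@is_cocycle_zmod_closed n X).

Record cocycle n X := Cocycle {
  cocycle_val :> cochain n X;
  cocycle_valP : cocycle_val \in @is_cocycle n X }.

HB.instance Definition _ n X := [isSub for @cocycle_val n X].
HB.instance Definition _ n X := [Choice of cocycle n X by <:].
HB.instance Definition _ n X := [SubChoice_isSubZmodule of cocycle n X by <:].

Lemma codiff_cocycle n X (c : cocycle n X) : codiff c = 0.
Proof. exact/cocycleP/cocycle_valP. Qed.

Definition coboundary n X : cochain n X -> Prop :=
  match n with
  | 0 => fun c => c = 0
  | m.+1 => fun c => exists b : cochain m X, c = codiff b
  end.

Lemma coboundary0 n X : coboundary (0 : cochain n X).
Proof. by case: n => //= n; exists 0; rewrite codiff0. Qed.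

Lemma coboundaryB n X (c e : cochain n X) :
  coboundary c -> coboundary e -> coboundary (c - e).
Proof.
case: n c e => [c e /= -> ->|n c e [b ->] [b' ->]]; first by rewrite subrr.
by exists (b - b'); rewrite codiffB.
Qed.

Definition is_coboundary n X : {pred cocycle n X} :=
  fun c => `[< coboundary (c : cochain n X) >].

Lemma is_coboundary_zmod_closed n X : zmod_closed (@is_coboundary n X).
Proof.
split=> [|c e /asboolP dc /asboolP de]; apply/asboolP.
  exact: coboundary0.
exact: coboundaryB.
Qed.

HB.instance Definition _ n X :=
  GRing.isZmodClosed.Build (cocycle n X) (@is_coboundary n X)
    (@is_coboundary_zmod_closed n X).

Definition cohomology n X : zmodType := Quotient.quot (@is_coboundary n X).

Definition coclass n X (c : cocycle n X) : cohomology n X := \pi c.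

Lemma coclassP n X (c e : cocycle n X) :
  coclass c = coclass e <-> coboundary (c - e : cochain n X).
Proof.
rewrite /coclass; split=> [/eqP|ce]; last apply/eqP.
  by rewrite -Quotient.idealrBE => /asboolP.
by rewrite -Quotient.idealrBE; exact/asboolP.
Qed.

Lemma coclassB n X (c e : cocycle n X) : coclass (c - e) = coclass c - coclass e.
Proof. by rewrite /coclass raddfB. Qed.

Section Pullback.
Variables (X Y : topologicalType) (f : continuousType X Y).

Definition cpull n (c : cochain n Y) : cochain n X :=
  fun s => c (f \o s : singular K n Y).

Lemma cpullB n : {morph @cpull n : c e / c - e}. Proof. by []. Qed.

Lemma cpull0 n : @cpull n 0 = 0. Proof. by []. Qed.

Lemma cpull_codiff n (c : cochain n Y) : cpull (codiff c) = codiff (cpull c).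
Proof.
apply/funext => s; apply: eq_bigr => i _; congr (_ * c _).
exact/continuousEP.
Qed.

Lemma cpull_cocycle n (c : cocycle n Y) : cpull c \in @is_cocycle n X.
Proof. by apply/cocycleP; rewrite -cpull_codiff codiff_cocycle cpull0. Qed.

Definition zpull n (c : cocycle n Y) : cocycle n X := Cocycle (cpull_cocycle c).

Lemma cpull_coboundary n (c : cochain n Y) : coboundary c -> coboundary (cpull c).
Proof.
by case: n c => [c -> //|n c [b ->]]; exists (cpull b); rewrite cpull_codiff.
Qed.

Definition pull n (x : cohomology n Y) : cohomology n X := coclass (zpull (repr x)).

Lemma pull_coclass n (c : cocycle n Y) : pull (coclass c) = coclass (zpull c).
Proof.
apply/coclassP.
change (coboundary (cpull (repr (coclass c) - c : cochain n Y))).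
by apply/cpull_coboundary/coclassP; rewrite /coclass reprK.
Qed.

Lemma pullB n : {morph @pull n : x y / x - y}.
Proof.
move=> x y; rewrite -[x]reprK -[y]reprK.
rewrite -!/(coclass _) -coclassB !pull_coclass -coclassB; congr coclass.
exact: val_inj.
Qed.

End Pullback.

Section Cup.
Variable X : topologicalType.

(* Front p-face times back q-face. *)
Definition ccup p q (a : cochain p X) (b : cochain q X) : cochain (p + q) X :=
  fun s => a (srestr p id s) * b (srestr q (addn p) s).

Lemma ccup_cocycle p q (a : cocycle p X) (b : cocycle q X) :
  ccup a b \in @is_cocycle (p + q) X.
Proof.
have := codiff_cocycle a; have := codiff_cocycle b.
case: a => a aP; case: b => b bP /= db da.
apply/cocycleP/funext => s; rewrite /codiff /ccup.
pose T (i : nat) : R := (-1) ^+ i *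
  (a (srestr p id (srestr (p + q) (bump i) s)) *
   b (srestr q (addn p) (srestr (p + q) (bump i) s))).
pose u := srestr p.+1 id s; pose w := srestr q.+1 (addn p) s.
pose a0 := a (srestr p id s); pose b0 := b (srestr q (addn p.+1) s).
have T1 i : (i <= p)%N -> T i = (-1) ^+ i * a (srestr p (bump i) u) * b0.
  move=> ip; rewrite /T -mulrA; congr (_ * (a _ * b _)).
  - rewrite srestr_comp; last by move=> j jp; rewrite (leq_trans jp) ?leq_addr.
    rewrite /u srestr_comp // => j jp; rewrite /bump.
    by case: (i <= j)%N; rewrite ?add1n ?add0n ?ltnS // leqW.
  - rewrite srestr_comp; last by move=> j jq; rewrite leq_add2l.
    by apply: eq_srestr => j jq /=; rewrite /bump (leq_trans ip) ?leq_addr.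
have T2 k : (k <= q)%N -> T (p.+1 + k)%N =
    (-1) ^+ p * a0 * ((-1) ^+ k.+1 * b (srestr q (bump k.+1) w)).
  move=> kq; rewrite /T.
  have -> : srestr p id (srestr (p + q) (bump (p.+1 + k)) s) = srestr p id s.
    rewrite srestr_comp; last by move=> j jp; rewrite (leq_trans jp) ?leq_addr.
    apply: eq_srestr => j jp /=; rewrite /bump leqNgt.
    by rewrite addSn ltnS (leq_trans jp) ?leq_addr.
  have -> : srestr q (addn p) (srestr (p + q) (bump (p.+1 + k)) s) =
            srestr q (bump k.+1) w.
    rewrite srestr_comp; last by move=> j jq; rewrite leq_add2l.
    rewrite /w srestr_comp; last first.
      by move=> j jq; rewrite /bump; case: (_ < _)%N; rewrite ?add1n ?ltnS // leqW.
    apply: eq_srestr => j jq /=; rewrite /bump addSnnS leq_add2l.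
    by rewrite addnCA.
  by rewrite -/a0 addSnnS exprD !mulrA; congr (_ * _); rewrite mulrAC.
rewrite -(big_mkord xpredT T) (_ : (p + q).+2 = p.+1 + q.+1)%N; last first.
  by rewrite addnS.
rewrite (big_cat_nat _ (n := p.+1)) ?leq_addr //=.
have da0 : \sum_(0 <= i < p.+1) T i + (-1) ^+ p.+1 * a0 * b0 = 0.
  have /(congr1 (fun c => c u * b0)) := da.
  rewrite /codiff mul0r mulr_suml => E; rewrite -[RHS]E.
  rewrite -(big_mkord xpredT (fun i => (-1) ^+ i * a (srestr p (bump i) u) * b0)).
  rewrite [RHS]big_nat_recr //= /a0; congr (_ + _ * _ * _).
        by apply: eq_big_nat => i /andP[_ ip]; rewrite T1.
  congr (a _); rewrite /u srestr_comp; last first.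
    by move=> j jp; rewrite /bump (leqNgt p.+1 j) ltnS jp add0n leqW.
  by apply: eq_srestr => j jp /=; rewrite /bump leqNgt ltnS jp.
have Ew : srestr q (bump 0) w = srestr q (addn p.+1) s.
  rewrite /w srestr_comp; last by move=> j jq; rewrite /bump leq0n add1n ltnS.
  by apply: eq_srestr => j jq; rewrite /= /bump leq0n add1n addnS.
have db0 : \sum_(p.+1 <= i < p.+1 + q.+1) T i = - ((-1) ^+ p * a0 * b0).
  have /(congr1 (fun c => (-1) ^+ p * a0 * c w)) := db.
  rewrite /codiff mulr0 mulr_sumr.
  rewrite -(big_mkord xpredT (fun i => (-1) ^+ p * a0 * ((-1) ^+ i * b (srestr q (bump i) w)))).
  rewrite big_nat_recl //= Ew expr0 mul1r -/b0 addrC => /eqP.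
  rewrite addr_eq0 => /eqP <-; rewrite -{1}[p.+1]add0n big_addn addnC addnK.
  by apply: eq_big_nat => i /andP[_ iq]; rewrite addnC T2.
rewrite db0; move: da0; rewrite exprS mulN1r !mulNr => /eqP.
by rewrite addr_eq0 opprK => /eqP ->; rewrite subrr.
Qed.

End Cup.
End Cochains.

Section Diagram.
Variables (K : realType) (R : comPzRingType).
Local Notation H n X := (cohomology K R n X).

(* By the Leibniz rule the class does not depend on the representatives. *)
Definition cup X p q (x : H p X) (y : H q X) : H (p + q)%N X :=
  coclass (Cocycle (ccup_cocycle (repr x) (repr y))).

(* H^{n-1}(X, R), with H^{-1} = 0. *)
Definition cohomology_prev n X : zmodType :=
  match n with 0 => 'rV[R]_0 | m.+1 => H m X end.
Local Notation H1 n X := (cohomology_prev n X).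

Definition pull_prev (X Y : topologicalType) (f : continuousType X Y) n :
    H1 n Y -> H1 n X :=
  match n with 0 => fun _ => 0 | m.+1 => fun x => pull f x end.

(* H^{p-1}(Y) x H^q(X) -> H^{p+q-1}(Y x X). *)
Definition cross (Y X : topologicalType) p q : H1 p Y -> H q X -> H1 (p + q)%N (Y * X)%type :=
  match p with
  | 0 => fun _ _ => 0
  | m.+1 => fun a y =>
     cup (pull (mkcts (@fst_continuous Y X)) a) (pull (mkcts (@snd_continuous Y X)) y)
  end.

(* The reduced cohomology of (Z, z0): the kernel of restriction to the base point. *)
Definition reduced (Z : topologicalType) (z0 : Z) n (x : H n Z) : Prop :=
  pull (cst z0 : continuousType unit Z) x = 0.

Section SuspensionIso.
Variable Y : topologicalType.

(* [b] is the image of [a] under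
     H^m(Y) -> H^{m+1}(Y x [0,1], Y x {0,1}) <~~ H^{m+1}(Sigma Y_+, base point),
   the first arrow being the connecting homomorphism applied to the class that
   is [a] on Y x {1} and 0 on Y x {0}: [codiff C] represents it, and [z] is a
   cocycle relative to the base point which pulls back to [codiff C]. *)
Definition suspends m (a : H m Y) (b : H m.+1 (susp_plus K Y)) : Prop :=
  exists (c : cocycle K R m Y) (C : cochain K R m (Y * unit_interval K)%type)
         (z : cocycle K R m.+1 (susp_plus K Y)),
    [/\ a = coclass c /\ b = coclass z,
        cpull (cst (susp_base K (inr tt)) : continuousType unit (susp_plus K Y)) z = 0,
        cpull (cyl_end Y (izero K)) C = 0,
        cpull (cyl_end Y (ione K)) C = c &
        cpull (cyl_susp_plus K Y) z = codiff C].

(* The suspension isomorphism H^{n-1}(Y) -> reduced H^n(Sigma Y_+). *)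
Definition suspension n : H1 n Y -> H n (susp_plus K Y) :=
  match n with
  | 0 => fun _ => 0
  | m.+1 => fun a => xget 0 [set b | suspends a b]
  end.

(* The inverse isomorphism.  It is used on all of H^n, which is reduced for
   n > 0; for n = 0 the target vanishes. *)
Definition desuspension n (b : H n (susp_plus K Y)) : H1 n Y :=
  xget 0 [set a | suspension a = b].
End SuspensionIso.

Section DeltaS.
Variables (G : topologicalGroupType) (X : topologicalType) (a : left_action G X).

(* delta : H^{n-1}(G x X) -> H^n(X_nG). *)
Definition delta n (x : H1 n (G * X)%type) : H n (nquot K a) :=
  pull (nquot_collapse K a) (suspension x).

(* M_X^{n-1}, the image of phi^* - p_2^*. *)
Definition M_image n : {pred H1 n (G * X)%type} := fun c =>
  `[< exists x : H1 n X, c = pull_prev (act_map a) x - pull_prev (snd_map G X) x >].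

Lemma pull_prevB (Y Z : topologicalType) (f : continuousType Y Z) n :
  {morph @pull_prev _ _ f n : x y / x - y}.
Proof. by case: n => [|n] x y /=; [rewrite subrr|exact: pullB]. Qed.

Lemma M_image_zmod_closed n : zmod_closed (@M_image n).
Proof.
split=> [|c e /asboolP[x ->] /asboolP[y ->]]; apply/asboolP.
  by exists 0; rewrite -[0 in RHS](subrr 0) !pull_prevB !subrr.
by exists (x - y); rewrite !pull_prevB opprD addrACA -opprD opprB.
Qed.

HB.instance Definition _ n :=
  GRing.isZmodClosed.Build (H1 n (G * X)%type) (@M_image n) (@M_image_zmod_closed n).

Definition cohomology_mod_M n : zmodType := Quotient.quot (@M_image n).

Definition mod_M n (x : H1 n (G * X)%type) : cohomology_mod_M n := \pi x.

(* The map induced by delta, whose value does not depend on the representative. *)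
Definition delta_bar n (c : cohomology_mod_M n) : H n (nquot K a) := delta (repr c).

Variables (EG BG : topologicalType) (xi : principal_bundle G EG BG) (e0 : EG).
Variable j : continuousType (nquot K a) (nquot K (diag_action a xi)).
Variable gam : continuousType (susp K (1%g : G)) BG.

Definition in_I n (x : H n (hquot a xi)) : Prop := pull (hquot_incl a xi e0) x = 0.

(* S x is the unique c with delta_bar c = gamma'_X^* x, for x in I^n. *)
Definition S_map n (x : H n (hquot a xi)) : cohomology_mod_M n :=
  xget 0 [set c | delta_bar c = pull (borel_map j) x].

(* H^n(BG) -> H^n(Sigma G) -> H^n(Sigma G_+) ~~ H^{n-1}(G). *)
Definition gamma_bar n (x : H n BG) : H1 n G :=
  desuspension (pull (susp_plus_group K G) (pull gam x)).

(* Homogeneous pure tensors x (x) y of total degree n, with x in the reduced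
   cohomology of BG.  A sequence of them stands for its sum, so that sequences
   represent all degree n elements of the graded tensor product. *)
Inductive pure_tensor : nat -> Type :=
  PureTensor p q (x : H p BG) (y : H q (hquot a xi)) of
    reduced (pb_proj xi e0) x : pure_tensor (p + q)%N.

Definition k_pure n (t : pure_tensor n) : H n (hquot a xi) :=
  match t in pure_tensor n return H n (hquot a xi) with
  | PureTensor p q x y _ => cup (pull (hquot_proj a xi) x) y
  end.

Definition tilde_S_pure n (t : pure_tensor n) : H1 n (G * X)%type :=
  match t in pure_tensor n return H1 n (G * X)%type with
  | PureTensor p q x y _ => cross (gamma_bar x) (pull (hquot_incl a xi e0) y)
  end.

Definition k_map n (t : seq (pure_tensor n)) : H n (hquot a xi) :=
  \sum_(u <- t) k_pure u.

Definition tilde_S n (t : seq (pure_tensor n)) : H1 n (G * X)%type :=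
  \sum_(u <- t) tilde_S_pure u.

End DeltaS.
End Diagram.

Arguments contracts_to {K E} e0 F.
Arguments canonical_adjoint {K G E B} xi e0 F gam.
Arguments homotopy_inverse K {X Y} f g.
Arguments nquot_fst K {G X E B} a xi.
Arguments in_I {K R G X a EG BG} xi e0 {n} x.
Arguments S_map {K R G X a EG BG xi} j {n} x.
Arguments k_map {K R G X a EG BG xi e0 n} t.
Arguments tilde_S {K R G X a EG BG xi e0} gam {n} t.
Arguments mod_M {K R G X} a {n} x.
Arguments pure_tensor K R {G X} a {EG BG} xi e0 n.

(* Main.v *)
(* S is determined by delta, so the diagram commutes as soon as
   delta (gamma_bar x * alpha^* y) = gamma'_X^* (beta^* x . y).  Pull this back
   along the homotopy equivalence (X x EG)_nG -> X_nG.  There the cochain E on EG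
   obtained by integrating x along the contraction of EG is a primitive of the
   pullback of x, so E . y is a primitive of beta^* x . y on X x EG; the failure
   of E to be invariant under the action is the class gamma_bar x on G, which is
   what delta records.  Comparing cochains on X_nG requires exactness of its
   Mayer-Vietoris sequence, that is, subdivision into small simplices.

   Subdivision and prism operators are handled dually, as operations on
   functions of lists of vertices: with K_p phi s = phi (p :: s) the coboundary
   is d phi (p :: s) = phi s - d (K_p phi) s, and chain maps and homotopies are
   defined by recursion on cones. *)

Require Import Defs.
From mathcomp Require Import all_boot all_order all_algebra ring_quotient ring lra.
From mathcomp Require Import all_classical reals topology normedtype sequences.

Set Implicit Arguments.
Unset Strict Implicit.
Unset Printing Implicit Defensive.

Import Order.TTheory GRing.Theory Num.Theory.
Import numFieldNormedType.Exports.

Local Open Scope classical_set_scope.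
Local Open Scope ring_scope.

(** * Cochains on lists of vertices *)

(** The obstacle is that singular cochains do not glue along closed pieces: a simplex of X_nG may
    cross the ends of the cylinder. The remedy is [hc_stretch], a self-map homotopic to the identity
    that squeezes collars of width 1/4 onto the base. Cochains on the base and on the cylinder that
    agree at the ends then determine values on all simplices of an open cover, and the cochains
    vanishing on such simplices form an exact complex, which absorbs the rest. Only the two ends
    matter, so this is done for an abstract [hocoequalizer]; Sigma(Y_+) is the case of two maps from
    Y to a point, and the suspension isomorphism comes from the same gluing.

    Integrals over [0,1] are kept strict. In positive degree the reduced class x is represented by a
    cocycle that is zero on constant simplices at the base point, so prisms over constant maps are
    zero and not merely coboundaries. In degree 0 a reduced class is itself zero, as BG is the image
    of the contractible EG. The factor y needs no integration: its pullback to X x EG is invariant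
    on the nose. *)

Section VertexCochains.
Variables (R : comPzRingType).
Implicit Types V W : Type.

Definition vcone V (p : V) (phi : seq V -> R) (s : seq V) : R := phi (p :: s).

(** A list of length k+1 is a k-simplex and the empty list is the augmentation: [vdiff phi [:: p]]
    is [phi [::]]. The complex is therefore acyclic, with [vcone p] as contraction. *)
Fixpoint vdiff V (phi : seq V -> R) (s : seq V) : R :=
  if s is p :: s' then phi s' - vdiff (vcone p phi) s' else 0.

Lemma vdiffB V (phi psi : seq V -> R) s :
  vdiff (fun t => phi t - psi t) s = vdiff phi s - vdiff psi s.
Proof.
elim: s phi psi => [|p s IH] phi psi /=; first by rewrite subrr.
rewrite [vdiff (vcone p (fun t => phi t - psi t)) s]IH; ring.
Qed.

Lemma eq_vdiff V (phi psi : seq V -> R) s :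
  (forall t, (size t).+1 = size s ->
     (forall x, List.In x t -> List.In x s) -> phi t = psi t) ->
  vdiff phi s = vdiff psi s.
Proof.
elim: s phi psi => [//|p s IH] phi psi eqs /=.
rewrite eqs //; last by move=> x; right.
congr (_ - _); apply: IH => t st ts; apply: eqs => /=; first by rewrite st.
by move=> x [<-|xt]; [left|right; exact: ts].
Qed.

Lemma eq_vdiff_size V (phi psi : seq V -> R) s :
  (forall t, (size t).+1 = size s -> phi t = psi t) -> vdiff phi s = vdiff psi s.
Proof. by move=> e; apply: eq_vdiff => t st _; apply: e. Qed.

Lemma vdiff0 V (s : seq V) : vdiff (fun=> 0 : R) s = 0.
Proof. by elim: s => //= p s; rewrite /vcone => ->; rewrite subrr. Qed.

Lemma vdiff_map V W (f : V -> W) (phi : seq W -> R) s :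
  vdiff phi (map f s) = vdiff (phi \o map f) s.
Proof. by elim: s phi => //= p s IH phi; rewrite IH. Qed.

Lemma vdiff_vdiff V (phi : seq V -> R) s : vdiff (vdiff phi) s = 0.
Proof.
elim: s phi => //= p s IH phi.
rewrite [X in _ - X](vdiffB phi (vdiff (vcone p phi))) IH subr0.
exact: subrr.
Qed.

Lemma vdiff_sum V (phi : seq V -> R) (s : seq V) :
  vdiff phi s = \sum_(i < size s) (-1) ^+ i * phi (take i s ++ drop i.+1 s).
Proof.
elim: s phi => [|p s IH] phi /=; first by rewrite big_ord0.
rewrite big_ord_recl /= expr0 mul1r drop0; congr (_ + _).
rewrite IH -sumrN; apply: eq_bigr => i _.
by rewrite exprS mulN1r mulNr.
Qed.

Section ConeHomotopy.
Variables (V W : Type) (A : (seq W -> R) -> seq V -> R) (b : seq V -> W).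
Hypothesis A_nil : forall phi, A phi [::] = 0.
Hypothesis AB : forall phi psi s,
  A (fun t => phi t - psi t) s = A phi s - A psi s.
Hypothesis A_vdiff : forall phi s, A (vdiff phi) s = vdiff (A phi) s.

(** Dual of the acyclic-carrier recursion in which h(s) is the cone from [b s] over A(s) - h(ds). It
    descends to faces, which [vdiff] hides from structural recursion, so the length of [s] serves as
    fuel. *)
Fixpoint vhomotopy_rec n (phi : seq W -> R) (s : seq V) : R :=
  if n is n'.+1 then
    A (vcone (b s) phi) s - vdiff (vhomotopy_rec n' (vcone (b s) phi)) s
  else 0.

Definition vhomotopy phi s := vhomotopy_rec (size s) phi s.

Lemma vhomotopyE phi s : (0 < size s)%N ->
  vhomotopy phi s =
  A (vcone (b s) phi) s - vdiff (vhomotopy (vcone (b s) phi)) s.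
Proof.
rewrite /vhomotopy; case E: (size s) => [//|n] _ /=; congr (_ - _).
by apply: eq_vdiff_size => t; rewrite E => -[->].
Qed.

Lemma vhomotopyB phi psi s :
  vhomotopy (fun t => phi t - psi t) s = vhomotopy phi s - vhomotopy psi s.
Proof.
rewrite /vhomotopy; move: (size s) => n.
elim: n phi psi s => [|n IH] phi psi s /=; first by rewrite subrr.
rewrite [A _ _](AB (vcone (b s) phi)) (@eq_vdiff_size _ _ (fun t =>
  vhomotopy_rec n (vcone (b s) phi) t - vhomotopy_rec n (vcone (b s) psi) t)).
  by rewrite vdiffB; ring.
by move=> t _; rewrite -IH.
Qed.

(* The cone with apex [b s] is a contracting homotopy, up to terms on the faces
   of [s]; these are handled by induction. *)
Lemma vhomotopy_vdiff phi s :
  vdiff (vhomotopy phi) s + vhomotopy (vdiff phi) s = A phi s.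
Proof.
have [n] := ubnP (size s); elim: n => // n IH in phi s *.
rewrite ltnS => sn; case: (posnP (size s)) => [|s0].
  by case: s {sn} => //= _; rewrite addr0 A_nil.
rewrite [vhomotopy (vdiff _) _]vhomotopyE //; set psi := vcone (b s) phi.
(* The relation [vcone p (vdiff phi) = phi - vdiff (vcone p phi)] holds by computation and is pushed
   through [A]; the next rewriting uses it again on the faces of [s]. *)
have -> : A (vcone (b s) (vdiff phi)) s = A phi s - vdiff (A psi) s.
  by rewrite -A_vdiff -AB.
have -> : vdiff (vhomotopy (vcone (b s) (vdiff phi))) s =
          vdiff (vhomotopy phi) s - vdiff (A psi) s.
  transitivity (vdiff (fun t => vhomotopy phi t -
                 (A psi t - vdiff (vhomotopy psi) t)) s).
    apply: eq_vdiff_size => t st.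
    have -> : vcone (b s) (vdiff phi) = fun t => phi t - vdiff psi t by [].
    rewrite vhomotopyB -(IH psi t); last by rewrite st.
    by congr (_ - _); rewrite addrC addKr.
  by rewrite vdiffB (vdiffB (A psi)) vdiff_vdiff subr0.
by ring.
Qed.
End ConeHomotopy.

Section Subdivision.
Variables (V : Type) (b : seq V -> V).

(** Dual of the classical formula in which Sd(s) is the cone from the barycentre over Sd(ds). The
    apex function [b] is still arbitrary. *)
Fixpoint vsubdiv_rec n (phi : seq V -> R) (s : seq V) : R :=
  if n is n'.+1 then vdiff (vsubdiv_rec n' (vcone (b s) phi)) s else phi s.

Definition vsubdiv phi s := vsubdiv_rec (size s) phi s.

Lemma vsubdivE phi s : (0 < size s)%N ->
  vsubdiv phi s = vdiff (vsubdiv (vcone (b s) phi)) s.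
Proof.
rewrite /vsubdiv; case E: (size s) => [//|n] _ /=.
by apply: eq_vdiff_size => t; rewrite E => -[->].
Qed.

Lemma vsubdivB phi psi s :
  vsubdiv (fun t => phi t - psi t) s = vsubdiv phi s - vsubdiv psi s.
Proof.
rewrite /vsubdiv; move: (size s) => n.
elim: n phi psi s => [//|n IH] phi psi s /=.
rewrite -vdiffB; apply: eq_vdiff_size => t _; exact: IH.
Qed.

(** With K the cone, Sd d phi equals d Sd phi - d Sd d K phi; on the faces induction turns Sd d into
    d Sd, and d d = 0 removes the second term. *)
Lemma vsubdiv_vdiff phi s : vsubdiv (vdiff phi) s = vdiff (vsubdiv phi) s.
Proof.
have [n] := ubnP (size s); elim: n => // n IH in phi s *.
rewrite ltnS => sn; case: (posnP (size s)) => [|s0]; first by case: s {sn}.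
rewrite vsubdivE // [RHS](_ : _ = vdiff (vsubdiv phi) s -
  vdiff (vdiff (vsubdiv (vcone (b s) phi))) s); last by rewrite vdiff_vdiff subr0.
rewrite -vdiffB; apply: eq_vdiff_size => t st.
by rewrite (vsubdivB phi (vdiff (vcone (b s) phi))) IH // st.
Qed.

Definition vsubdiv_homotopy :=
  vhomotopy (fun phi s => phi s - vsubdiv phi s) b.

Lemma vsubdiv_homotopyB phi psi s :
  vsubdiv_homotopy (fun t => phi t - psi t) s =
  vsubdiv_homotopy phi s - vsubdiv_homotopy psi s.
Proof. by apply: vhomotopyB => f g t; rewrite vsubdivB; ring. Qed.

Lemma vsubdiv_homotopy_vdiff phi s :
  vdiff (vsubdiv_homotopy phi) s + vsubdiv_homotopy (vdiff phi) s =
  phi s - vsubdiv phi s.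
Proof.
apply: (vhomotopy_vdiff (A := fun phi s => phi s - vsubdiv phi s)).
- by move=> psi; rewrite subrr.
- by move=> f g t; rewrite vsubdivB; ring.
- by move=> f t; rewrite vsubdiv_vdiff vdiffB.
Qed.
End Subdivision.

Lemma vhomotopy_map V V' W W' (A : (seq W -> R) -> seq V -> R) (b : seq V -> W)
    (A' : (seq W' -> R) -> seq V' -> R) (b' : seq V' -> W')
    (g : V -> V') (h : W -> W') phi s :
  (forall psi t, A' psi (map g t) = A (psi \o map h) t) ->
  (forall t, (0 < size t)%N -> b' (map g t) = h (b t)) ->
  vhomotopy A' b' phi (map g s) = vhomotopy A b (phi \o map h) s.
Proof.
move=> AA' bb'; have [n] := ubnP (size s).
elim: n => // n IH in phi s *; rewrite ltnS => sn.
case: (posnP (size s)) => [|s0]; first by case: s {sn}.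
rewrite !vhomotopyE ?size_map // AA' bb' //; congr (_ - _).
by rewrite vdiff_map; apply: eq_vdiff_size => t st /=; rewrite IH // st.
Qed.

Lemma vsubdiv_map V W (g : V -> W) (b : seq V -> V) (c : seq W -> W) phi s :
  (forall t, (0 < size t)%N -> c (map g t) = g (b t)) ->
  vsubdiv c phi (map g s) = vsubdiv b (phi \o map g) s.
Proof.
move=> bc; have [n] := ubnP (size s).
elim: n => // n IH in phi s *; rewrite ltnS => sn.
case: (posnP (size s)) => [|s0]; first by case: s {sn}.
rewrite !vsubdivE ?size_map // bc // vdiff_map.
by apply: eq_vdiff_size => t st /=; rewrite IH // st.
Qed.

(** Any property [G s t] that coning propagates from faces of [s] to [s] holds for every simplex [t]
    of the subdivision of [s], and [phi] is evaluated nowhere else. Both vertex counts and diameter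
    bounds are obtained in this way. *)
Lemma vsubdiv_eq0 V (b : seq V -> V) (G : seq V -> seq V -> Prop) phi s :
  G [::] [::] ->
  (forall s s' t, (size s').+1 = size s -> (forall x, List.In x s' -> List.In x s) ->
     G s' t -> G s (b s :: t)) ->
  (forall t, G s t -> phi t = 0) -> vsubdiv b phi s = 0.
Proof.
move=> G0 GS; have [n] := ubnP (size s).
elim: n => // n IH in phi s *; rewrite ltnS => sn phi0.
case: (posnP (size s)) => [|s0]; first by case: s {sn} phi0 => // phi0 _; apply: phi0.
rewrite vsubdivE // (@eq_vdiff _ _ (fun=> 0)) ?vdiff0 // => t st ts.
apply: IH => [|u Gtu]; first by rewrite st.
by apply: phi0; exact: GS Gtu.
Qed.

(** The homotopy raises the dimension by exactly one, so it reads [phi] only on lists with one more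
    vertex than [s]. On other lengths a [phi] coming from a cochain of fixed degree has no
    meaning. *)
Lemma vhomotopy_eq0 V W (A : (seq W -> R) -> seq V -> R) (b : seq V -> W) phi s :
  (forall psi t, (forall u, size u = size t -> psi u = 0) -> A psi t = 0) ->
  (forall u, size u = (size s).+1 -> phi u = 0) -> vhomotopy A b phi s = 0.
Proof.
move=> A0; have [n] := ubnP (size s).
elim: n => // n IH in phi s *; rewrite ltnS => sn phi0.
case: (posnP (size s)) => [|s0]; first by case: s {sn phi0}.
rewrite vhomotopyE // A0 ?sub0r; last by move=> u us; apply: phi0; rewrite /= us.
rewrite (@eq_vdiff_size _ _ (fun=> 0)) ?vdiff0 ?oppr0 // => t st.
by apply: IH => [|u ut]; [rewrite st|apply: phi0 => /=; rewrite ut st].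
Qed.

Lemma vsubdiv_homotopy_map V W (g : V -> W) (b : seq V -> V) (c : seq W -> W) phi s :
  (forall t, (0 < size t)%N -> c (map g t) = g (b t)) ->
  vsubdiv_homotopy c phi (map g s) = vsubdiv_homotopy b (phi \o map g) s.
Proof.
by move=> bc; apply: vhomotopy_map => // psi t; rewrite (vsubdiv_map _ _ bc).
Qed.

Lemma vsubdiv_homotopy_eq0 V (b : seq V -> V) phi s :
  (forall u, size u = (size s).+1 -> phi u = 0) -> vsubdiv_homotopy b phi s = 0.
Proof.
apply: vhomotopy_eq0 => psi t psi0; rewrite psi0 // sub0r.
rewrite (vsubdiv_eq0 (G := fun s t => size t = size s)) ?oppr0 //.
by move=> {}s s' u ss' _ us' /=; rewrite us'.
Qed.
End VertexCochains.

(** * Barycentric subdivision *)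

Section AffineSimplices.
Variable K : realType.

Lemma simplex_ge0 n (v : simplex K n) i : 0 <= \val v ord0 i.
Proof. by case: v => v /= /set_mem []. Qed.

Lemma simplex_sum1 n (v : simplex K n) : \sum_i \val v ord0 i = 1.
Proof. by case: v => v /= /set_mem []. Qed.

Lemma simplex_subproof n (w : 'rV[K]_n.+1) :
  (forall i, 0 <= w ord0 i) -> \sum_i w ord0 i = 1 -> w \in @std_simplex K n.
Proof. by move=> w0 w1; apply/mem_set. Qed.

Definition mksimplex n (w : 'rV[K]_n.+1) (w0 : forall i, 0 <= w ord0 i)
    (w1 : \sum_i w ord0 i = 1) : simplex K n :=
  exist (fun w => w \in @std_simplex K n) w (simplex_subproof w0 w1).

Section Vertex.
Variables (n : nat) (i : 'I_n.+1).
Let w : 'rV[K]_n.+1 := delta_mx ord0 i.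
Let w0 j : 0 <= w ord0 j. Proof. by rewrite mxE ler0n. Qed.
Let w1 : \sum_j w ord0 j = 1.
Proof.
rewrite (bigD1 i) //= mxE !eqxx big1 ?addr0 // => j /negPf ji.
by rewrite mxE ji andbF.
Qed.
Definition vertex : simplex K n := mksimplex w0 w1.
End Vertex.

Definition vertices n : seq (simplex K n) := [seq vertex i | i <- enum 'I_n.+1].

Lemma size_vertices n : size (vertices n) = n.+1.
Proof. by rewrite size_map size_enum_ord. Qed.

Definition vnth n (s : seq (simplex K n)) i := nth (vertex ord0) s i.

Lemma vnth_vertices n (i : 'I_n.+1) : vnth (vertices n) i = vertex i.
Proof. by rewrite /vnth (nth_map ord0) ?size_enum_ord // nth_ord_enum. Qed.

Lemma rV_continuous (T : topologicalType) n (f : T -> 'rV[K]_n.+1) :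
  (forall j, continuous (fun x => f x ord0 j)) -> continuous f.
Proof.
move=> cf u A [P Pn PA].
have : forall j, nbhs u [set w | P ord0 j (f w ord0 j)] by move=> j; exact: cf.
move=> /filter_forall H; apply: (filterS _ H) => w /= Hw.
by apply: PA => i j; rewrite (ord1 i).
Qed.

Section Affine.
Variables (n k : nat) (s : seq (simplex K n)).

Definition affine_row (v : 'rV[K]_k.+1) : 'rV[K]_n.+1 :=
  \row_j \sum_(i < k.+1) v ord0 i * \val (vnth s i) ord0 j.

Lemma affine_row_continuous : continuous affine_row.
Proof.
apply: rV_continuous => j.
have -> : (fun w : 'rV[K]_k.+1 => affine_row w ord0 j) =
    (fun w => \sum_(i < k.+1) w ord0 i * \val (vnth s i) ord0 j).
  by apply/funext => w; rewrite mxE.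
apply: (@continuous_big K _ +%R) => [|i _]; first exact: add_continuous.
by move=> w; apply: cvgMr_tmp; [exact: (nbhs_filter w)|exact: coord_continuous].
Qed.

Let affine_ge0 (v : simplex K k) j : 0 <= affine_row (\val v) ord0 j.
Proof. by rewrite mxE sumr_ge0 // => i _; rewrite mulr_ge0 ?simplex_ge0. Qed.

Let affine_sum1 (v : simplex K k) : \sum_j affine_row (\val v) ord0 j = 1.
Proof.
under eq_bigr do rewrite mxE.
rewrite exchange_big /= -[RHS](simplex_sum1 v); apply: eq_bigr => i _.
by rewrite -mulr_sumr simplex_sum1 mulr1.
Qed.

Definition affine_fun (v : simplex K k) : simplex K n :=
  mksimplex (affine_ge0 v) (affine_sum1 v).

Lemma affine_continuous : continuous affine_fun.
Proof.
apply: continuous_comp_initial => v.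
apply: (@continuous_comp _ _ _ set_val affine_row).
  exact: initial_continuous.
exact: affine_row_continuous.
Qed.

Definition affine : continuousType (simplex K k) (simplex K n) :=
  mkcts affine_continuous.

Lemma affineE v j :
  \val (affine v) ord0 j = \sum_(i < k.+1) \val v ord0 i * \val (vnth s i) ord0 j.
Proof. by rewrite mxE. Qed.
End Affine.

Lemma affine_smap n k l (s : seq (simplex K n)) t (f : 'I_l.+1 -> 'I_k.+1) v :
  (forall i : 'I_l.+1, vnth t i = vnth s (f i)) ->
  affine k s (smap K f v) = affine l t v.
Proof.
move=> ts; apply: val_inj; apply/rowP => j; rewrite !affineE.
rewrite [RHS](partition_big f xpredT) //=; apply: eq_bigr => i _.
rewrite mxE mulr_suml; apply: eq_bigr => i' /eqP <-.
by rewrite ts.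
Qed.

Lemma affine_vertex n l (t : seq (simplex K n)) (f : 'I_l.+1 -> 'I_n.+1) v :
  (forall i : 'I_l.+1, vnth t i = vertex (f i)) -> affine l t v = smap K f v.
Proof.
move=> tf; apply: val_inj; apply/rowP => j; rewrite affineE mxE.
rewrite [RHS]big_mkcond /=; apply: eq_bigr => i _.
by rewrite tf mxE eqxx /= eq_sym; case: eqP => _; rewrite ?mulr1 ?mulr0.
Qed.

Lemma smap_id n (v : simplex K n) : smap K id v = v.
Proof.
apply: val_inj; apply/rowP => j; rewrite mxE (bigD1 j) //= big1 ?addr0 //.
by move=> i /andP[/eqP ->]; rewrite eqxx.
Qed.

Lemma affine_vertices n v : affine n (vertices n) v = v.
Proof.
by rewrite (affine_vertex (f := id)) ?smap_id // => i; rewrite vnth_vertices.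
Qed.

Lemma affine_comp n k l (t : seq (simplex K n)) (s : seq (simplex K k)) v :
  size s = l.+1 ->
  affine k t (affine l s v) = affine l (map (affine k t) s) v.
Proof.
move=> sl; apply: val_inj; apply/rowP => j; rewrite !affineE.
under eq_bigr do rewrite affineE mulr_suml.
rewrite exchange_big /=; apply: eq_bigr => i _.
rewrite /vnth (nth_map (vertex ord0)) ?sl // affineE mulr_sumr.
by apply: eq_bigr => i' _; rewrite mulrA.
Qed.

Lemma affine_at_vertex n k (s : seq (simplex K n)) (i : 'I_k.+1) :
  affine k s (vertex i) = vnth s i.
Proof.
apply: val_inj; apply/rowP => j; rewrite affineE (bigD1 i) //= big1.
  by rewrite mxE !eqxx mul1r addr0.
by move=> i' /negPf ii'; rewrite mxE ii' andbF mul0r.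
Qed.

Lemma map_affine_vertices n k (s : seq (simplex K n)) :
  size s = k.+1 -> map (affine k s) (vertices k) = s.
Proof.
move=> sk; apply: (@eq_from_nth _ (vertex ord0)); first by rewrite size_map size_vertices.
move=> i; rewrite size_map size_vertices => ik.
rewrite (nth_map (vertex ord0)) ?size_vertices //.
by have := vnth_vertices (Ordinal ik); rewrite /vnth /= => ->; rewrite affine_at_vertex.
Qed.

Section Center.
Variable n : nat.
Let w : 'rV[K]_n.+1 := const_mx n.+1%:R^-1.
Let w0 j : 0 <= w ord0 j. Proof. by rewrite mxE invr_ge0 ler0n. Qed.
Let w1 : \sum_j w ord0 j = 1.
Proof.
under eq_bigr do rewrite mxE.
by rewrite sumr_const card_ord -[LHS]mulr_natr mulVf // pnatr_eq0.
Qed.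
Definition simplex_center : simplex K n := mksimplex w0 w1.
End Center.

Definition barycenter n (s : seq (simplex K n)) : simplex K n :=
  affine (size s).-1 s (simplex_center _).

Lemma barycenter_affine n k (t : seq (simplex K n)) (s : seq (simplex K k)) :
  (0 < size s)%N -> barycenter (map (affine k t) s) = affine k t (barycenter s).
Proof.
by move=> s0; rewrite /barycenter affine_comp ?prednK // size_map.
Qed.

(** Balls are convex: the difference from [p] is the same convex combination of the differences at
    the vertices. *)
Lemma ball_affine n k (s : seq (simplex K n)) (p : 'rV[K]_n.+1) r v :
  size s = k.+1 -> (forall x, List.In x s -> `|p - \val x| <= r) ->
  `|p - \val (affine k s v)| <= r.
Proof.
move=> sk sr.
have -> : p - \val (affine k s v) =
    \sum_(i < k.+1) \val v ord0 i *: (p - \val (vnth s i)).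
  under eq_bigr do rewrite scalerBr.
  rewrite sumrB -scaler_suml simplex_sum1 scale1r; congr (_ - _).
  by apply/rowP => j; rewrite affineE summxE; apply: eq_bigr => i _; rewrite mxE.
rewrite (le_trans (ler_norm_sum _ _ _)) // -[leRHS]mul1r -(simplex_sum1 v).
rewrite mulr_suml ler_sum // => i _.
rewrite normrZ ger0_norm ?simplex_ge0 // ler_wpM2l ?simplex_ge0 // sr //.
have : (i < size s)%N by rewrite sk.
rewrite /vnth; elim: s (i : nat) {sk sr} => // x s IH [|j] /=; first by left.
by rewrite ltnS => js; right; exact: IH.
Qed.

End AffineSimplices.

Section SubdivisionShrinks.
Variable K : realType.
Implicit Type n : nat.

Definition diam_le n (s : seq (simplex K n)) (d : K) : Prop :=
  forall x y, List.In x s -> List.In y s -> `|\val x - \val y| <= d.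

(** With [m] vertices the dimension is d = m - 1, and this is the classical factor d/(d+1) of
    barycentric subdivision. *)
Definition shrink_ratio (m : nat) : K := 1 - m%:R^-1.

Lemma shrink_ratio_ge0 m : 0 <= shrink_ratio m.+1.
Proof. by rewrite subr_ge0 invf_le1 ?ltr0n // ler1n. Qed.

Lemma shrink_ratio_lt1 m : shrink_ratio m.+1 < 1.
Proof. by rewrite ltrBlDr ltrDl invr_gt0 ltr0n. Qed.

Lemma shrink_ratioS m : shrink_ratio m.+1 <= shrink_ratio m.+2.
Proof. by rewrite lerD2l lerN2 lef_pV2 ?posrE ?ltr0n // ler_nat. Qed.

Lemma InP n (x : simplex K n) s :
  List.In x s <-> exists2 i, (i < size s)%N & vnth s i = x.
Proof.
rewrite /vnth; elim: s => [|y s IH] /=; first by split=> // -[].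
rewrite IH; split=> [[->|[i si <-]]|[[|i] /= si ix]].
- by exists 0%N.
- by exists i.+1.
- by left.
- by right; exists i.
Qed.

Lemma barycenter_near n (s : seq (simplex K n)) d x :
  diam_le s d -> List.In x s ->
  `|\val (barycenter s) - \val x| <= shrink_ratio (size s) * d.
Proof.
move=> sd /[dup] xs /InP [i si ix].
case E: (size s) (si) => [//|m] im.
have -> : barycenter s = affine m s (simplex_center K m) by rewrite /barycenter E.
have m0 : m.+1%:R != 0 :> K by rewrite pnatr_eq0.
have -> : \val (affine m s (simplex_center K m)) - \val x =
    \sum_(k < m.+1) m.+1%:R^-1 *: (\val (vnth s k) - \val x).
  under eq_bigr do rewrite scalerBr.
  rewrite sumrB sumr_const card_ord scalerMnl.
  rewrite (_ : m.+1%:R^-1 *+ m.+1 = 1); last by rewrite -[LHS]mulr_natr mulVf.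
  rewrite scale1r; congr (_ - _); apply/rowP => j; rewrite affineE summxE.
  by apply: eq_bigr => k _; rewrite !mxE.
(* The summand of [x] itself is zero, so only [m] of the [m.+1] terms of the average remain; this is
   the whole gain. *)
rewrite (bigD1 (Ordinal im)) //= ix subrr scaler0 add0r.
rewrite (le_trans (ler_norm_sum _ _ _)) //.
apply: (@le_trans _ _ (\sum_(k < m.+1 | k != Ordinal im) m.+1%:R^-1 * d)).
  apply: ler_sum => k _; rewrite normrZ ger0_norm ?invr_ge0 ?ler0n //.
  rewrite ler_wpM2l ?invr_ge0 ?ler0n // sd //; apply/InP.
  by exists k; rewrite // E.
rewrite sumr_const cardC1 card_ord /shrink_ratio /= -[leLHS]mulr_natr mulrAC.
rewrite (_ : m%:R = m.+1%:R - 1 :> K); last by rewrite -natr1 addrK.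
by rewrite mulrBr mulr1 mulVf.
Qed.

(** The invariant fed to [vsubdiv_eq0]. Its second clause stands in for membership in the convex
    hull: a closed ball containing the old vertices contains the new ones, which is enough to bound
    their distance to the barycentre. *)
Definition subdivided n (s t : seq (simplex K n)) : Prop :=
  [/\ size t = size s,
      forall (p : 'rV[K]_n.+1) r, (forall x, List.In x s -> `|p - \val x| <= r) ->
        forall x, List.In x t -> `|p - \val x| <= r &
      forall d, diam_le s d -> diam_le t (shrink_ratio (size s) * d)].

Lemma subdivided_cone n (s s' t : seq (simplex K n)) :
  (size s').+1 = size s -> (forall x, List.In x s' -> List.In x s) ->
  subdivided s' t -> subdivided s (barycenter s :: t).
Proof.
move=> ss' s's [ts' ht dt]; split=> [|p r pr x|d sd].
- by rewrite /= ts' ss'.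
- case=> [<-|xt]; first by apply: ball_affine; rewrite // -ss'.
  by apply: ht xt => y /s's; exact: pr.
have bt x : List.In x t -> `|\val (barycenter s) - \val x| <= shrink_ratio (size s) * d.
  by apply: ht => y /s's; exact: barycenter_near.
have d0 : 0 <= d.
  have /sd : List.In (vnth s 0) s by apply/InP; exists 0%N; rewrite // -ss'.
  by move=> /(_ _ (_ : List.In (vnth s 0) s)); rewrite subrr normr0; apply; apply/InP;
    exists 0%N; rewrite // -ss'.
have q0 : 0 <= shrink_ratio (size s) * d.
  by rewrite mulr_ge0 // -ss' shrink_ratio_ge0.
move=> x y [<-|xt] [<-|yt].
- by rewrite subrr normr0.
- exact: bt.
- by rewrite distrC; exact: bt.
apply: (le_trans (dt d _ x y xt yt)); first by move=> z w /s's zs /s's; exact: sd.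
(* An empty [s'] is excluded because [t] has a member; this matters since [shrink_ratio 0] is 1. *)
rewrite ler_wpM2r // -ss'; case: s' t ts' xt {ht dt bt yt s's ss'} => [[]//|z s' t _ _].
exact: shrink_ratioS.
Qed.

Lemma vsubdiv_shrink (R : comPzRingType) n phi (s : seq (simplex K n)) d :
  diam_le s d ->
  (forall t, size t = size s -> diam_le t (shrink_ratio (size s) * d) -> phi t = 0) ->
  vsubdiv (R := R) (@barycenter K n) phi s = 0.
Proof.
move=> sd phi0; apply: (@vsubdiv_eq0 _ _ _ (@subdivided n)).
- by split=> // e _ x y [].
- exact: subdivided_cone.
- by move=> t [ts _ /(_ d sd)]; exact: phi0.
Qed.
End SubdivisionShrinks.

(** * Subdivision of singular cochains *)

Section CochainSubdivision.
Variables (K : realType) (R : comPzRingType) (X : topologicalType).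
Local Notation cochain n := (cochain K R n X).

(** The bridge to the vertex calculus: [c] is read on the affine simplices inside one singular
    simplex. Only lists of length k+1 are meaningful, which is why operators are later shown to be
    local in the length. *)
Definition vertex_cochain k n (c : cochain k) (s : singular K n X) :
    seq (simplex K n) -> R :=
  fun t => c (s \o affine k t : singular K k X).

Lemma vertex_cochain_vertices n (c : cochain n) s :
  vertex_cochain c s (vertices K n) = c s.
Proof.
by congr c; apply/continuousEP => v /=; rewrite affine_vertices.
Qed.

Lemma vertex_cochain_codiff k n (c : cochain k) (s : singular K n X) t :
  size t = k.+2 ->
  vertex_cochain (codiff c) s t = vdiff (vertex_cochain c s) t.
Proof.
move=> tk; rewrite vdiff_sum tk; apply: eq_bigr => i _; congr (_ * c _).
apply/continuousEP => v /=; congr (s _); apply: affine_smap => j.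
rewrite /vnth nth_cat size_take tk ltn_ord inordK; last first.
  by rewrite /bump ltnS; case: (i <= j)%N; rewrite ?add1n ?add0n ?ltn_ord // ltnW.
rewrite /bump; case: leqP => [ij|ji] /=.
  by rewrite nth_drop addSn subnKC // add1n.
by rewrite nth_take.
Qed.

Lemma vertex_cochain_affine k n m (c : cochain k) (s : singular K n X) t u :
  size u = k.+1 ->
  vertex_cochain c (s \o affine m t : singular K m X) u =
  vertex_cochain c s (map (affine m t) u).
Proof.
move=> uk; congr c; apply/continuousEP => v /=.
by rewrite affine_comp.
Qed.

Section Operator.
Variables (O : forall n, (seq (simplex K n) -> R) -> seq (simplex K n) -> R).
Variables (d e : nat).
Hypothesis O_local : forall n phi psi s, size s = e.+1 ->
  (forall t, size t = d.+1 -> phi t = psi t) -> O (n := n) phi s = O psi s.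
Hypothesis O_affine : forall n m (t : seq (simplex K m)) phi s,
  O phi (map (affine n t) s) = O (phi \o map (affine n t)) s.

Definition vertex_operator (c : cochain d) : cochain e :=
  fun s => O (vertex_cochain c s) (vertices K e).

(** By naturality, the value on the vertices of the standard simplex determines the operator on all
    affine simplices. This gives access to faces and to iterates. *)
Lemma vertex_cochain_operator n (c : cochain d) (s : singular K n X) t :
  size t = e.+1 ->
  vertex_cochain (vertex_operator c) s t = O (vertex_cochain c s) t.
Proof.
move=> te; rewrite -[in RHS](map_affine_vertices te) O_affine.
apply: O_local => [|u ud]; first by rewrite size_vertices.
by rewrite vertex_cochain_affine.
Qed.
End Operator.

Lemma vsubdiv_local n (phi psi : seq (simplex K n) -> R) s k :
  size s = k -> (forall t, size t = k -> phi t = psi t) ->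
  vsubdiv (@barycenter K n) phi s = vsubdiv (@barycenter K n) psi s.
Proof.
move=> sk e; apply/eqP; rewrite -subr_eq0 -vsubdivB; apply/eqP.
apply: (vsubdiv_eq0 (G := fun s t => size t = size s)) => //.
  by move=> u u' t uu' _ tu' /=; rewrite tu'.
by move=> t ts; rewrite e ?subrr // ts.
Qed.

Lemma vsubdiv_homotopy_local n (phi psi : seq (simplex K n) -> R) s k :
  size s = k -> (forall t, size t = k.+1 -> phi t = psi t) ->
  vsubdiv_homotopy (@barycenter K n) phi s = vsubdiv_homotopy (@barycenter K n) psi s.
Proof.
move=> sk e; apply/eqP; rewrite -subr_eq0 -vsubdiv_homotopyB; apply/eqP.
by apply: vsubdiv_homotopy_eq0 => t ts; rewrite e ?subrr // ts sk.
Qed.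

Definition csubdiv n : cochain n -> cochain n :=
  @vertex_operator (fun n => vsubdiv (@barycenter K n)) n n.

Definition csubdiv_homotopy n : cochain n.+1 -> cochain n :=
  @vertex_operator (fun n => vsubdiv_homotopy (@barycenter K n)) n.+1 n.

Lemma vertex_cochain_csubdiv n m (c : cochain n) (s : singular K m X) t :
  size t = n.+1 ->
  vertex_cochain (csubdiv c) s t = vsubdiv (@barycenter K m) (vertex_cochain c s) t.
Proof.
apply: vertex_cochain_operator => [k phi psi u un|k l u phi v].
  exact: vsubdiv_local.
by apply: vsubdiv_map => {}v; exact: barycenter_affine.
Qed.

Lemma vertex_cochain_csubdiv_homotopy n m (c : cochain n.+1) (s : singular K m X) t :
  size t = n.+1 ->
  vertex_cochain (csubdiv_homotopy c) s t =
  vsubdiv_homotopy (@barycenter K m) (vertex_cochain c s) t.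
Proof.
apply: vertex_cochain_operator => [k phi psi u un|k l u phi v].
  exact: vsubdiv_homotopy_local.
by apply: vsubdiv_homotopy_map => {}v; exact: barycenter_affine.
Qed.

Lemma codiff_vdiff n (c : cochain n) (s : singular K n.+1 X) :
  codiff c s = vdiff (vertex_cochain c s) (vertices K n.+1).
Proof.
by rewrite -vertex_cochain_codiff ?size_vertices // vertex_cochain_vertices.
Qed.

Lemma codiff_csubdiv n (c : cochain n) : codiff (csubdiv c) = csubdiv (codiff c).
Proof.
apply/funext => s; rewrite codiff_vdiff /csubdiv /vertex_operator.
transitivity (vdiff (vsubdiv (@barycenter K _) (vertex_cochain c s)) (vertices K n.+1)).
  apply: eq_vdiff_size => t; rewrite size_vertices => -[tn].
  exact: vertex_cochain_csubdiv.
rewrite -vsubdiv_vdiff; apply: vsubdiv_local (size_vertices _ _) _ => t tn.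
by rewrite vertex_cochain_codiff.
Qed.

Lemma codiff_csubdiv_homotopy n (c : cochain n.+1) :
  codiff c = 0 -> codiff (csubdiv_homotopy c) = c - csubdiv c.
Proof.
move=> dc; apply/funext => s; rewrite codiff_vdiff.
transitivity (vdiff (vsubdiv_homotopy (@barycenter K _) (vertex_cochain c s))
               (vertices K n.+1)).
  apply: eq_vdiff_size => t; rewrite size_vertices => -[tn].
  exact: vertex_cochain_csubdiv_homotopy.
have E : vsubdiv_homotopy (@barycenter K n.+1) (vdiff (vertex_cochain c s))
    (vertices K n.+1) = 0.
  apply: vsubdiv_homotopy_eq0 => u; rewrite size_vertices => un.
  by rewrite -vertex_cochain_codiff // dc.
rewrite -[LHS]addr0 -E vsubdiv_homotopy_vdiff vertex_cochain_vertices.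
congr (_ - _).
Qed.

Definition small_simplex (U : set (set X)) n (s : singular K n X) : Prop :=
  exists2 O, U O & forall v, O (s v).

Definition vanishes_on_small (U : set (set X)) n (c : cochain n) : Prop :=
  forall s : singular K n X, small_simplex U s -> c s = 0.

End CochainSubdivision.

(** * Lebesgue numbers and cochains vanishing on small simplices *)

Section LebesgueNumber.
Variable K : realType.

Lemma std_simplex_closed n : closed (@std_simplex K n).
Proof.
rewrite (_ : @std_simplex K n =
  \bigcap_(i in [set: 'I_n.+1]) ((fun w : 'rV[K]_n.+1 => w ord0 i) @^-1` [set t | 0 <= t])
  `&` (fun w : 'rV[K]_n.+1 => \sum_i w ord0 i) @^-1` [set t | t = 1]).
  apply: closedI.
    apply: closed_bigI => i _; apply: preimage_closed; last exact: closed_ge.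
    by move=> w _; exact: coord_continuous.
  apply: preimage_closed; last exact: closed_eq.
  move=> w _; apply: (@continuous_big K _ +%R) => [|i _]; first exact: add_continuous.
  exact: coord_continuous.
by apply/seteqP; split=> w /= [w0 w1]; split=> // i; [move=> _; exact: w0|exact: w0].
Qed.

Lemma std_simplex_compact n : compact (@std_simplex K n).
Proof.
apply: (subclosed_compact (@std_simplex_closed n) (B :=
  [set v : 'rV[K]_n.+1 | forall i, `[(0 : K), 1]%classic (v ord0 i)])).
  apply: (@rV_compact K _ (fun=> `[(0 : K), 1]%classic)) => i.
  exact: segment_compact.
move=> w [w0 w1] i /=; rewrite in_itv /= w0 -w1 (bigD1 i) //=.
by rewrite lerDl sumr_ge0.
Qed.

Lemma lebesgue_number n (X : topologicalType) (U : set (set X)) (s : singular K n X) :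
  (forall O, U O -> open O) -> (forall x, exists2 O, U O & O x) ->
  exists2 e : K, 0 < e & forall v : simplex K n, exists2 O, U O &
    forall w : simplex K n, `|\val v - \val w| <= e -> O (s w).
Proof.
move=> oU cU.
pose P (e : K) (x : 'rV[K]_n.+1) := exists2 O, U O &
  forall w : simplex K n, `|x - \val w| <= e -> O (s w).
have : \forall e \near (0 : K)^'+, @std_simplex K n `<=` P e.
  apply: (iffLR (compact_near_coveringP _) (@std_simplex_compact n)) => x xs.
  pose v : simplex K n := exist (fun w => w \in @std_simplex K n) x (mem_set xs).
  have [O UO Osv] := cU (s v).
  have : nbhs v (s @^-1` O).
    by apply: (@cts_fun _ _ s); apply: open_nbhs_nbhs; split => //; exact: oU.
  rewrite nbhsE => -[N [[A oA AN] Nv]] Ns.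
  have : nbhs x A by apply: open_nbhs_nbhs; split => //; move: Nv; rewrite -AN.
  move=> /nbhs_ballP [d /= d0 dA].
  (* A ball of radius [d] around [x] is mapped into [O]. Half of [d] pays for moving the centre to
     [x'], the other half for the radius [e], so compactness yields one [e] for all centres. *)
  near=> x' e; have ed : e < d / 2.
    by near: e; apply: nbhs_right_lt; exact: divr_gt0.
  exists O => // w x'we.
  apply: Ns; rewrite -AN /=; apply: dA; rewrite -ball_normE /=.
  rewrite (splitr d) -(subrKA x') (le_lt_trans (ler_normD _ _)) // ltrD //.
    by near: x'; apply/nbhs_ballP; exists (d / 2) => /=; [rewrite divr_gt0|
      move=> y; rewrite -ball_normE].
  exact: le_lt_trans ed.
move=> H; have /filter_ex [e [e0 eP]] : \forall e \near (0:K)^'+,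
    0 < e /\ @std_simplex K n `<=` P e.
  near=> e; split; near: e; [exact: nbhs_right_gt|exact: H].
exists e => // v; apply: eP; exact: (set_mem (valP v)).
Unshelve. all: by end_near.
Qed.
End LebesgueNumber.

Section SmallSimplices.
Variables (K : realType) (R : comPzRingType) (X : topologicalType).
Variable U : set (set X).
Hypothesis U_open : forall O, U O -> open O.
Hypothesis U_cover : forall x, exists2 O, U O & O x.
Local Notation cochain n := (cochain K R n X).

Lemma simplex_diam n : exists D : K, forall s : seq (simplex K n), diam_le s D.
Proof.
have [M [_ /(_ (M + 1))]] := compact_bounded (@std_simplex_compact K n).
rewrite ltrDl ltr01 => /(_ isT) MP; exists (M + 1 + (M + 1)) => s x y _ _.
by rewrite (le_trans (ler_normB _ _)) // lerD // MP //; exact: (set_mem (valP _)).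
Qed.

(** Iterated subdivision brings the diameter below the Lebesgue number of the cover pulled back
    along [s]. The bound [N] therefore depends on [s], and the sum formed below is finite only
    simplex by simplex. *)
Lemma csubdiv_eventually0 n m (c : cochain n) (s : singular K m X) :
  vanishes_on_small U c ->
  exists N, forall j, (N <= j)%N -> forall t, size t = n.+1 ->
    vertex_cochain (iter j (@csubdiv K R X n) c) s t = 0.
Proof.
move=> c0; have [e e0 eP] := lebesgue_number s U_open U_cover.
have [D DP] := simplex_diam m.
pose q := shrink_ratio K n.+1.
have q0 : 0 <= q by exact: shrink_ratio_ge0.
(* The induction is over all lists and diameters at once: one iterate of subdivision is traded for
   one factor [q] in the diameter. *)
have key j t d : size t = n.+1 -> diam_le t d -> q ^+ j * d <= e ->
    vertex_cochain (iter j (@csubdiv K R X n) c) s t = 0.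
  elim: j t d => [|j IH] t d tn td qd.
    have v0 : List.In (vnth t 0) t by apply/InP; exists 0%N; rewrite ?tn.
    have [O UO OP] := eP (vnth t 0); apply: c0; exists O => // v /=.
    apply: OP; apply: ball_affine => // x xt.
    by rewrite (le_trans (td _ _ v0 xt)) // -[leLHS]mul1r -(expr0 q).
  rewrite iterS vertex_cochain_csubdiv //; apply: vsubdiv_shrink td _ => u.
  rewrite tn => un ud; apply: IH un ud _.
  by rewrite mulrA -exprSr.
have : \forall j \near \oo, `|D| * q ^+ j < e.
  have : (fun j => `|D| * q ^+ j) @ \oo --> `|D| * 0.
    apply: cvgMl_tmp; apply: cvg_expr; rewrite ger0_norm //.
    exact: shrink_ratio_lt1.
  by rewrite mulr0 => /cvgr_lt; apply.
move=> [N _ NP]; exists N => j Nj t tn; apply: (key j t D) => //.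
rewrite (le_trans _ (ltW (NP j Nj))) // mulrC ler_wpM2r ?exprn_ge0 //.
exact: ler_norm.
Qed.

Lemma csubdiv_vanishes n (c : cochain n.+1) :
  vanishes_on_small U c -> vanishes_on_small U (csubdiv c) /\
                           vanishes_on_small U (csubdiv_homotopy c).
Proof.
move=> c0.
have vc0 m (s : singular K m X) t : small_simplex U s -> vertex_cochain c s t = 0.
  by move=> [O UO Os]; apply: c0; exists O => // v /=; exact: Os.
split=> s ss.
  apply: (vsubdiv_eq0 (G := fun s t => size t = size s)) => //.
    by move=> u u' t uu' _ tu' /=; rewrite tu'.
  by move=> t _; exact: vc0.
by apply: vsubdiv_homotopy_eq0 => t _; exact: vc0.
Qed.

(* The cochain is the sum of the subdivision homotopies of all iterated
   subdivisions of [c]; it is finite on every simplex. *)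
Lemma small_cochain_exact n (c : cochain n.+1) :
  codiff c = 0 -> vanishes_on_small U c ->
  exists2 e : cochain n, codiff e = c & vanishes_on_small U e.
Proof.
move=> dc c0; pose cj j := iter j (@csubdiv K R X n.+1) c.
have dcj j : codiff (cj j) = 0.
  elim: j => [//|j IH]; rewrite /cj iterS codiff_csubdiv IH.
  apply/funext => s; apply: (vsubdiv_eq0 (G := fun s t => size t = size s)) => //.
  by move=> u u' t uu' _ tu' /=; rewrite tu'.
have cj0 j : vanishes_on_small U (cj j).
  by elim: j => [//|j IH]; rewrite /cj iterS; have [] := csubdiv_vanishes IH.
pose T j s := csubdiv_homotopy (cj j) s.
have NP (s : singular K n X) : exists N, forall j, (N <= j)%N -> T j s = 0.
  have [N NP] := csubdiv_eventually0 s c0; exists N => j Nj.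
  apply: vsubdiv_homotopy_eq0 => u; rewrite size_vertices => un; exact: NP.
pose N s := projT1 (cid (NP s)).
pose e : cochain n := fun s => \sum_(j < N s) T j s.
have eE s M : (N s <= M)%N -> e s = \sum_(j < M) T j s.
  move=> NM; rewrite -(big_mkord xpredT (fun j => T j s)).
  rewrite (big_cat_nat _ (n := N s)) //= big_mkord big_nat [X in _ = _ + X]big1 ?addr0 //.
  by move=> j /andP[Nj _]; exact: (projT2 (cid (NP s))).
exists e; last first.
  move=> s ss; rewrite /e big1 // => j _.
  by have [_] := csubdiv_vanishes (cj0 j); apply.
apply/funext => s.
have [N' N'P] := csubdiv_eventually0 s c0.
(* [M] exceeds the cut-offs of all faces of [s], so the coboundary passes through a common finite
   sum, and it exceeds [N'], so the telescoping sum ends with [cj M s = 0]. *)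
pose M := (N' + \sum_(i < n.+2) N (srestr n (bump i) s))%N.
transitivity (\sum_(j < M) codiff (T j) s).
  rewrite /codiff exchange_big /=; apply: eq_bigr => i _.
  rewrite -mulr_sumr (eE _ M) // /M (bigD1 i) //=.
  by rewrite addnA addnAC leq_addl.
transitivity (\sum_(j < M) (cj j s - cj j.+1 s)).
  by apply: eq_bigr => j _; rewrite (codiff_csubdiv_homotopy (dcj j)).
rewrite -(big_mkord xpredT (fun j => cj j s - cj j.+1 s)).
rewrite (eq_bigr (fun j => - cj j.+1 s - - cj j s)); last by move=> j _; rewrite opprK addrC.
rewrite (telescope_sumr (fun j => - cj j s)) // opprK.
by rewrite -(vertex_cochain_vertices (cj M) s) N'P ?size_vertices ?leq_addr ?oppr0 ?add0r.
Qed.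
End SmallSimplices.

(** * Homotopy invariance *)

Section Prism.
Variables (K : realType) (R : comPzRingType).
Local Notation I := (unit_interval K).
Local Notation cochain n X := (cochain K R n X).

Lemma interval_subproof (w : simplex K 1) :
  \val w ord0 ord_max \in [set t : K | 0 <= t <= 1].
Proof.
case: w => w /= /set_mem [w0 w1]; apply/mem_set => /=.
by rewrite w0 -w1 big_ord_recr /= lerDr sumr_ge0.
Qed.

Definition simplex1_interval (w : simplex K 1) : I :=
  exist (fun t => t \in [set t : K | 0 <= t <= 1]) _ (interval_subproof w).

Lemma simplex1_interval_continuous : continuous simplex1_interval.
Proof.
apply: continuous_comp_initial => v.
apply: (@continuous_comp _ _ _ set_val (fun w : 'rV[K]_2 => w ord0 ord_max)).
  exact: initial_continuous.
exact: coord_continuous.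
Qed.

Definition bool_ord (b : bool) : 'I_2 := if b then ord_max else ord0.

Section PrismSimplex.
Variables (X : topologicalType) (n : nat) (s : singular K n X).
Variables (k : nat) (t : seq ('I_n.+1 * bool)).

(* The simplex of [X * I] with vertices [(s i, b)], for [(i, b)] in [t]. *)
Definition prism_simplex_fun (v : simplex K k) : (X * I)%type :=
  (s (smap K (fun i : 'I_k.+1 => (nth (ord0, false) t i).1) v),
   simplex1_interval
     (smap K (fun i : 'I_k.+1 => bool_ord (nth (ord0, false) t i).2) v)).

Lemma prism_simplex_continuous : continuous prism_simplex_fun.
Proof.
apply: pair_continuous; first exact: compT_continuous (@cts_fun _ _ _) (@cts_fun _ _ s).
exact: compT_continuous (@cts_fun _ _ _) simplex1_interval_continuous.
Qed.

Definition prism_simplex : singular K k (X * I)%type := mkcts prism_simplex_continuous.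
End PrismSimplex.

Definition prism_cochain (X : topologicalType) n k (c : cochain k (X * I)%type) (s : singular K n X)
    (t : seq ('I_n.+1 * bool)) : R := c (prism_simplex s k t).

Definition prism_ends n (phi : seq ('I_n.+1 * bool) -> R) (s : seq 'I_n.+1) : R :=
  phi (map (pair^~ true) s) - phi (map (pair^~ false) s).

(** The product of a simplex with the interval is convex, so every list of its vertices, ordered or
    not, spans a simplex, and any vertex may be the apex. The choice made here is the lower copy of
    the first vertex. *)
Definition prism_apex n (s : seq 'I_n.+1) : 'I_n.+1 * bool := (head ord0 s, false).

Definition vprism n := vhomotopy (@prism_ends n) (@prism_apex n).

Definition prism (X : topologicalType) n (c : cochain n.+1 (X * I)%type) : cochain n X :=
  fun s => vprism (prism_cochain c s) (enum 'I_n.+1).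

Lemma vprism_vdiff n phi (s : seq 'I_n.+1) :
  vdiff (vprism phi) s + vprism (vdiff phi) s = prism_ends phi s.
Proof.
apply: vhomotopy_vdiff => [psi|psi psi' t|psi t]; rewrite /prism_ends ?subrr //.
  by ring.
by rewrite vdiffB !vdiff_map.
Qed.

Lemma vprism_local n (phi psi : seq ('I_n.+1 * bool) -> R) s k :
  size s = k -> (forall t, size t = k.+1 -> phi t = psi t) ->
  vprism phi s = vprism psi s.
Proof.
move=> sk e; apply/eqP; rewrite -subr_eq0 -vhomotopyB; last first.
  by move=> f g t; rewrite /prism_ends; ring.
apply/eqP; apply: vhomotopy_eq0 => [f t f0|t ts].
  by rewrite /prism_ends !f0 ?size_map // subrr.
by rewrite e ?subrr // ts sk.
Qed.

Lemma vprism_map n m (g : 'I_m.+1 -> 'I_n.+1) (phi : seq ('I_n.+1 * bool) -> R) s :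
  vprism phi (map g s) = vprism (phi \o map (fun p => (g p.1, p.2))) s.
Proof.
apply: vhomotopy_map => [psi t|[//|i t] _ //].
by rewrite /prism_ends /= -!map_comp.
Qed.

Lemma nth_remove (T : Type) (d : T) (t : seq T) i j : (i < size t)%N ->
  nth d (take i t ++ drop i.+1 t) j = nth d t (bump i j).
Proof.
move=> it; rewrite nth_cat size_take it /bump; case: leqP => [ij|ji].
  by rewrite nth_drop addSn subnKC // add1n.
by rewrite nth_take.
Qed.

Lemma inord_bump k (i : 'I_k.+2) (j : 'I_k.+1) : (inord (bump i j) : 'I_k.+2) = bump i j :> nat.
Proof.
by rewrite inordK // /bump ltnS; case: (i <= j)%N; rewrite ?add1n ?add0n ?ltn_ord // ltnW.
Qed.

Lemma prism_cochain_codiff (X : topologicalType) n k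
    (c : cochain k (X * I)%type) (s : singular K n X) t :
  size t = k.+2 -> prism_cochain (codiff c) s t = vdiff (prism_cochain c s) t.
Proof.
move=> tk; rewrite vdiff_sum tk; apply: eq_bigr => i _; congr (_ * c _).
apply/continuousEP => v.
change (prism_simplex_fun (k := k.+1) s t (smap K (fun j : 'I_k.+1 => inord (bump i j)) v) =
  prism_simplex_fun s (take i t ++ drop i.+1 t) v).
rewrite /prism_simplex_fun !smap_comp.
by congr pair; [congr (s (smap K _ v))|congr (simplex1_interval (smap K _ v))];
  apply/funext => j /=;
  rewrite nth_remove ?tk // inord_bump.
Qed.

Lemma prism_cochain_srestr (X : topologicalType) n m k
    (c : cochain k (X * I)%type) (s : singular K n X)
    (f : nat -> nat) (t : seq ('I_m.+1 * bool)) : size t = k.+1 ->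
  prism_cochain c (srestr m f s) t =
  prism_cochain c s (map (fun p : 'I_m.+1 * bool => (inord (f p.1) : 'I_n.+1, p.2)) t).
Proof.
move=> tk; congr c; apply/continuousEP => v.
change (prism_simplex_fun (srestr m f s) t v =
  prism_simplex_fun s (map (fun p : 'I_m.+1 * bool => (inord (f p.1) : 'I_n.+1, p.2)) t) v).
rewrite /prism_simplex_fun /srestr [LHS]/= smap_comp.
by congr pair; [congr (s (smap K _ v))|congr (simplex1_interval (smap K _ v))];
  apply/funext => j /=;
  rewrite (nth_map (ord0, false)) // tk.
Qed.

Lemma enum_bump n (i : 'I_n.+2) :
  take i (enum 'I_n.+2) ++ drop i.+1 (enum 'I_n.+2) =
  map (fun j : 'I_n.+1 => inord (bump i j)) (enum 'I_n.+1).
Proof.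
apply: (@eq_from_nth _ ord0) => [|j].
  rewrite size_cat size_take size_drop size_map !size_enum_ord ltn_ord.
  by rewrite subSS subnKC // -ltnS.
rewrite nth_remove ?size_enum_ord // => jn.
have {}jn : (j < n.+1)%N.
  move: jn; rewrite size_cat size_take size_drop !size_enum_ord ltn_ord.
  by rewrite subSS subnKC // -ltnS.
rewrite (nth_map ord0) ?size_enum_ord //; apply: val_inj.
rewrite [RHS]inord_bump !nth_enum_ord // /bump.
by case: (i <= j)%N; rewrite ?add1n ?add0n /= nth_enum_ord // ltnW.
Qed.

Lemma codiff_prism (X : topologicalType) n (c : cochain n.+1 (X * I)%type) (s : singular K n.+1 X) :
  codiff (prism c) s = vdiff (vprism (prism_cochain c s)) (enum 'I_n.+2).
Proof.
rewrite vdiff_sum size_enum_ord; apply: eq_bigr => i _; congr (_ * _).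
rewrite enum_bump vprism_map; apply: (vprism_local (size_enum_ord n.+1)) => t tn.
by rewrite prism_cochain_srestr.
Qed.

Lemma prism_ends_cochain (X : topologicalType) n (c : cochain n (X * I)%type) s :
  prism_ends (prism_cochain c s) (enum 'I_n.+1) =
  cpull (cyl_end X (ione K)) c s - cpull (cyl_end X (izero K)) c s.
Proof.
have smap_enum (b : bool) v :
    s (smap K (fun i : 'I_n.+1 => (nth (ord0, false) (map (pair^~ b) (enum 'I_n.+1)) i).1) v) = s v.
  congr (s _); rewrite -[RHS]smap_id; congr (smap K _ v); apply/funext => i.
  by rewrite (nth_map ord0) ?size_enum_ord //= nth_ord_enum.
congr (_ - _); congr c; apply/continuousEP => v.
  change (prism_simplex_fun s (map (pair^~ true) (enum 'I_n.+1)) v = (s v, ione K)).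
  rewrite /prism_simplex_fun smap_enum; congr pair; apply: val_inj; rewrite /= mxE.
  rewrite (eq_bigl xpredT) ?simplex_sum1 // => i.
  by rewrite (nth_map ord0) ?size_enum_ord.
change (prism_simplex_fun s (map (pair^~ false) (enum 'I_n.+1)) v = (s v, izero K)).
rewrite /prism_simplex_fun smap_enum; congr pair; apply: val_inj; rewrite /= mxE.
by rewrite big1 // => i; rewrite (nth_map ord0) ?size_enum_ord.
Qed.

Lemma prism_homotopy (X : topologicalType) n (c : cochain n.+1 (X * I)%type) :
  codiff (prism c) + prism (codiff c) =
  cpull (cyl_end X (ione K)) c - cpull (cyl_end X (izero K)) c.
Proof.
apply/funext => s; rewrite -[RHS]prism_ends_cochain -vprism_vdiff.
congr (_ + _); first exact: codiff_prism.
apply: (vprism_local (size_enum_ord n.+2)) => t tn.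
by rewrite prism_cochain_codiff.
Qed.

Lemma prism_homotopy0 (X : topologicalType) (c : cochain 0 (X * I)%type) :
  prism (codiff c) =
  cpull (cyl_end X (ione K)) c - cpull (cyl_end X (izero K)) c.
Proof.
apply/funext => s; rewrite -[RHS]prism_ends_cochain -vprism_vdiff.
rewrite (_ : vdiff _ _ = 0) ?add0r.
  apply: (vprism_local (size_enum_ord 1)) => t tn.
  by rewrite prism_cochain_codiff.
rewrite (eq_vdiff_size (psi := fun=> 0)) ?vdiff0 // => t.
by rewrite size_enum_ord => -[]; case: t.
Qed.

Lemma prism0 (X : topologicalType) n : prism (0 : cochain n.+1 (X * I)%type) = 0.
Proof.
apply/funext => s; rewrite /prism /prism_cochain.
by apply: vhomotopy_eq0 => // psi t psi0; rewrite /prism_ends !psi0 ?size_map // subrr.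
Qed.

Lemma prism_natural (X Y : topologicalType) n (f : continuousType X Y)
    (F : continuousType (X * I)%type (Y * I)%type) (c : cochain n.+1 (Y * I)%type) :
  (forall p, F p = (f p.1, p.2)) -> prism (cpull F c) = cpull f (prism c).
Proof.
move=> FE; apply/funext => s; rewrite /prism /cpull /prism_cochain.
congr (vprism _ _); apply/funext => t; congr c; apply/continuousEP => v /=.
by rewrite FE.
Qed.
End Prism.

Section CohomologyHomotopy.
Variables (K : realType) (R : comPzRingType).
Local Notation I := (unit_interval K).
Local Notation cochain n X := (cochain K R n X).
Local Notation H n X := (cohomology K R n X).

Lemma codiff_codiff (X : topologicalType) n (c : cochain n X) : codiff (codiff c) = 0.
Proof.
apply/funext => s; rewrite codiff_vdiff.
rewrite (@eq_vdiff_size _ _ _ (vdiff (vertex_cochain c s))) ?vdiff_vdiff //.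
by move=> t; rewrite size_vertices => -[tn]; rewrite vertex_cochain_codiff.
Qed.

Lemma cpull_comp (X Y Z : topologicalType) (f : continuousType X Y)
    (g : continuousType Y Z) n (c : cochain n Z) :
  cpull (g \o f) c = cpull f (cpull g c).
Proof. by apply/funext => s; congr c; apply/continuousEP. Qed.

Lemma eq_cpull (X Y : topologicalType) (f g : continuousType X Y) n (c : cochain n Y) :
  f =1 g -> cpull f c = cpull g c.
Proof. by move=> fg; have -> : f = g by exact/continuousEP. Qed.

Lemma pull_comp (X Y Z : topologicalType) (f : continuousType X Y)
    (g : continuousType Y Z) n (x : H n Z) : pull (g \o f) x = pull f (pull g x).
Proof.
rewrite -[x]reprK -!/(coclass _) !pull_coclass; congr coclass.
by apply: val_inj; exact: cpull_comp.
Qed.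

Lemma pull_id (X : topologicalType) n (x : H n X) : pull idfun x = x.
Proof.
rewrite -[x in RHS]reprK -/(coclass _) /pull; congr coclass.
apply: val_inj; apply/funext => s /=; rewrite /cpull.
by have -> : (idfun \o s : singular K n X) = s by exact/continuousEP.
Qed.

Lemma coboundary_codiff (X : topologicalType) n (c : cochain n X) : coboundary (codiff c).
Proof. by exists c. Qed.

Lemma coboundaryN (X : topologicalType) n (c : cochain n X) :
  coboundary c -> coboundary (- c).
Proof. by move=> dc; rewrite -sub0r; apply: coboundaryB => //; exact: coboundary0. Qed.

Lemma coboundaryD (X : topologicalType) n (c e : cochain n X) :
  coboundary c -> coboundary e -> coboundary (c + e).
Proof. by move=> dc de; rewrite -[e]opprK; apply: coboundaryB => //; exact: coboundaryN. Qed.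

Lemma coclass_eq0 (X : topologicalType) n (c : cocycle K R n X) :
  coclass c = 0 <-> coboundary (c : cochain n X).
Proof.
have E : coclass (0 : cocycle K R n X) = 0.
  by rewrite -(subrr (0 : cocycle K R n X)) coclassB subrr.
by rewrite -E coclassP subr0.
Qed.

(** Typically applied to the difference of two cochains on a cylinder with equal coboundaries, to
    carry information from one end to the other. *)
Lemma coboundary_prism (X : topologicalType) n (c : cochain n (X * I)%type) :
  codiff c = 0 ->
  coboundary (cpull (cyl_end X (ione K)) c - cpull (cyl_end X (izero K)) c).
Proof.
case: n c => [|n] c dc; first by rewrite -prism_homotopy0 dc prism0.
by rewrite -prism_homotopy dc prism0 addr0; exact: coboundary_codiff.
Qed.

Lemma coboundary_homotopic (X Y : topologicalType) (f g : continuousType X Y) n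
    (c : cochain n Y) :
  homotopic K f g -> codiff c = 0 -> coboundary (cpull f c - cpull g c).
Proof.
move=> [h hP] dc; rewrite -opprB; apply: coboundaryN.
rewrite (_ : cpull f c = cpull (cyl_end X (izero K)) (cpull h c)); last first.
  by rewrite -cpull_comp; apply: eq_cpull => x /=; have [] := hP x.
rewrite (_ : cpull g c = cpull (cyl_end X (ione K)) (cpull h c)); last first.
  by rewrite -cpull_comp; apply: eq_cpull => x /=; have [] := hP x.
by apply: coboundary_prism; rewrite -cpull_codiff dc cpull0.
Qed.

Lemma homotopic_pull (X Y : topologicalType) (f g : continuousType X Y) n (x : H n Y) :
  homotopic K f g -> pull f x = pull g x.
Proof.
move=> fg; apply/coclassP; apply: coboundary_homotopic => //.
exact: codiff_cocycle.
Qed.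
End CohomologyHomotopy.

Section Interval.
Variable K : realType.
Local Notation I := (unit_interval K).

Lemma ival_continuous : continuous (\val : I -> K).
Proof. exact: initial_continuous. Qed.

Lemma ival_ge0 (t : I) : 0 <= \val t. Proof. by case: t => t /= /set_mem /andP[]. Qed.
Lemma ival_le1 (t : I) : \val t <= 1. Proof. by case: t => t /= /set_mem /andP[]. Qed.

Lemma clamp_subproof (t : K) : Num.max 0 (Num.min t 1) \in [set t : K | 0 <= t <= 1].
Proof. by apply/mem_set => /=; rewrite le_max lexx /= ge_max ler01 ge_min lexx orbT. Qed.

Definition clamp (t : K) : I :=
  exist (fun t => t \in [set t : K | 0 <= t <= 1]) _ (clamp_subproof t).

Lemma clampE (t : K) : 0 <= t <= 1 -> \val (clamp t) = t.
Proof. by move=> /andP[t0 t1] /=; rewrite min_l // max_r. Qed.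

Lemma clamp_val (t : I) : clamp (\val t) = t.
Proof. by apply: val_inj; rewrite clampE // ival_ge0 ival_le1. Qed.

Lemma clamp_le0 (t : K) : t <= 0 -> clamp t = izero K.
Proof. by move=> t0; apply: val_inj => /=; rewrite min_l ?max_l // (le_trans t0). Qed.

Lemma clamp_ge1 (t : K) : 1 <= t -> clamp t = ione K.
Proof. by move=> t1; apply: val_inj => /=; rewrite min_r ?max_r. Qed.

Lemma clamp_continuous : continuous clamp.
Proof.
apply: continuous_comp_initial => t.
apply: (@continuous_max K K^o (fun=> 0) (fun t => Num.min t 1)); first exact: cvg_cst.
apply: (@continuous_min K K^o idfun (fun=> 1)); [exact: cvg_id|exact: cvg_cst].
Qed.

Lemma interval_compact : compact [set: I].
Proof.
rewrite (_ : [set: I] = clamp @` `[0, 1]%classic); last first.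
  apply/seteqP; split=> // t _; exists (\val t); rewrite ?clamp_val //.
  by rewrite /= in_itv /= ival_ge0 ival_le1.
apply: continuous_compact; last exact: segment_compact.
by apply: continuous_subspaceT; exact: clamp_continuous.
Qed.

Lemma interval_locally_compact (s : I) (N : set I) : nbhs s N ->
  exists C, [/\ compact C, nbhs s C & C `<=` N].
Proof.
rewrite nbhsE => -[M [[B oB BM] Ms]] MN.
have : nbhs (\val s) B by apply: open_nbhs_nbhs; split => //; move: Ms; rewrite -BM.
move=> /nbhs_ballP [d /= d0 dB].
have Ns : nbhs s ((\val : I -> K) @^-1` [set x | `|\val s - x| <= d / 2]).
  apply: ival_continuous; apply/nbhs_ballP; exists (d / 2); first exact: divr_gt0.
  by move=> t; rewrite -ball_normE /= => /ltW.
exists ((\val : I -> K) @^-1` [set x | `|\val s - x| <= d / 2]); split=> //.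
- apply: subclosed_compact interval_compact _ => //.
  apply: (@preimage_closed _ _ (\val : I -> K)).
    by move=> t _; exact: ival_continuous.
  apply: (@preimage_closed _ _ (fun x : K => `|\val s - x|) [set x | x <= d / 2]).
    move=> x _; apply: (@cvg_norm _ K^o); apply: (@cvgB _ K^o); first exact: cvg_cst.
    exact: cvg_id.
  exact: closed_le.
- by move: Ns; rewrite nbhsE.
- move=> t /= td; apply: MN; rewrite -BM /=; apply: dB; rewrite -ball_normE /=.
  by rewrite (le_lt_trans td) // ltr_pdivrMr // ltr_pMr // ltr1n.
Qed.

(** The tube lemma: compactness of [C] lets one neighbourhood of [x] serve all its points. *)
Lemma tube_open (T Z : topologicalType) (f : T * I -> Z) (C : set I) (O : set Z) :
  continuous f -> compact C -> open O -> open [set x | forall s, C s -> O (f (x, s))].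
Proof.
move=> fc cC oO; rewrite openE => x /= xO; rewrite /interior.
have := iffLR (compact_near_coveringP _) cC T (nbhs x) (fun x s => O (f (x, s))) _.
apply=> s Cs.
have : nbhs (x, s) (f @^-1` O) by apply: fc; apply: open_nbhs_nbhs; split=> //; exact: xO.
by move=> [[P Q] [/= xP sQ] PQ]; exists (Q, P) => // -[s' x'] [/= Qs' Px']; exact: PQ.
Qed.
End Interval.

(** * Homotopy coequalizers *)

Section HomotopyCoequalizer.
Variables (K : realType) (R : comPzRingType).
Local Notation I := (unit_interval K).
Local Notation cochain n X := (cochain K R n X).

Section Structure.
Variables (Y A Q : topologicalType) (f0 f1 : continuousType Y A).

(** Moving both ends of the cylinder into [A] leaves one representative per point of the quotient,
    so that equality there can be decided on normal forms. *)
Definition hocoeq_normal (u : (Y * I) + A) : (Y * I) + A :=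
  match u with
  | inl p => if \val p.2 == 0 then inr (f0 p.1)
             else if \val p.2 == 1 then inr (f1 p.1) else u
  | inr _ => u
  end.

(* [Q] is the quotient of [Y * I + A] by [(y, 0) ~ f0 y] and [(y, 1) ~ f1 y],
   and [hc_repr] picks the representatives in [Y * (0, 1) + A]. *)
Record hocoequalizer := Hocoequalizer {
  hc_cyl : continuousType (Y * I)%type Q;
  hc_base : continuousType A Q;
  hc_repr : Q -> (Y * I) + A;
  hc_reprK : forall x, match hc_repr x with inl p => hc_cyl p | inr a => hc_base a end = x;
  hc_repr_cyl : forall p, hc_repr (hc_cyl p) = hocoeq_normal (inl p);
  hc_repr_base : forall a, hc_repr (hc_base a) = inr a;
  hc_open : forall O, open (hc_cyl @^-1` O) -> open (hc_base @^-1` O) -> open O }.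
End Structure.

Variables (Y A Q : topologicalType) (f0 f1 : continuousType Y A).
Variable hc : hocoequalizer Q f0 f1.
Local Notation q := (hc_cyl hc).
Local Notation i := (hc_base hc).

Lemma hc_repr_inj x y : hc_repr hc x = hc_repr hc y -> x = y.
Proof. by rewrite -{2}(hc_reprK hc x) -{2}(hc_reprK hc y) => ->. Qed.

Lemma hc_cyl0 y : q (y, izero K) = i (f0 y).
Proof. by apply: hc_repr_inj; rewrite hc_repr_cyl hc_repr_base /= eqxx. Qed.

Lemma hc_cyl1 y : q (y, ione K) = i (f1 y).
Proof.
by apply: hc_repr_inj; rewrite hc_repr_cyl hc_repr_base /= (negPf (@oner_neq0 _)) eqxx.
Qed.

Lemma hc_cases (P : Q -> Prop) :
  (forall p, P (q p)) -> (forall a, P (i a)) -> forall x, P x.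
Proof.
by move=> Pq Pi x; rewrite -(hc_reprK hc x); case: (hc_repr hc x).
Qed.

(* The interval is locally compact, so the product with it preserves the
   quotient topology of [Q]. *)
Lemma hc_prod_continuous (Z : topologicalType) (f : Q * I -> Z) :
  continuous (fun u : (Y * I) * I => f (q u.1, u.2)) ->
  continuous (fun u : A * I => f (i u.1, u.2)) -> continuous f.
Proof.
move=> fq fi [x s] O; rewrite nbhsE => -[O' [oO' fO'] OO'].
have fs : continuous (fun s => f (x, s)).
  move: x {fO'}; apply: hc_cases => [p|a].
    apply: (compT_continuous (f := fun s => (p, s)) _ fq).
    by apply: pair_continuous; [exact: cst_continuous|move=> s'; exact: cvg_id].
  apply: (compT_continuous (f := fun s => (a, s)) _ fi).
  by apply: pair_continuous; [exact: cst_continuous|move=> s'; exact: cvg_id].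
have /interval_locally_compact [C [cC sC CO]] : nbhs s [set s | O' (f (x, s))].
  by apply: fs; exact: open_nbhs_nbhs.
have oW : open [set x' | forall s', C s' -> O' (f (x', s'))].
  by apply: (@hc_open _ _ _ _ _ hc); [exact: tube_open fq cC oO'|exact: tube_open fi cC oO'].
exists ([set x' | forall s', C s' -> O' (f (x', s'))], C).
  split => //=; apply: open_nbhs_nbhs; split=> // s' /CO; exact.
by move=> [x' s'] [/= x'C Cs']; apply: OO'; exact: x'C.
Qed.

(** Maps [1/4, 3/4] affinely onto [0, 1]; after clamping, the two outer quarters go to the ends. *)
Definition stretch (t : K) : K := 2 * t - 2^-1.

(** The straight-line homotopy from the identity to the clamped [stretch]. It fixes both ends, so it
    descends to the quotient. *)
Definition slide_fun (u : I * I) : I :=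
  clamp ((1 - \val u.2) * \val u.1 + \val u.2 * \val (clamp (stretch (\val u.1)))).

Lemma slide_continuous : continuous slide_fun.
Proof.
have v1 : continuous (fun u : I * I => \val u.1).
  exact: compT_continuous (@fst_continuous _ _) (@ival_continuous K).
have v2 : continuous (fun u : I * I => \val u.2).
  exact: compT_continuous (@snd_continuous _ _) (@ival_continuous K).
apply: compT_continuous (@clamp_continuous K) => u.
have vs : continuous (fun u : I * I => \val (clamp (stretch (\val u.1)))).
  apply: compT_continuous (@ival_continuous K).
  apply: compT_continuous (@clamp_continuous K) => w.
  apply: (@cvgB _ K^o); last exact: cvg_cst.
  by apply: cvgM; [exact: cvg_cst|exact: v1].
apply: (@cvgD _ K^o); apply: cvgM; [|exact: v1|exact: v2|exact: vs].
by apply: (@cvgB _ K^o); [exact: cvg_cst|exact: v2].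
Qed.

Definition slide : continuousType (I * I)%type I := mkcts slide_continuous.

Lemma val_izero : \val (izero K) = 0. Proof. by []. Qed.
Lemma val_ione : \val (ione K) = 1. Proof. by []. Qed.

Lemma slideE t s : slide (t, s) =
  clamp ((1 - \val s) * \val t + \val s * \val (clamp (stretch (\val t)))).
Proof. by []. Qed.

Lemma slide0 t : slide (t, izero K) = t.
Proof. by rewrite slideE val_izero subr0 mul1r mul0r addr0 clamp_val. Qed.

Lemma slide1 t : slide (t, ione K) = clamp (stretch (\val t)).
Proof. by rewrite slideE val_ione subrr mul0r add0r mul1r clamp_val. Qed.

Lemma slide_at0 s : slide (izero K, s) = izero K.
Proof.
rewrite slideE [clamp (stretch _)]clamp_le0 val_izero.
  by rewrite !mulr0 addr0 clamp_le0.
by rewrite /stretch mulr0 sub0r oppr_le0 invr_ge0.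
Qed.

Lemma slide_at1 s : slide (ione K, s) = ione K.
Proof.
rewrite slideE [clamp (stretch _)]clamp_ge1 val_ione.
  by rewrite !mulr1 subrK clamp_ge1.
by rewrite /stretch; lra.
Qed.

Lemma stretch_lt t : \val t < 4^-1 -> slide (t, ione K) = izero K.
Proof. by move=> t4; rewrite slide1 clamp_le0 // /stretch; lra. Qed.

Lemma stretch_gt t : 3 / 4 < \val t -> slide (t, ione K) = ione K.
Proof. by move=> t4; rewrite slide1 clamp_ge1 // /stretch; lra. Qed.

Definition cyl_slide_fun (u : (Y * I) * I) : Y * I := (u.1.1, slide (u.1.2, u.2)).

Lemma cyl_slide_continuous : continuous cyl_slide_fun.
Proof.
have c1 := compT_continuous (@fst_continuous (Y * I)%type I) (@fst_continuous Y I).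
have c2 := compT_continuous (@fst_continuous (Y * I)%type I) (@snd_continuous Y I).
apply: pair_continuous c1 _.
exact: compT_continuous (pair_continuous c2 (@snd_continuous _ _)) (@cts_fun _ _ slide).
Qed.

Definition cyl_slide : continuousType ((Y * I) * I)%type (Y * I)%type :=
  mkcts cyl_slide_continuous.

Definition cyl_stretch : continuousType (Y * I)%type (Y * I)%type :=
  cyl_slide \o cyl_end (Y * I)%type (ione K).

Definition hc_slide_fun (u : Q * I) : Q :=
  match hc_repr hc u.1 with
  | inl p => q (cyl_slide (p, u.2))
  | inr a => i a
  end.

Lemma cyl_slideE y t s : cyl_slide ((y, t), s) = (y, slide (t, s)).
Proof. by []. Qed.

Lemma hc_slide_cyl p s : hc_slide_fun (q p, s) = q (cyl_slide (p, s)).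
Proof.
rewrite /hc_slide_fun hc_repr_cyl /hocoeq_normal; case: p => y t.
case: eqP => [t0|_]; last case: eqP => [t1|_] //.
- have -> : t = izero K by apply: val_inj.
  by rewrite cyl_slideE slide_at0 hc_cyl0.
- have -> : t = ione K by apply: val_inj.
  by rewrite cyl_slideE slide_at1 hc_cyl1.
Qed.

Lemma hc_slide_base a s : hc_slide_fun (i a, s) = i a.
Proof. by rewrite /hc_slide_fun hc_repr_base. Qed.

Lemma hc_slide_continuous : continuous hc_slide_fun.
Proof.
apply: hc_prod_continuous.
  rewrite (_ : (fun u => _) = q \o cyl_slide); first exact: cts_fun.
  by apply/funext => -[p s]; exact: hc_slide_cyl.
rewrite (_ : (fun u => _) = i \o fst).
  exact: compT_continuous (@fst_continuous _ _) (@cts_fun _ _ i).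
by apply/funext => -[a s]; exact: hc_slide_base.
Qed.

Definition hc_slide : continuousType (Q * I)%type Q := mkcts hc_slide_continuous.

Definition hc_stretch : continuousType Q Q := hc_slide \o cyl_end Q (ione K).

Lemma hc_stretch_cyl p : hc_stretch (q p) = q (cyl_stretch p).
Proof. exact: hc_slide_cyl. Qed.

Lemma hc_stretch_base a : hc_stretch (i a) = i a.
Proof. exact: hc_slide_base. Qed.

Lemma hc_stretch_homotopic : homotopic K idfun hc_stretch.
Proof.
exists hc_slide => x; split=> //.
move: x; apply: hc_cases => [[y t]|a]; last exact: hc_slide_base.
by rewrite [LHS]hc_slide_cyl cyl_slideE slide0.
Qed.

Definition near_base (t : I) : Prop := \val t < 4^-1 \/ 3 / 4 < \val t.

Definition in_cyl (x : Q) (p : Y * I) : Prop := hc_repr hc x = inl p.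

(** Graph of a partial map to [A], defined on the base together with its two open collars. On this
    domain it agrees with [hc_stretch], which is why 1/4 and 3/4 reappear. *)
Definition in_base (x : Q) (a : A) : Prop :=
  match hc_repr hc x with
  | inl p => \val p.2 < 4^-1 /\ a = f0 p.1 \/ 3 / 4 < \val p.2 /\ a = f1 p.1
  | inr a' => a = a'
  end.

Lemma in_cyl_cyl p p' : in_cyl (q p) p' <-> 0 < \val p.2 < 1 /\ p' = p.
Proof.
rewrite /in_cyl hc_repr_cyl /hocoeq_normal.
case: eqP => [t0|/eqP t0]; first by split=> // -[]; rewrite t0 ltxx.
case: eqP => [t1|/eqP t1]; first by split=> // -[]; rewrite t1 ltxx andbF.
split=> [[<-]|[_ ->]] //; split=> //.
by rewrite !lt_neqAle ival_ge0 ival_le1 t1 eq_sym t0.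
Qed.

Lemma in_cyl_base a p : ~ in_cyl (i a) p.
Proof. by rewrite /in_cyl hc_repr_base. Qed.

Lemma in_base_cyl p a : in_base (q p) a <->
  \val p.2 < 4^-1 /\ a = f0 p.1 \/ 3 / 4 < \val p.2 /\ a = f1 p.1.
Proof.
rewrite /in_base hc_repr_cyl /hocoeq_normal.
case: eqP => [->|_]; last case: eqP => [->|_] //; split.
- by move=> ->; left; split=> //; lra.
- by move=> [[_ ->]|[h _]] //; exfalso; lra.
- by move=> ->; right; split=> //; lra.
- by move=> [[h _]|[_ ->]] //; exfalso; lra.
Qed.

Lemma in_base_base a a' : in_base (i a) a' <-> a' = a.
Proof. by rewrite /in_base hc_repr_base. Qed.

Lemma in_cyl_functional x p p' : in_cyl x p -> in_cyl x p' -> p = p'.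
Proof. by rewrite /in_cyl => -> [->]. Qed.

Lemma in_base_functional x a a' : in_base x a -> in_base x a' -> a = a'.
Proof.
rewrite /in_base; case: (hc_repr hc x) => [p|b -> ->] //.
by move=> [[p4 ->]|[p4 ->]] [[p4' ->]|[p4' ->]] //; exfalso; lra.
Qed.

Lemma cyl_interior_open : open [set p : Y * I | 0 < \val p.2 < 1].
Proof.
rewrite (_ : [set _ | _] = (fun p : Y * I => \val p.2) @^-1` `]0, 1[%classic).
  have := compT_continuous (@snd_continuous Y I) (@ival_continuous K).
  by move=> /continuousP; apply; exact: interval_open.
by apply/seteqP; split=> p; rewrite /= in_itv.
Qed.

Lemma cyl_ends_open (N0 N1 : set Y) : open N0 -> open N1 ->
  open [set p : Y * I | \val p.2 < 4^-1 /\ N0 p.1 \/ 3 / 4 < \val p.2 /\ N1 p.1].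
Proof.
have /continuousP c2 := compT_continuous (@snd_continuous Y I) (@ival_continuous K).
have /continuousP c1 := @fst_continuous Y I.
move=> oN0 oN1; apply: openU; apply: openI.
- exact: (c2 [set x | x < 4^-1] (@open_lt _ _)).
- exact: c1.
- exact: (c2 [set x | 3 / 4 < x] (@open_gt _ _)).
- exact: c1.
Qed.

(** Preimages of open sets being open in all of [Q] says two things at once: the domain of the
    partial map is open, and the map is continuous there. *)
Lemma in_cyl_open (N : set (Y * I)) : open N ->
  open [set x | exists2 p, N p & in_cyl x p].
Proof.
move=> oN; apply: (@hc_open _ _ _ _ _ hc).
  rewrite (_ : _ @^-1` _ = N `&` [set p | 0 < \val p.2 < 1]).
    by apply: openI => //; exact: cyl_interior_open.
  apply/seteqP; split=> p /=.
    by move=> [p' Np' /in_cyl_cyl [p01 E]]; split=> //; rewrite -E.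
  by move=> [Np p01]; exists p => //; apply/in_cyl_cyl.
rewrite (_ : _ @^-1` _ = set0); first exact: open0.
by apply/seteqP; split=> a //= [p _ /in_cyl_base].
Qed.

Lemma in_base_open (N : set A) : open N ->
  open [set x | exists2 a, N a & in_base x a].
Proof.
move=> oN; apply: (@hc_open _ _ _ _ _ hc).
  rewrite (_ : _ @^-1` _ = [set p | \val p.2 < 4^-1 /\ (f0 @^-1` N) p.1 \/
                                    3 / 4 < \val p.2 /\ (f1 @^-1` N) p.1]).
    have /continuousP c0 := @cts_fun _ _ f0; have /continuousP c1 := @cts_fun _ _ f1.
    by apply: cyl_ends_open; [exact: c0|exact: c1].
  apply/seteqP; split=> p /=.
    by move=> [a Na /in_base_cyl [[p4 E]|[p4 E]]]; [left|right]; rewrite -E.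
  by move=> [[p4 Np]|[p4 Np]];
    [exists (f0 p.1)|exists (f1 p.1)] => //; apply/in_base_cyl; [left|right].
rewrite (_ : _ @^-1` _ = N) //.
apply/seteqP; split=> a /=; first by move=> [a' Na' /in_base_base <-].
by move=> Na; exists a => //; exact/in_base_base.
Qed.
End HomotopyCoequalizer.

Section SimplexConnected.
Variable K : realType.
Local Notation I := (unit_interval K).

Section Segment.
Variable x : K.
Let w : 'rV[K]_2 := \row_j if j == ord0 then 1 - \val (clamp x) else \val (clamp x).
Let w0 j : 0 <= w ord0 j.
Proof. by rewrite mxE; case: ifP => _; rewrite ?subr_ge0 ?ival_ge0 ?ival_le1. Qed.
Let w1 : \sum_j w ord0 j = 1.
Proof. by rewrite !big_ord_recl big_ord0 !mxE /= addr0 subrK. Qed.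
Definition segment1 : simplex K 1 := mksimplex w0 w1.
End Segment.

Lemma segment1_continuous : continuous segment1.
Proof.
have cc := compT_continuous (@clamp_continuous K) (@ival_continuous K).
apply: continuous_comp_initial; apply: rV_continuous => j.
rewrite [X in continuous X](_ : _ = fun x : K =>
  if j == ord0 then 1 - \val (clamp x) else \val (clamp x)); last first.
  by apply/funext => x; rewrite /= mxE.
case: (j == ord0) => //.
by move=> x; apply: (@cvgB _ K^o); [exact: cvg_cst|exact: cc].
Qed.

Lemma segment1_0 : segment1 0 = vertex K ord0.
Proof.
apply: val_inj; apply/rowP => j; rewrite !mxE eqxx /=.
by case: j => -[|[|//]] /= ?; rewrite ?min_l ?max_l ?subr0.
Qed.

Lemma segment1_1 : segment1 1 = vertex K ord_max.
Proof.
apply: val_inj; apply/rowP => j; rewrite !mxE eqxx /=.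
by case: j => -[|[|//]] /= ?; rewrite ?min_l ?max_r ?subrr.
Qed.

(** Values on both sides of [c] would contradict the intermediate value theorem along the affine
    edge joining the two points. *)
Lemma simplex_avoids n (f : simplex K n -> K) (c : K) : continuous f ->
  (forall v, f v != c) -> (forall v, f v < c) \/ (forall v, c < f v).
Proof.
move=> fc fne; have [[v fv]|] := pselect (exists v, f v < c); last first.
  by move=> nv; right => v; rewrite lt_def fne leNgt; apply/negP => fv; apply: nv; exists v.
left=> w; rewrite ltNge le_eqVlt eq_sym (negPf (fne w)) /=; apply/negP => fw.
pose g x := f (affine 1 [:: v; w] (segment1 x)).
have g0 : g 0 = f v by rewrite /g segment1_0 affine_at_vertex.
have g1 : g 1 = f w by rewrite /g segment1_1 affine_at_vertex.
have gc : {within `[0 : K, 1], continuous g}.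
  apply: continuous_subspaceT.
  exact: compT_continuous (compT_continuous segment1_continuous (@cts_fun _ _ _)) fc.
have [] := @IVT K g 0 1 c ler01 gc.
  by rewrite g0 g1 ge_min le_max (ltW fv) (ltW fw) orbT.
by move=> x _ gx; move: (fne (affine 1 [:: v; w] (segment1 x))); rewrite -/(g x) gx eqxx.
Qed.
End SimplexConnected.

Section RelationPullback.
Variables (K : realType) (R : comPzRingType) (X Z : topologicalType).
Variable rel : X -> Z -> Prop.
Hypothesis rel_functional : forall x z z', rel x z -> rel x z' -> z = z'.

(* Pullback along a partial map, given by its graph. *)
Definition rpull n (c : cochain K R n Z) : cochain K R n X := fun s =>
  match pselect (exists t : singular K n Z, forall v, rel (s v) (t v)) with
  | left h => c (projT1 (cid h))
  | right _ => 0
  end.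

Lemma rpullE n (c : cochain K R n Z) (s : singular K n X) (t : singular K n Z) :
  (forall v, rel (s v) (t v)) -> rpull c s = c t.
Proof.
move=> st; rewrite /rpull; case: pselect => [h|[]]; last by exists t.
congr c; apply/continuousEP => v; apply: rel_functional (st v).
exact: (projT2 (cid h)).
Qed.

(** Lifts are chosen point by point; uniqueness of the value forces the choice to be the partial map
    itself, whose continuity is the openness hypothesis. *)
Lemma rpull_lift n (s : singular K n X) :
  (forall N, open N -> open [set x | exists2 z, N z & rel x z]) ->
  (forall v, exists z, rel (s v) z) ->
  exists t : singular K n Z, forall v, rel (s v) (t v).
Proof.
move=> rel_open /choice [t st].
suff tc : continuous t by exists (mkcts tc).
move=> v N; rewrite nbhsE => -[N' [oN' N'v] NN'].
have : nbhs v (s @^-1` [set x | exists2 z, N' z & rel x z]).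
  apply: (@cts_fun _ _ s); apply: open_nbhs_nbhs.
  by split; [exact: rel_open|exists (t v)].
apply: filterS => w /= [z N'z swz]; apply: NN'.
by rewrite (rel_functional (st w) swz).
Qed.
End RelationPullback.

Section Gluing.
Variables (K : realType) (R : comPzRingType).
Local Notation I := (unit_interval K).
Local Notation cochain n X := (cochain K R n X).
Variables (Y A Q : topologicalType) (f0 f1 : continuousType Y A).
Variable hc : hocoequalizer K Q f0 f1.
Local Notation q := (hc_cyl hc).
Local Notation i := (hc_base hc).
Local Notation end0 := (cyl_end Y (izero K)).
Local Notation end1 := (cyl_end Y (ione K)).
Local Notation stretchY := (cyl_stretch K Y).

(* The cover of [Q] by [Y * (0, 1)] and the set on which stretching maps to [A]. *)
Definition hc_cover (O : set Q) : Prop :=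
  O = [set x | exists2 p, setT p & in_cyl hc x p] \/
  O = [set x | exists2 a, setT a & in_base hc x a].

Lemma hc_cover_open O : hc_cover O -> open O.
Proof.
by move=> [->|->]; [apply: in_cyl_open|apply: in_base_open]; exact: openT.
Qed.

Lemma hc_cover_all x : exists2 O, hc_cover O & O x.
Proof.
case E: (hc_repr hc x) => [p|a].
  by exists [set x | exists2 p, setT p & in_cyl hc x p]; [left|exists p].
exists [set x | exists2 a, setT a & in_base hc x a]; first by right.
by exists a => //=; rewrite /in_base E.
Qed.

Lemma hc_small_cases n (s : singular K n Q) : small_simplex hc_cover s ->
  (exists t : singular K n (Y * I)%type, forall v, in_cyl hc (s v) (t v)) \/
  (exists t : singular K n A, forall v, in_base hc (s v) (t v)).
Proof.
move=> [O [->|->] Os]; [left|right].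
  apply: rpull_lift => [x p p'|N|v]; [exact: in_cyl_functional|exact: in_cyl_open|].
  by have [p _ sp] := Os v; exists p.
apply: rpull_lift => [x p p'|N|v]; [exact: in_base_functional|exact: in_base_open|].
by have [p _ sp] := Os v; exists p.
Qed.

Section GlueCochain.
Variables (n : nat) (B : cochain n A) (C : cochain n (Y * I)%type).
Hypothesis C0 : cpull end0 C = cpull f0 B.
Hypothesis C1 : cpull end1 C = cpull f1 B.

(** Models the pullback under [hc_stretch] of a cochain that need not exist: [B] where stretching
    lands in [A], the stretched [C] inside the open cylinder. A simplex of neither kind gets 0, so
    identities can be expected on small simplices only. *)
Definition glue : cochain n Q := fun s =>
  if `[< exists t : singular K n A, forall v, in_base hc (s v) (t v) >]
  then rpull (in_base hc) B s
  else rpull (in_cyl hc) (cpull stretchY C) s.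

Lemma glue_base (s : singular K n Q) (t : singular K n A) :
  (forall v, in_base hc (s v) (t v)) -> glue s = B t.
Proof.
move=> st; rewrite /glue asboolT; last by exists t.
exact: (rpullE (@in_base_functional _ _ _ _ _ _ hc)).
Qed.

(* As simplices are connected, such a [t] stays near one of the two ends. *)
Lemma glue_near_base (t : singular K n (Y * I)%type) :
  (forall v, near_base (t v).2) ->
  exists2 u : singular K n A, (forall v, in_base hc (q (t v)) (u v)) &
    cpull stretchY C t = B u.
Proof.
move=> tb; have c2 : continuous (fun v => \val (t v).2).
  have c := compT_continuous (@cts_fun _ _ t) (@snd_continuous Y I).
  exact: compT_continuous c (@ival_continuous K).
have c1 : continuous (fun v => (t v).1).
  exact: compT_continuous (@cts_fun _ _ t) (@fst_continuous _ _).
pose t1 : singular K n Y := mkcts c1.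
have [|tlt|tgt] := @simplex_avoids K n _ (2^-1) c2.
- by move=> v; case: (tb v) => tv; apply/eqP => E; rewrite E in tv; lra.
- have t4 v : \val (t v).2 < 4^-1 by case: (tb v) => // ?; have := tlt v; lra.
  exists (f0 \o t1) => [v|]; first by apply/in_base_cyl; left.
  rewrite -[RHS]/(cpull f0 B t1) -C0; congr C; apply/continuousEP => v.
  by rewrite -[LHS]/((t v).1, slide K ((t v).2, ione K)) stretch_lt.
- have t4 v : 3 / 4 < \val (t v).2 by case: (tb v) => // ?; have := tgt v; lra.
  exists (f1 \o t1) => [v|]; first by apply/in_base_cyl; right.
  rewrite -[RHS]/(cpull f1 B t1) -C1; congr C; apply/continuousEP => v.
  by rewrite -[LHS]/((t v).1, slide K ((t v).2, ione K)) stretch_gt.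
Qed.

(** The point is the overlap: a simplex inside the cylinder that also lies in the collars is
    stretched onto an end, where [C0] and [C1] make the two prescriptions agree. *)
Lemma glue_cyl (s : singular K n Q) (t : singular K n (Y * I)%type) :
  (forall v, in_cyl hc (s v) (t v)) -> glue s = cpull stretchY C t.
Proof.
move=> st; rewrite /glue; case: asboolP => [[u su]|_]; last first.
  exact: (rpullE (@in_cyl_functional _ _ _ _ _ _ hc)).
have sE v : s v = q (t v) by rewrite -(hc_reprK hc (s v)) (st v).
have tb v : near_base (t v).2.
  by have := su v; rewrite sE => /in_base_cyl [[tv _]|[tv _]]; [left|right].
have [u' u'P ->] := glue_near_base tb.
by apply: (rpullE (@in_base_functional _ _ _ _ _ _ hc)) => v; rewrite sE.
Qed.

Lemma glue_codiff_cyl (s : singular K n.+1 Q) (t : singular K n.+1 (Y * I)%type) :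
  (forall v, in_cyl hc (s v) (t v)) ->
  codiff glue s = cpull stretchY (codiff C) t.
Proof.
move=> st; rewrite cpull_codiff; apply: eq_bigr => k _; congr (_ * _).
by apply: glue_cyl => v; exact: st.
Qed.

Lemma glue_codiff_base (s : singular K n.+1 Q) (t : singular K n.+1 A) :
  (forall v, in_base hc (s v) (t v)) -> codiff glue s = codiff B t.
Proof.
move=> st; apply: eq_bigr => k _; congr (_ * _).
by apply: glue_base => v; exact: st.
Qed.
End GlueCochain.

Lemma in_cylE x p : in_cyl hc x p -> x = q p.
Proof. by move=> xp; rewrite -(hc_reprK hc x) xp. Qed.

Lemma in_base_stretch x a : in_base hc x a -> hc_stretch hc x = i a.
Proof.
move: x; apply: hc_cases => [[y t]|b] /=; last first.
  by move=> /in_base_base ->; exact: hc_stretch_base.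
rewrite [LHS]hc_stretch_cyl -[cyl_stretch _ _ _]/(y, slide K (t, ione K)).
move=> /in_base_cyl [[/= t4 ->]|[/= t4 ->]].
  by rewrite stretch_lt // hc_cyl0.
by rewrite stretch_gt // hc_cyl1.
Qed.

(* Injectivity of [H^n Q -> H^n A + H^n (Y * I)] on classes whose primitives
   agree on [Y * {0, 1}]. *)
Lemma coboundary_glue n (w : cochain n.+1 Q) (B : cochain n A) (C : cochain n (Y * I)%type) :
  codiff w = 0 -> cpull i w = codiff B -> cpull q w = codiff C ->
  cpull end0 C = cpull f0 B -> cpull end1 C = cpull f1 B -> coboundary w.
Proof.
move=> dw wB wC C0 C1.
(* Both terms agree on small simplices: stretching sends such a simplex into [A] or along the
   cylinder, where [w] is the coboundary of [B] or of [C]. *)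
pose w' := cpull (hc_stretch hc) w - codiff (glue B C).
have [||e de _] := @small_cochain_exact K R Q hc_cover hc_cover_open hc_cover_all n w'.
- by rewrite codiffB -cpull_codiff dw cpull0 codiff_codiff subrr.
- move=> s /hc_small_cases [[t st]|[t st]].
    rewrite -[LHS]/(cpull (hc_stretch hc) w s - codiff (glue B C) s).
    rewrite (glue_codiff_cyl C0 C1 st) -wC -cpull_comp.
    apply/eqP; rewrite subr_eq0; apply/eqP; congr w; apply/continuousEP => v.
    by rewrite /= (in_cylE (st v)) [LHS]hc_stretch_cyl.
  rewrite -[LHS]/(cpull (hc_stretch hc) w s - codiff (glue B C) s).
  rewrite (glue_codiff_base B C st) -wB; apply/eqP; rewrite subr_eq0; apply/eqP.
  by congr w; apply/continuousEP => v; exact: in_base_stretch.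
(* The first bracket is a coboundary because [hc_stretch] is homotopic to the identity, the second
   because [w'] is exact. *)
rewrite (_ : w = (w - cpull (hc_stretch hc) w) + (w' + codiff (glue B C))).
  apply: coboundaryD; last by rewrite -de; apply: coboundaryD; exact: coboundary_codiff.
  rewrite {1}(_ : w = cpull idfun w); last first.
    by apply/funext => s; congr w; apply/continuousEP.
  by apply: coboundary_homotopic => //; exact: hc_stretch_homotopic.
by rewrite subrK subrK.
Qed.

(** The glued cochain is closed only on small simplices. A primitive of its coboundary that vanishes
    on them corrects this without changing the restriction to [A]. On the cylinder the result is the
    stretched [wC] up to [codiff e], and [e] is zero at the ends because they lie inside one member
    of the cover. *)
Lemma hc_extend n (wA : cochain n.+1 A) (wC : cochain n.+1 (Y * I)%type) :
  codiff wA = 0 -> codiff wC = 0 ->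
  cpull end0 wC = cpull f0 wA -> cpull end1 wC = cpull f1 wA ->
  exists (w : cochain n.+1 Q) (e : cochain n (Y * I)%type),
    [/\ codiff w = 0, cpull i w = wA, cpull q w = cpull stretchY wC + codiff e,
        cpull end0 e = 0 & cpull end1 e = 0].
Proof.
move=> dwA dwC C0 C1; pose w0 := glue wA wC.
have [||e de e0] := @small_cochain_exact K R Q hc_cover hc_cover_open hc_cover_all n.+1 (codiff w0).
- exact: codiff_codiff.
- move=> s /hc_small_cases [[t st]|[t st]].
    by rewrite (glue_codiff_cyl C0 C1 st) dwC.
  by rewrite (glue_codiff_base wA wC st) dwA.
pose w := w0 - e.
have dw : codiff w = 0 by rewrite codiffB de subrr.
(* Exactness is used a second time, now on the cylinder with the pulled-back cover, to get a
   primitive of the difference that vanishes near the ends. *)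
have coverY x : exists2 O, [set O | exists2 O', hc_cover O' & O = q @^-1` O'] O & O x.
  by have [O hO Ox] := hc_cover_all (q x); exists (q @^-1` O) => //; exists O.
have coverYo O : [set O | exists2 O', hc_cover O' & O = q @^-1` O'] O -> open O.
  by move=> [O' hO' ->]; have /continuousP := @cts_fun _ _ q; apply; exact: hc_cover_open.
have [||e' de' e'0] := @small_cochain_exact K R _ _ coverYo coverY n
    (cpull q w - cpull stretchY wC).
- by rewrite codiffB -!cpull_codiff dw dwC !cpull0 subrr.
- move=> t [_ [O hO ->] tO].
  have qt : small_simplex hc_cover (q \o t : singular K n.+1 Q) by exists O.
  rewrite -[LHS]/(w0 (q \o t) - e (q \o t) - cpull stretchY wC t) (e0 _ qt) subr0.
  apply/eqP; rewrite subr_eq0; apply/eqP.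
  case: hO tO => -> tO.
    apply: glue_cyl => // v; have [p _] := tO v.
    by move=> /[dup] /in_cyl_cyl [p01 ->].
  have [|u u'P ->] := glue_near_base C0 C1 (t := t).
    by move=> v; have [a _ /in_base_cyl [[]|[]]] := tO v; [left|right].
  exact: glue_base.
have near_end m (s : singular K m Y) (t : I) : near_base t ->
    small_simplex [set O | exists2 O', hc_cover O' & O = q @^-1` O']
      (cyl_end Y t \o s : singular K m (Y * I)%type).
  move=> tb; exists (q @^-1` [set x | exists2 a, setT a & in_base hc x a]).
    by eexists; [right; reflexivity|].
  move=> v /=; case: tb => t4; [exists (f0 (s v))|exists (f1 (s v))] => //.
    by apply/in_base_cyl; left.
  by apply/in_base_cyl; right.
exists w, e'; split=> //.
- apply/funext => s; pose s' : singular K n.+1 Q := i \o s.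
  have si v : in_base hc (s' v) (s v) by apply/in_base_base.
  have e0s : e s' = 0.
    apply: e0; exists [set x | exists2 a, setT a & in_base hc x a]; first by right.
    by move=> v; exists (s v) => //; exact: si.
  by rewrite -[LHS]/(w0 s' - e s') e0s subr0; exact: (glue_base wA wC si).
- by rewrite de' addrCA subrr addr0.
- by apply/funext => s; apply: e'0; apply: near_end; left; rewrite /=; lra.
- by apply/funext => s; apply: e'0; apply: near_end; right; rewrite /=; lra.
Qed.
End Gluing.

(** * The naive quotient and the suspension as homotopy coequalizers *)

Section Instances.
Variable K : realType.
Local Notation I := (unit_interval K).

Section Nquot.
Variables (G : topologicalGroupType) (X : topologicalType) (a : left_action G X).

Lemma nquot_cyl_continuous :
  continuous (fun p : G * X * I => tproj (nquot_rel a) (inl p) : nquot K a).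
Proof. exact: compT_continuous (@inl_continuous _ _) (@tproj_continuous _ _). Qed.

Definition nquot_cyl : continuousType (G * X * I)%type (nquot K a) :=
  mkcts nquot_cyl_continuous.

Lemma nquot_base_continuous :
  continuous (fun x : X => tproj (nquot_rel a) (inr x) : nquot K a).
Proof. exact: compT_continuous (@inr_continuous _ _) (@tproj_continuous _ _). Qed.

Definition nquot_base : continuousType X (nquot K a) := mkcts nquot_base_continuous.

Definition nquot_repr : nquot K a -> (G * X * I) + X :=
  @tlift_fun _ (nquot_rel a) _ (@hocoeq_normal K _ _ (snd_map G X) (act_map a)).

Lemma nquot_reprE u : nquot_repr (tproj _ u) = hocoeq_normal (snd_map G X) (act_map a) u.
Proof.
apply: tlift_funE => _ _ [g x|g x] /=; first by rewrite eqxx.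
by rewrite (negPf (@oner_neq0 _)) eqxx.
Qed.

Lemma nquot_hocoequalizer : hocoequalizer K (nquot K a) (snd_map G X) (act_map a).
Proof.
exists nquot_cyl nquot_base nquot_repr.
- move=> x; rewrite -(treprK x) nquot_reprE; case: (trepr x) => [[[g y] t]|y] //=.
  case: eqP => [t0|_]; first by
    have -> : t = izero K; [exact: val_inj|apply/esym/tproj_rel; constructor].
  case: eqP => [t1|_] //.
  by have -> : t = ione K; [exact: val_inj|apply/esym/tproj_rel; constructor].
- by move=> p; exact: nquot_reprE.
- by move=> y; exact: nquot_reprE.
- by move=> O Oq Oi; split.
Defined.
End Nquot.

Section SuspPlus.
Variable Y : topologicalType.
Local Notation base := (susp_base K (inr tt : plus Y)).

Definition susp_plus_normal (u : plus Y * I) : (Y * I) + unit :=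
  match u.1 with
  | inl y => hocoeq_normal (cst tt : continuousType Y unit) (cst tt) (inl (y, u.2))
  | inr _ => inr tt
  end.

Definition susp_plus_repr : susp_plus K Y -> (Y * I) + unit :=
  @tlift_fun _ _ _ susp_plus_normal.

Lemma susp_plus_reprE u : susp_plus_repr (susp_proj K (inr tt : plus Y) u) = susp_plus_normal u.
Proof.
have collapsedE w : susp_collapsed (inr tt : plus Y) w -> susp_plus_normal w = inr tt.
  case: w => -[y|[]] t //= [//|[|]] /= ->; rewrite /susp_plus_normal /= ?eqxx //.
  by rewrite (negPf (@oner_neq0 _)).
by apply: tlift_funE => v w [/collapsedE -> /collapsedE ->].
Qed.

Lemma susp_plus_projr u t : susp_proj K (inr tt : plus Y) (inr u, t) = base.
Proof. by apply: tproj_rel; case: u; split; left. Qed.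

Lemma susp_plus_cyl_end (y : Y) (t : I) : t = izero K \/ t = ione K ->
  cyl_susp_plus K Y (y, t) = base.
Proof. by move=> ht; apply: tproj_rel; split; right; [|left]. Qed.

Lemma sum_inl_nbhs (B : topologicalType) (y : Y) (N : set Y) :
  nbhs y N -> nbhs (inl y : Y + B) (inl @` N).
Proof.
rewrite nbhsE => -[O [oO Oy] ON].
apply: (@filterS _ _ _ ((inl : Y -> Y + B) @` O)); first exact: image_subset.
apply: open_nbhs_nbhs; split; last by exists y.
split; first by rewrite (_ : _ @^-1` _ = O) //; apply/seteqP; split=> z /=;
  [move=> [z' Oz' [<-]]|move=> Oz; exists z].
rewrite (_ : _ @^-1` _ = set0); first exact: open0.
by apply/seteqP; split=> z //= -[].
Qed.

Lemma sum_inr_unit_open : open [set (inr tt : Y + unit)].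
Proof.
split; last by [].
rewrite (_ : _ @^-1` _ = set0); first exact: open0.
by apply/seteqP; split=> z.
Qed.

(** The added point of [plus Y] contributes only a collapsed interval, so what remains is the
    cylinder on [Y] with both ends sent to one point. *)
Lemma susp_plus_hocoequalizer :
  hocoequalizer K (susp_plus K Y) (cst tt : continuousType Y unit) (cst tt).
Proof.
exists (cyl_susp_plus K Y) (cst base) susp_plus_repr.
- move=> x; rewrite -(treprK x) [susp_plus_repr _]susp_plus_reprE.
  case: (trepr x) => -[y|u] t; last by rewrite [RHS]susp_plus_projr.
  rewrite /susp_plus_normal /=; case: eqP => [t0|_].
    by rewrite [RHS]susp_plus_cyl_end //; left; exact: val_inj.
  case: eqP => [t1|_] //.
  by rewrite [RHS]susp_plus_cyl_end //; right; exact: val_inj.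
- by move=> [y t]; exact: susp_plus_reprE.
- by move=> []; exact: susp_plus_reprE.
- move=> O Oq Oi.
  suff : open (susp_proj K (inr tt : plus Y) @^-1` O) by [].
  rewrite openE => -[[y|u] t] /= Op; rewrite /interior.
    have : nbhs (y, t) (cyl_susp_plus K Y @^-1` O) by apply: open_nbhs_nbhs.
    move=> [[N M] /= [yN tM] NM].
    exists (inl @` N, M); first by split=> //=; exact: sum_inl_nbhs.
    by move=> [_ s] [/= [z Nz <-] Ms]; exact: (NM (z, s)).
  exists ([set inr tt], setT).
    split=> /=; last exact: filterT.
    by apply: open_nbhs_nbhs; split; [exact: sum_inr_unit_open|case: u Op].
  by move=> [_ s] [/= -> _]; rewrite /= susp_plus_projr -(susp_plus_projr u t).
Defined.
End SuspPlus.
End Instances.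

(** * The suspension isomorphism and the long exact sequence *)

Section Suspension.
Variables (K : realType) (R : comPzRingType).
Local Notation I := (unit_interval K).
Local Notation cochain n X := (cochain K R n X).
Local Notation H n X := (cohomology K R n X).

Lemma codiffN (X : topologicalType) n (c : cochain n X) : codiff (- c) = - codiff c.
Proof. by rewrite -sub0r codiffB codiff0 sub0r. Qed.

Lemma codiffD (X : topologicalType) n (c e : cochain n X) :
  codiff (c + e) = codiff c + codiff e.
Proof. by rewrite -{1}[e]opprK codiffB codiffN opprK. Qed.

Lemma cpullN (X Y : topologicalType) (f : continuousType X Y) n (c : cochain n Y) :
  cpull f (- c) = - cpull f c.
Proof. by []. Qed.

Lemma cpullD (X Y : topologicalType) (f : continuousType X Y) n (c e : cochain n Y) :
  cpull f (c + e) = cpull f c + cpull f e.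
Proof. by []. Qed.

Lemma coclass_exists (X : topologicalType) n (x : H n X) :
  exists c : cocycle K R n X, x = coclass c.
Proof. by exists (repr x); rewrite /coclass reprK. Qed.

(** No simplex lies in both ends and a cochain is an arbitrary function on simplices, so the values
    at the ends can be prescribed independently. *)
Lemma cyl_ends_extend (Y : topologicalType) n (c0 c1 : cochain n Y) :
  exists C : cochain n (Y * I)%type,
    cpull (cyl_end Y (izero K)) C = c0 /\ cpull (cyl_end Y (ione K)) C = c1.
Proof.
pose C (t : singular K n (Y * I)%type) : R :=
  let u : singular K n Y := mkcts (@fst_continuous Y I) \o t in
  if `[< forall v, (t v).2 = ione K >] then c1 u else c0 u.
exists C; split; apply/funext => s; rewrite /cpull /C.
  rewrite asboolF; first by congr c0; apply/continuousEP.
  by move=> /(_ (vertex K ord0)) /(congr1 val) /= /eqP; rewrite eq_sym oner_eq0.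
by rewrite asboolT //; congr c1; apply/continuousEP.
Qed.

(** Mismatches at the ends that are coboundaries are absorbed by subtracting [codiff D] from [C],
    with [D] prescribed at the ends. In degree 0 a coboundary is zero and there is nothing to
    absorb. *)
Lemma coboundary_glue_up_to (Y A Q : topologicalType) (f0 f1 : continuousType Y A)
    (hc : hocoequalizer K Q f0 f1) n (w : cochain n.+1 Q) (B : cochain n A)
    (C : cochain n (Y * I)%type) :
  codiff w = 0 -> cpull (hc_base hc) w = codiff B -> cpull (hc_cyl hc) w = codiff C ->
  coboundary (cpull (cyl_end Y (izero K)) C - cpull f0 B) ->
  coboundary (cpull (cyl_end Y (ione K)) C - cpull f1 B) -> coboundary w.
Proof.
case: n w B C => [|n] w B C dw wB wC.
  move=> /= /eqP; rewrite subr_eq0 => /eqP C0 /eqP; rewrite subr_eq0 => /eqP C1.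
  exact: coboundary_glue dw wB wC C0 C1.
move=> [D0 C0] [D1 C1]; have [D [DD0 DD1]] := cyl_ends_extend D0 D1.
apply: (coboundary_glue dw wB (C := C - codiff D)).
- by rewrite codiffB codiff_codiff subr0.
- by rewrite cpullB cpull_codiff DD0 -C0 subKr.
- by rewrite cpullB cpull_codiff DD1 -C1 subKr.
Qed.

Section Suspends.
Variable Y : topologicalType.
Local Notation base := (susp_base K (inr tt : plus Y)).

Lemma cpull_base0 (X : topologicalType) n (z : cochain n (susp_plus K Y)) :
  cpull (cst base : continuousType unit (susp_plus K Y)) z = 0 ->
  cpull (cst base : continuousType X (susp_plus K Y)) z = 0.
Proof.
move=> z0; transitivity (cpull (cst tt : continuousType X unit)
    (cpull (cst base : continuousType unit (susp_plus K Y)) z)).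
  by rewrite -cpull_comp; exact: eq_cpull.
by rewrite z0.
Qed.

Lemma suspends_exists m (a : H m Y) : exists b, suspends a b.
Proof.
have [c ->] := coclass_exists a.
have [C [C0 C1]] := cyl_ends_extend (0 : cochain m Y) c.
have [|||| w [e [dw w0 wC e0 e1]]] :=
  @hc_extend K R Y unit _ _ _ (susp_plus_hocoequalizer K Y) m 0 (codiff C).
- exact: codiff0.
- exact: codiff_codiff.
- by rewrite cpull_codiff C0 codiff0.
- by rewrite cpull_codiff C1 codiff_cocycle.
have dw' : w \in @is_cocycle K R m.+1 (susp_plus K Y) by exact/cocycleP.
(* [C] is replaced by its stretched version plus [e], whose coboundary is exactly the pullback of
   [w]; stretching fixes the ends and [e] is zero there, so the end values survive. *)
exists (coclass (Cocycle dw')), c, (cpull (cyl_stretch K Y) C + e), (Cocycle dw').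
have stretch_end t : t = izero K \/ t = ione K ->
    cpull (cyl_end Y t) (cpull (cyl_stretch K Y) C) = cpull (cyl_end Y t) C.
  move=> ht; rewrite -cpull_comp; apply: eq_cpull => y.
  rewrite -[LHS]/(y, slide K (t, ione K)).
  by case: ht => ->; rewrite ?slide_at0 ?slide_at1.
split=> //.
- by rewrite cpullD stretch_end ?C0 ?e0 ?addr0 //; left.
- by rewrite cpullD stretch_end ?C1 ?e1 ?addr0 //; right.
- by rewrite codiffD -cpull_codiff -wC.
Qed.

Lemma suspendsB m (a a' : H m Y) b b' :
  suspends a b -> suspends a' b' -> suspends (a - a') (b - b').
Proof.
move=> [c [C [z [[-> ->] z0 C0 C1 zC]]]] [c' [C' [z' [[-> ->] z0' C0' C1' zC']]]].
exists (c - c'), (C - C'), (z - z'); split.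
- by rewrite !coclassB.
- by rewrite [LHS](cpullB _ (z : cochain _ _)) z0 z0' subrr.
- by rewrite cpullB C0 C0' subrr.
- by rewrite cpullB C1 C1'.
- by rewrite [LHS](cpullB _ (z : cochain _ _)) zC zC' codiffB.
Qed.

Lemma suspends0_eq0 m b : suspends (0 : H m Y) b -> b = 0.
Proof.
move=> [c [C [z [[/esym/coclass_eq0 c0 ->] z0 C0 C1 zC]]]]; apply/coclass_eq0.
apply: (coboundary_glue_up_to (hc := susp_plus_hocoequalizer K Y) (B := 0) _ _ zC).
- exact: codiff_cocycle.
- by rewrite codiff0; exact: z0.
- by rewrite C0 cpull0 subrr; exact: coboundary0.
- by rewrite C1 cpull0 subr0.
Qed.

(** If [z] is the coboundary of [w], then [C] minus the pullback of [w] is a cocycle on the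
    cylinder. Both ends go to the base point, so [w] contributes equally to them, and the ends
    differ by [c] alone. *)
Lemma suspends_eq0 m (a : H m Y) : suspends a 0 -> a = 0.
Proof.
move=> [c [C [z [[-> /esym/coclass_eq0 [w zw]] z0 C0 C1 zC]]]]; apply/coclass_eq0.
have := @coboundary_prism K R Y m (C - cpull (cyl_susp_plus K Y) w).
rewrite codiffB -cpull_codiff -zw zC subrr => /(_ erefl).
rewrite !cpullB C0 C1 sub0r opprK -!cpull_comp.
rewrite (eq_cpull (f := cyl_susp_plus K Y \o cyl_end Y (ione K))
  (g := cyl_susp_plus K Y \o cyl_end Y (izero K))) ?subrK // => y /=.
by rewrite [LHS]susp_plus_cyl_end ?[RHS]susp_plus_cyl_end //; [left|right].
Qed.

Lemma suspends_functional m (a : H m Y) b b' : suspends a b -> suspends a b' -> b = b'.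
Proof.
by move=> ab /(suspendsB ab); rewrite subrr => /suspends0_eq0 /eqP; rewrite subr_eq0 => /eqP.
Qed.

Lemma suspends_injective m (a a' : H m Y) b : suspends a b -> suspends a' b -> a = a'.
Proof.
by move=> ab /(suspendsB ab); rewrite subrr => /suspends_eq0 /eqP; rewrite subr_eq0 => /eqP.
Qed.

Lemma suspension_suspends m (a : H m Y) : suspends a (suspension (n := m.+1) a).
Proof. by have [b ab] := suspends_exists a; exact: (xgetPex 0 (ex_intro _ b ab)). Qed.

(** Turns the choice made in [desuspension] into a computation: any explicit witness of [suspends]
    determines the value. *)
Lemma desuspensionE m (a : H m Y) b : suspends a b -> desuspension (n := m.+1) b = a.
Proof.
move=> ab; have sab : suspension (n := m.+1) a = b.
  exact: suspends_functional (suspension_suspends a) ab.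
apply: (@suspends_injective m _ _ b) => //.
have : exists a', suspension (n := m.+1) a' = b by exists a.
by move=> /(xgetPex (0 : H m Y)) /= E; rewrite -[b in suspends _ b]E; exact: suspension_suspends.
Qed.

Lemma suspensionB m (a a' : H m Y) : suspension (n := m.+1) (a - a') =
  suspension (n := m.+1) a - suspension (n := m.+1) a'.
Proof.
apply: (suspends_functional (suspension_suspends _)).
by apply: suspendsB; exact: suspension_suspends.
Qed.
End Suspends.
End Suspension.

(** * Exactness at the source of delta *)

Section Delta.
Variables (K : realType) (R : comPzRingType).
Variables (G : topologicalGroupType) (X : topologicalType) (a : left_action G X).
Local Notation I := (unit_interval K).
Local Notation cochain n X := (cochain K R n X).
Local Notation H n X := (cohomology K R n X).
Local Notation H1 n X := (cohomology_prev K R n X).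

Lemma pull0 (Y Z : topologicalType) (f : continuousType Y Z) n : pull f (0 : H n Z) = 0.
Proof. by rewrite -(subrr 0) pullB subrr. Qed.

Lemma deltaB n : {morph @delta K R G X a n : x y / x - y}.
Proof.
case: n => [|m] x y; first by rewrite /delta /= !pull0 subrr.
by rewrite /delta suspensionB pullB.
Qed.

Lemma nquot_collapse_proj u : nquot_collapse K a (tproj _ u) = nquot_collapse_fun u.
Proof. exact: tliftE. Qed.

(** For a cocycle [B] on [X], the primitives are [B] on the base and [C] plus the constant extension
    of [p_2^* B] on the cylinder. They match at 0; at 1 the mismatch is a coboundary because [c]
    represents [phi^* B - p_2^* B]. *)
Lemma delta_M n (x : H1 n (G * X)%type) : x \in @M_image K R G X a n -> delta a x = 0.
Proof.
case: n x => [|m] x; first by move=> _; exact: pull0.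
move=> /asboolP [y /= xE]; have [B yB] := coclass_exists y; rewrite yB in xE.
have [c [C [z [[xc E] z0 C0 C1 zC]]]] := suspension_suspends x.
rewrite /delta E pull_coclass; apply/coclass_eq0.
pose pr : continuousType (G * X * I)%type X :=
  snd_map G X \o mkcts (@fst_continuous (G * X)%type I).
have pr_end t : cpull (cyl_end (G * X)%type t) (cpull pr B) = cpull (snd_map G X) B.
  by rewrite -cpull_comp; exact: eq_cpull.
have dB : codiff (cpull pr B) = 0 by rewrite -cpull_codiff codiff_cocycle cpull0.
apply: (coboundary_glue_up_to (hc := nquot_hocoequalizer K a) (B := B)
  (C := C + cpull pr B)).
- exact: codiff_cocycle.
- rewrite codiff_cocycle -[LHS]cpull_comp -[RHS](cpull_base0 X z0).
  by apply: eq_cpull => x'; exact: nquot_collapse_proj.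
- rewrite codiffD dB addr0 -zC -[LHS]cpull_comp; apply: eq_cpull => p.
  by exact: nquot_collapse_proj.
- by rewrite cpullD pr_end C0 add0r subrr; exact: coboundary0.
- rewrite cpullD pr_end C1 -addrA -opprB.
  have /coclassP : coclass c = coclass (zpull (act_map a) B - zpull (snd_map G X) B).
    by rewrite -xc xE !pull_coclass coclassB.
  by [].
Qed.

(** A primitive [w] of the collapsed cocycle restricts to a cocycle on [X], as collapsing sends [X]
    to the base point. Comparing the ends of the cocycle [C - q^* w] shows that this restriction
    realises [c] as an element of the image. *)
Lemma delta_eq0 n (x : H1 n (G * X)%type) : delta a x = 0 -> x \in @M_image K R G X a n.
Proof.
case: n x => [|m] x.
  by move=> _; apply/asboolP; exists 0; apply/rowP => -[].
have [c [C [z [[xc E] z0 C0 C1 zC]]]] := suspension_suspends x.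
rewrite /delta E pull_coclass => /coclass_eq0 [w zw'].
have {zw'} zw : cpull (nquot_collapse K a) z = codiff w by rewrite -zw'.
pose i := nquot_base K a; pose q := nquot_cyl K a.
have iw : cpull i w \in @is_cocycle K R m X.
  apply/cocycleP; rewrite -cpull_codiff -zw -[LHS]cpull_comp -[RHS](cpull_base0 X z0).
  by apply: eq_cpull => x'; exact: nquot_collapse_proj.
apply/asboolP; exists (coclass (Cocycle iw)).
rewrite xc [RHS]/= !pull_coclass -coclassB; apply/coclassP.
have := @coboundary_prism K R (G * X)%type m (C - cpull q w).
rewrite codiffB -cpull_codiff -zw -cpull_comp.
rewrite (eq_cpull (g := cyl_susp_plus K (G * X)%type)); last first.
  by move=> p; exact: nquot_collapse_proj.
rewrite zC subrr => /(_ erefl); rewrite !cpullB C0 C1 sub0r opprK -!cpull_comp.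
rewrite (eq_cpull (f := q \o cyl_end _ (izero K)) (g := i \o snd_map G X)); last first.
  by move=> [g x']; apply: tproj_rel; constructor.
rewrite (eq_cpull (f := q \o cyl_end _ (ione K)) (g := i \o act_map a)); last first.
  by move=> [g x']; apply: tproj_rel; constructor.
by rewrite !cpull_comp -addrA [- _ + _]addrC -opprB.
Qed.

Lemma delta_barE n (x : H1 n (G * X)%type) : delta_bar (mod_M a x) = delta a x.
Proof.
rewrite /delta_bar; apply/eqP; rewrite -subr_eq0 -deltaB; apply/eqP/delta_M.
have : mod_M a (repr (mod_M a x)) = mod_M a x by rewrite /mod_M reprK.
by rewrite /mod_M => /eqP; rewrite -Quotient.idealrBE.
Qed.

Lemma delta_bar_inj n : injective (@delta_bar K R G X a n).
Proof.
move=> c c' cc'; rewrite -[c]reprK -[c']reprK.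
apply/eqP; rewrite -Quotient.idealrBE; apply: delta_eq0.
by rewrite deltaB -/(delta_bar c) cc' subrr.
Qed.

Lemma S_mapE (EG BG : topologicalType) (xi : principal_bundle G EG BG)
    (j : continuousType (nquot K a) (nquot K (diag_action a xi))) n
    (x : H n (hquot a xi)) (s : H1 n (G * X)%type) :
  delta a s = pull (borel_map j) x -> S_map j x = mod_M a s.
Proof.
move=> ds; apply: delta_bar_inj.
have : exists c, delta_bar c = pull (borel_map j) x by exists (mod_M a s); rewrite delta_barE.
by move=> /(xgetPex (0 : cohomology_mod_M K R a n)) /= ->; rewrite delta_barE.
Qed.
End Delta.

(** * Cup products *)

Section VertexCup.
Variables (R : comPzRingType) (V : Type).
Implicit Types phi psi : seq V -> R.

Definition vcup p phi psi (s : seq V) : R := phi (take p.+1 s) * psi (drop p s).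

Lemma vdiffZ (k : R) phi s : vdiff (fun t => k * phi t) s = k * vdiff phi s.
Proof.
elim: s phi => [|x s IH] phi /=; first by rewrite mulr0.
by rewrite mulrBr -IH.
Qed.

(** Coning from the first vertex affects only the left factor when p > 0, so the Leibniz rule
    follows by induction on [p]. *)
Lemma vdiff_vcup p phi psi (s : seq V) : (p.+1 < size s)%N ->
  vdiff (vcup p phi psi) s =
  vcup p.+1 (vdiff phi) psi s + (-1) ^+ p * vcup p phi (vdiff psi) s.
Proof.
elim: p phi s => [|p IH] phi [|x s] //=; rewrite ltnS => ps.
  case: s ps => [//|y s] _; rewrite (@eq_vdiff_size _ _ (vcone x (vcup 0 phi psi))
      (fun t => phi [:: x] * vcone x psi t)); last by move=> t _; rewrite /vcup /vcone /= take0.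
  rewrite vdiffZ.
  rewrite /vcup /= !take0 ?drop0 expr0 /= /vcone /=; ring.
have -> : vcone x (vcup p.+1 phi psi) = vcup p (vcone x phi) psi by [].
rewrite IH // /vcup /= exprS.
by rewrite [vcone x phi _]/vcone; ring.
Qed.
End VertexCup.

Section Cup.
Variables (K : realType) (R : comPzRingType) (X : topologicalType).
Local Notation cochain n := (cochain K R n X).
Local Notation H n X := (cohomology K R n X).

Lemma vertex_cochain_ccup p q n (a : cochain p) (b : cochain q) (s : singular K n X) t :
  size t = (p + q).+1 ->
  vertex_cochain (ccup a b) s t = vcup p (vertex_cochain a s) (vertex_cochain b s) t.
Proof.
move=> tpq; congr (a _ * b _); apply/continuousEP => v /=; congr (s _);
  apply: affine_smap => i; rewrite /vnth.
  by rewrite nth_take // inordK // ltnS (leq_trans _ (leq_addr _ _)) // -ltnS.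
by rewrite nth_drop inordK // ltnS leq_add2l -ltnS.
Qed.

(** The degrees [(p + q).+1], [p.+1 + q] and [p + q.+1] are not all convertible. Writing the
    coboundary as a sum and leaving [n] free lets one Leibniz formula serve both factors without
    transport. *)
Lemma codiff_ccup_sum p q n (a : cochain p) (b : cochain q) (s : singular K n X) :
  n = (p + q).+1 ->
  \sum_(i < (p + q).+2) (-1) ^+ i * ccup a b (srestr (p + q) (bump i) s) =
  codiff a (srestr p.+1 id s) * b (srestr q (addn p.+1) s) +
  (-1) ^+ p * (a (srestr p id s) * codiff b (srestr q.+1 (addn p) s)).
Proof.
move=> np; subst n.
rewrite -[LHS]/(codiff (ccup a b) s) codiff_vdiff.
rewrite (eq_vdiff_size (psi := vcup p (vertex_cochain a s) (vertex_cochain b s))); last first.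
  by move=> t; rewrite size_vertices => -[]; exact: vertex_cochain_ccup.
rewrite vdiff_vcup ?size_vertices ?ltnS ?leq_addr //.
have sv : size (vertices K (p + q).+1) = (p + q).+2 by exact: size_vertices.
congr (_ + _ * _).
  transitivity (vcup p.+1 (vertex_cochain (codiff a) s) (vertex_cochain b s)
                 (vertices K (p + q).+1)).
    rewrite /vcup vertex_cochain_codiff // size_takel // sv !ltnS; exact: leq_addr.
  by rewrite -(@vertex_cochain_ccup p.+1 q) // vertex_cochain_vertices.
rewrite /vcup -vertex_cochain_codiff ?size_drop ?sv; last first.
  by rewrite -addnS -addnS addKn.
congr (a _ * codiff b _); apply/continuousEP => v /=; congr (s _);
  apply: affine_vertex => i; rewrite -vnth_vertices /vnth.
  rewrite nth_take // inordK //.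
  by rewrite (leq_trans (ltn_ord i)) // ltnS; apply: leqW; exact: leq_addr.
rewrite nth_drop inordK // -!addnS leq_add2l; exact: ltn_ord.
Qed.

Lemma codiff_ccupl p q (a : cochain p) (b : cochain q) : codiff b = 0 ->
  codiff (ccup a b) = ccup (codiff a) b :> cochain (p + q).+1.
Proof.
move=> db; apply/funext => s; rewrite [LHS](codiff_ccup_sum a b s erefl) db.
by rewrite [X in _ + _ * X]mulr0 mulr0 addr0.
Qed.

Lemma coboundary_sum n m (c : cochain n) (b : cochain m) : n = m.+1 ->
  (forall s, c s = \sum_(i < m.+2) (-1) ^+ i * b (srestr m (bump i) s)) -> coboundary c.
Proof. by move=> nm cb; subst n; exists b; apply/funext. Qed.

Lemma coboundary_ccupl p q (a : cochain p) (b : cochain q) :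
  coboundary a -> codiff b = 0 -> coboundary (ccup a b).
Proof.
case: p a => [|p] a /= => [-> _|[c ->] db].
  by rewrite (_ : ccup 0 b = 0); [exact: coboundary0|apply/funext => s; exact: mul0r].
by exists (ccup c b); rewrite codiff_ccupl.
Qed.

Lemma coboundary_ccupr p q (a : cochain p) (b : cochain q) :
  codiff a = 0 -> coboundary b -> coboundary (ccup a b).
Proof.
case: q b => [|q] b /= => [_ ->|da [c ->]].
  by rewrite (_ : ccup a 0 = 0); [exact: coboundary0|apply/funext => s; exact: mulr0].
(* For a cocycle [a] the Leibniz rule gives (-1)^p times the cup of [a] with [codiff c]; the same
   sign in the primitive cancels it. *)
apply: (@coboundary_sum _ (p + q) _ (fun s => (-1) ^+ p * ccup a c s)); first exact: addnS.
move=> s.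
transitivity ((-1) ^+ p *
  \sum_(i < (p + q).+2) (-1) ^+ i * ccup a c (srestr (p + q) (bump i) s)).
  rewrite codiff_ccup_sum ?addnS // da [X in X + _]mul0r add0r mulrA -exprD addnn.
  by rewrite -mul2n exprM sqrrN !expr1n mul1r.
by rewrite mulr_sumr; apply: eq_bigr => i _; rewrite mulrCA.
Qed.

Lemma ccupBl p q (a a' : cochain p) (b : cochain q) :
  ccup (a - a') b = ccup a b - ccup a' b.
Proof. by apply/funext => s; exact: mulrBl. Qed.

Lemma ccupBr p q (a : cochain p) (b b' : cochain q) :
  ccup a (b - b') = ccup a b - ccup a b'.
Proof. by apply/funext => s; exact: mulrBr. Qed.

Lemma cup_coclass p q (a : cocycle K R p X) (b : cocycle K R q X) :
  cup (coclass a) (coclass b) = coclass (Cocycle (ccup_cocycle a b)).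
Proof.
have ra : coboundary (repr (coclass a) - a : cochain p).
  by apply/coclassP; rewrite [LHS]reprK.
have rb : coboundary (repr (coclass b) - b : cochain q).
  by apply/coclassP; rewrite [LHS]reprK.
apply/coclassP => /=.
rewrite (_ : _ - _ = ccup (repr (coclass a) - a : cochain p) (repr (coclass b)) +
  ccup a (repr (coclass b) - b : cochain q)); last first.
  by rewrite ccupBl ccupBr addrA subrK.
apply: coboundaryD; first by apply: coboundary_ccupl => //; exact: codiff_cocycle.
by apply: coboundary_ccupr => //; exact: codiff_cocycle.
Qed.
End Cup.

Lemma cpull_ccup (K : realType) (R : comPzRingType) (X Y : topologicalType)
    (f : continuousType X Y) p q (a : cochain K R p Y) (b : cochain K R q Y) :
  cpull f (ccup a b) = ccup (cpull f a) (cpull f b).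
Proof. by apply/funext => s; congr (a _ * b _); apply/continuousEP. Qed.

Lemma pull_cup (K : realType) (R : comPzRingType) (X Y : topologicalType)
    (f : continuousType X Y) p q (x : cohomology K R p Y) (y : cohomology K R q Y) :
  pull f (cup x y) = cup (pull f x) (pull f y).
Proof.
have [a ->] := coclass_exists x; have [b ->] := coclass_exists y.
rewrite cup_coclass !pull_coclass cup_coclass; congr coclass.
by apply: val_inj; exact: cpull_ccup.
Qed.

(** * Integration along the fibre and the diagram *)

Definition cfst (A B : topologicalType) : continuousType (A * B)%type A :=
  mkcts (@fst_continuous A B).

Definition csnd (A B : topologicalType) : continuousType (A * B)%type B :=
  mkcts (@snd_continuous A B).

Definition cpair (T A B : topologicalType) (f : continuousType T A)
    (g : continuousType T B) : continuousType T (A * B)%type :=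
  mkcts (pair_continuous (@cts_fun _ _ f) (@cts_fun _ _ g)).

Section FiberIntegration.
Variables (K : realType) (R : comPzRingType).
Local Notation I := (unit_interval K).
Local Notation cochain n X := (cochain K R n X).
Local Notation H n X := (cohomology K R n X).

Lemma cpull_cst0 (X Z : topologicalType) (z0 : Z) n (c : cochain n Z)
    (f : continuousType X Z) :
  cpull (cst z0 : continuousType unit Z) c = 0 -> (forall x, f x = z0) -> cpull f c = 0.
Proof.
move=> c0 fz; transitivity (cpull (cst tt : continuousType X unit)
    (cpull (cst z0 : continuousType unit Z) c)).
  by rewrite -cpull_comp; exact: eq_cpull.
by rewrite c0.
Qed.

(** A reduced class restricts to a coboundary at the base point; pulling its primitive back along
    the map to the point and subtracting its coboundary makes the restriction zero as a cochain. *)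
Lemma reduced_cocycle (Z : topologicalType) (z0 : Z) m (x : H m.+1 Z) :
  reduced z0 x -> exists c : cocycle K R m.+1 Z,
    x = coclass c /\ cpull (cst z0 : continuousType unit Z) c = 0.
Proof.
have [c ->] := coclass_exists x; rewrite /reduced pull_coclass.
set u := zpull _ c => /coclass_eq0 [b ub].
pose d := codiff (cpull (cst tt : continuousType Z unit) b).
have dP : (c : cochain _ _) - d \in @is_cocycle K R m.+1 Z.
  by apply/cocycleP; rewrite codiffB codiff_cocycle codiff_codiff subrr.
exists (Cocycle dP); split.
  by apply/coclassP; rewrite /= subKr; exact: coboundary_codiff.
rewrite /= cpullB -[cpull _ c]/(u : cochain _ _) ub /d cpull_codiff -cpull_comp.
rewrite [X in _ - codiff X](_ : _ = b) ?subrr //.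
by apply/funext => s; congr b; apply/continuousEP => v /=; case: (s v).
Qed.

Variable Y : topologicalType.

Lemma scale_continuous : continuous (fun u : I * I => clamp (\val u.1 * \val u.2)).
Proof.
have v1 := compT_continuous (@fst_continuous I I) (@ival_continuous K).
have v2 := compT_continuous (@snd_continuous I I) (@ival_continuous K).
apply: compT_continuous (@clamp_continuous K) => u.
by apply: cvgM; [exact: v1|exact: v2].
Qed.

(** Contraction of the cylinder onto its bottom: the path of (y, t) runs over the segment from (y,
    0) to (y, t). *)
Definition cyl_scale : continuousType ((Y * I) * I)%type (Y * I)%type :=
  cpair (cfst Y I \o cfst (Y * I)%type I)
    (mkcts scale_continuous \o
       cpair (csnd Y I \o cfst (Y * I)%type I) (csnd (Y * I)%type I)).

Lemma cyl_scaleE y t s : cyl_scale ((y, t), s) = (y, clamp (\val t * \val s)).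
Proof. by []. Qed.

Lemma cyl_scale1 y s : cyl_scale ((y, ione K), s) = (y, s).
Proof. by rewrite cyl_scaleE val_ione mul1r clamp_val. Qed.

Lemma cyl_scale_end1 p : cyl_scale (p, ione K) = p.
Proof. by case: p => y t; rewrite cyl_scaleE val_ione mulr1 clamp_val. Qed.

Lemma cyl_scale0 y s : cyl_scale ((y, izero K), s) = (y, izero K).
Proof. by rewrite cyl_scaleE val_izero mul0r clamp_le0. Qed.

Lemma cyl_scale_end0 p : cyl_scale (p, izero K) = (p.1, izero K).
Proof. by case: p => y t; rewrite cyl_scaleE val_izero mulr0 clamp_le0. Qed.

Lemma prism_map (Y' Z : topologicalType) m (f : continuousType Y Y')
    (h : continuousType (Y' * I)%type Z) (h' : continuousType (Y * I)%type Z)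
    (c : cochain m.+1 Z) :
  (forall p, h' p = h (f p.1, p.2)) -> cpull f (prism (cpull h c)) = prism (cpull h' c).
Proof.
move=> hE; pose F : continuousType (Y * I)%type (Y' * I)%type :=
  cpair (f \o cfst Y I) (csnd Y I).
rewrite -(@prism_natural K R Y Y' m f F) // -cpull_comp; congr prism.
by apply: eq_cpull => p; rewrite hE.
Qed.

Section Primitive.
Variables (Z : topologicalType) (z0 : Z) (m : nat) (c : cochain m.+1 Z).
Hypothesis dc : codiff c = 0.
Hypothesis c0 : cpull (cst z0 : continuousType unit Z) c = 0.

Lemma prism_cst0 (h : continuousType (Y * I)%type Z) :
  (forall p, h p = z0) -> prism (cpull h c) = 0.
Proof. by move=> hz; rewrite (cpull_cst0 c0 hz) prism0. Qed.

Lemma codiff_prism_cpull (h : continuousType (Y * I)%type Z) :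
  codiff (prism (cpull h c)) =
  cpull (h \o cyl_end Y (ione K)) c - cpull (h \o cyl_end Y (izero K)) c.
Proof.
by have := prism_homotopy (cpull h c); rewrite -cpull_codiff dc cpull0 prism0 addr0 !cpull_comp.
Qed.

Lemma codiff_prism_loop (h : continuousType (Y * I)%type Z) :
  (forall y, h (y, izero K) = z0) -> (forall y, h (y, ione K) = z0) ->
  codiff (prism (cpull h c)) = 0.
Proof.
by move=> h0 h1; rewrite codiff_prism_cpull !(cpull_cst0 c0) ?subrr.
Qed.
End Primitive.
End FiberIntegration.

Section FiberIntegrationHomotopy.
Variables (K : realType) (R : comPzRingType) (Y Z : topologicalType).
Variables (z0 : Z) (m : nat) (c : cochain K R m.+1 Z).
Local Notation I := (unit_interval K).
Local Notation cochain n X := (cochain K R n X).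
Hypothesis dc : codiff c = 0.
Hypothesis c0 : cpull (cst z0 : continuousType unit Z) c = 0.

(** The primitive at (y, t) is the integral of [c] over the part of the path up to time t: zero at t
    = 0 and the full fibre integral at t = 1. *)
Lemma prism_primitive (h : continuousType (Y * I)%type Z) :
  (forall y, h (y, izero K) = z0) ->
  exists C : cochain m (Y * I)%type,
    [/\ codiff C = cpull h c, cpull (cyl_end Y (izero K)) C = 0 &
        cpull (cyl_end Y (ione K)) C = prism (cpull h c)].
Proof.
move=> h0; exists (prism (cpull (h \o cyl_scale K Y) c)); split.
- rewrite (codiff_prism_cpull dc) [X in _ - X](cpull_cst0 c0) ?subr0.
    by apply: eq_cpull => p; rewrite /= -[X in h X]/(cyl_scale K Y (p, ione K)) cyl_scale_end1.
  by move=> p; rewrite /= -[X in h X]/(cyl_scale K Y (p, izero K)) cyl_scale_end0.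
- rewrite (prism_map (h' := h \o cyl_scale K Y \o
      cpair (cyl_end Y (izero K) \o cfst Y I) (csnd Y I))) //.
  apply: (prism_cst0 c0) => -[y s].
  by rewrite -[LHS]/(h (cyl_scale K Y ((y, izero K), s))) cyl_scale0.
- apply: prism_map => -[y s].
  by rewrite -[RHS]/(h (cyl_scale K Y ((y, ione K), s))) cyl_scale1.
Qed.

(** Integrating [L] over its homotopy parameter gives [N], whose coboundary is the difference of the
    two pullbacks of [c]. With the partial-path primitives [C1] and [C0], the cochain [C1 - C0 - N]
    is a cocycle on the cylinder that is zero at one end and the desired difference at the other. *)
Lemma prism_homotopic (L : continuousType (Y * I * I)%type Z) :
  (forall y s, L (y, izero K, s) = z0) -> (forall y s, L (y, ione K, s) = z0) ->
  coboundary (prism (cpull (L \o cyl_end (Y * I)%type (ione K)) c) -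
              prism (cpull (L \o cyl_end (Y * I)%type (izero K)) c)).
Proof.
move=> L0 L1.
have [C1 [dC1 C10 C11]] := prism_primitive (h := L \o cyl_end (Y * I)%type (ione K))
  (fun y => L0 y _).
have [C0 [dC0 C00 C01]] := prism_primitive (h := L \o cyl_end (Y * I)%type (izero K))
  (fun y => L0 y _).
pose N := prism (cpull L c).
have N_end t : (forall y s, L (y, t, s) = z0) -> cpull (cyl_end Y t) N = 0.
  move=> Lt; rewrite (prism_map (h' := L \o cpair (cyl_end Y t \o cfst Y I) (csnd Y I))) //.
  by apply: (prism_cst0 c0) => -[y s]; exact: Lt.
have := @coboundary_prism K R Y m (C1 - C0 - N).
rewrite !codiffB dC1 dC0 (codiff_prism_cpull dc) subrr => /(_ erefl).
by rewrite !cpullB C11 C10 C01 C00 !N_end ?subr0 ?subrr.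
Qed.
End FiberIntegrationHomotopy.

Lemma subr_subl (V : zmodType) (x y z : V) : (x - y) - (x - z) = z - y.
Proof. by rewrite opprB addrC subrKA. Qed.

(** * Transgression on the total space of the universal bundle *)

Section Main.
Variables (K : realType) (R : comPzRingType).
Variables (G : topologicalGroupType) (X EG BG : topologicalType).
Variables (a : left_action G X) (xi : principal_bundle G EG BG).
Variables (e0 : EG) (F : continuousType (EG * unit_interval K)%type EG).
Variable gam : continuousType (susp K (1%g : G)) BG.
Hypothesis F_contracts : contracts_to e0 F.
Hypothesis gam_adjoint : canonical_adjoint xi e0 F gam.
Local Notation I := (unit_interval K).
Local Notation cochain n X := (cochain K R n X).
Local Notation H n X := (cohomology K R n X).
Local Notation b0 := (pb_proj xi e0).

Definition orbit_map : continuousType G EG :=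
  mkcts (ract_continuous (r := pb_act xi)) \o
    cpair (cst e0 : continuousType G EG) (idfun : continuousType G G).

Definition inv_act : continuousType (G * EG)%type EG :=
  mkcts (ract_continuous (r := pb_act xi)) \o
    cpair (csnd G EG) (mkcts (@invg_continuous G) \o cfst G EG).

Definition gam_cyl : continuousType (G * I)%type BG :=
  gam \o (susp_plus_group K G \o cyl_susp_plus K G).

Lemma susp_plus_groupE u t : susp_plus_group K G (susp_proj K (inr tt : plus G) (u, t)) =
  susp_proj K (1%g : G) (plus_group_fun u, t).
Proof. exact: tliftE. Qed.

Lemma gam_base s : gam (susp_proj K 1%g (s, izero K)) = b0.
Proof. by have [L [L0 _ /(_ s (izero K)) [<- _]]] := gam_adjoint; rewrite L0. Qed.

Lemma gam_collapsed p : susp_collapsed (1%g : G) p -> gam (susp_proj K 1%g p) = b0.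
Proof.
move=> hp; rewrite -(gam_base 1%g); congr (gam _); apply: tproj_rel; split=> //.
by left.
Qed.

Lemma gam_cylE g t : gam_cyl (g, t) = gam (susp_proj K 1%g (g, t)).
Proof.
by rewrite -[LHS]/(gam (susp_plus_group K G (susp_proj K (inr tt : plus G) (inl g, t))))
  susp_plus_groupE.
Qed.

Section Degree.
Variables (m : nat) (cx : cocycle K R m.+1 BG).
Hypothesis cx0 : cpull (cst b0 : continuousType unit BG) cx = 0.
Let dcx : codiff cx = 0 := codiff_cocycle cx.

Definition gam_cochain : cochain m G := prism (cpull gam_cyl cx).

Lemma gam_cochain_cocycle : gam_cochain \in @is_cocycle K R m G.
Proof.
apply/cocycleP; apply: (codiff_prism_loop dcx cx0) => g.
  by rewrite gam_cylE gam_collapsed //; right; left.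
by rewrite gam_cylE gam_collapsed //; right; right.
Qed.

(** Desuspension is integration over the suspension coordinate: the partial-path primitive from
    [prism_primitive] is the cochain [C] that [suspends] asks for. *)
Lemma gamma_barE : gamma_bar gam (coclass cx) = coclass (Cocycle gam_cochain_cocycle).
Proof.
apply: desuspensionE; rewrite !pull_coclass.
have [|C [dC C0 C1]] := prism_primitive dcx cx0 (h := gam_cyl).
  by move=> g; rewrite gam_cylE gam_collapsed //; right; left.
exists (Cocycle gam_cochain_cocycle), C, (zpull (susp_plus_group K G) (zpull gam cx)).
split=> //.
- rewrite -[LHS]cpull_comp -[LHS]cpull_comp; apply: (cpull_cst0 cx0) => u.
  by rewrite -[LHS]/(gam (susp_plus_group K G (susp_proj K (inr tt : plus G) (inr tt, izero K))))
    susp_plus_groupE gam_collapsed //; right; left.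
- by rewrite dC !cpull_comp.
Qed.

Definition transgression : cochain m EG := prism (cpull (pb_proj xi \o F) cx).

Lemma codiff_transgression : codiff transgression = cpull (pb_proj xi) cx.
Proof.
rewrite (codiff_prism_cpull dcx) [X in _ - X](cpull_cst0 cx0) ?subr0.
  by apply: eq_cpull => e /=; rewrite (F_contracts e).2.
by move=> e /=; rewrite (F_contracts e).1.
Qed.

Definition transgression_defect : cochain m (G * EG)%type :=
  cpull (csnd G EG) transgression - cpull inv_act transgression.

Lemma codiff_transgression_defect : codiff transgression_defect = 0.
Proof.
rewrite codiffB -!cpull_codiff codiff_transgression -!cpull_comp.
rewrite (eq_cpull (f := pb_proj xi \o inv_act) (g := pb_proj xi \o csnd G EG)) ?subrr //.
by move=> [g e]; exact: pb_projM.
Qed.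

(** On the orbit of [e0] the contraction paths project to the family [L] at parameter 1, homotopic
    relative to the ends to the loops of [gam]. As [F] may move [e0], the second claim is not
    immediate; it is the first one restricted to [g = 1], where [gam] is constant. *)
Lemma transgression_orbit :
  coboundary (cpull orbit_map transgression - gam_cochain) /\
  coboundary (cpull (cst e0 : continuousType G EG) transgression).
Proof.
have [L [L0 L1 Lb]] := gam_adjoint.
have Lcob := prism_homotopic dcx cx0 (L := L) (fun g s => (Lb g s).1) (fun g s => (Lb g s).2).
have EL : cpull orbit_map transgression =
    prism (cpull (L \o cyl_end (G * I)%type (ione K)) cx).
  by apply: prism_map => -[g t]; rewrite /= L1.
have EJ : gam_cochain = prism (cpull (L \o cyl_end (G * I)%type (izero K)) cx).
  by congr prism; apply: eq_cpull => -[g t]; rewrite gam_cylE /= L0.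
have orbJ : coboundary (cpull orbit_map transgression - gam_cochain) by rewrite EL EJ.
split=> //.
have -> : cpull (cst e0 : continuousType G EG) transgression =
    cpull (cst 1%g : continuousType G G) (cpull orbit_map transgression).
  by rewrite -cpull_comp; apply: eq_cpull => g; rewrite -[RHS]/(pb_act xi e0 1%g) ract1.
have J0 : cpull (cst 1%g : continuousType G G) gam_cochain = 0.
  rewrite /gam_cochain (prism_map (h' := gam_cyl \o
    cpair (cst 1%g : continuousType (G * I)%type G) (csnd G I))) //.
  apply: (prism_cst0 cx0) => -[g t].
  by rewrite -[LHS]/(gam_cyl (1%g, t)) gam_cylE gam_collapsed //; left.
by have := cpull_coboundary (cst 1%g : continuousType G G) orbJ; rewrite cpullB J0 subr0.
Qed.

(** All self-maps of [G * EG] over [G] are homotopic, as [EG] contracts. This allows the defect to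
    be evaluated on a convenient section instead of on all of [EG]. *)
Lemma contract_homotopic (f : continuousType (G * EG)%type EG) :
  homotopic K (cpair (cfst G EG) (cst e0 : continuousType (G * EG)%type EG))
              (cpair (cfst G EG) f).
Proof.
exists (cpair (cfst G EG \o cfst (G * EG)%type I)
          (F \o cpair (f \o cfst (G * EG)%type I) (csnd (G * EG)%type I))).
by move=> p; split; congr pair; [exact: (F_contracts (f p)).1|exact: (F_contracts (f p)).2].
Qed.

(** Pulled back along (g, e) to (g, e0 g), the defect compares the transgression at e0 g with its
    value at e0 g g^-1 = e0. By [transgression_orbit] the former is [gam_cochain] and the latter
    zero, up to coboundaries. *)
Lemma defect_gam_cochain :
  coboundary (cpull (cfst G EG) gam_cochain - transgression_defect).
Proof.
have [orbJ cst0] := transgression_orbit.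
have h1 := coboundary_homotopic (contract_homotopic (csnd G EG)) codiff_transgression_defect.
have h2 := coboundary_homotopic (contract_homotopic (orbit_map \o cfst G EG))
  codiff_transgression_defect.
have {h1 h2} h := coboundaryB h1 h2.
have E2 : cpull (cpair (cfst G EG) (orbit_map \o cfst G EG)) transgression_defect =
    cpull (cfst G EG) (cpull orbit_map transgression -
                       cpull (cst e0 : continuousType G EG) transgression).
  rewrite cpullB /transgression_defect cpullB -!cpull_comp; congr (_ - _).
    exact: eq_cpull.
  apply: eq_cpull => -[g e].
  by rewrite -[LHS]/(pb_act xi (pb_act xi e0 g) (g^-1)%g) -ractM mulgV ract1.
have E1 : cpull (cpair (cfst G EG) (csnd G EG)) transgression_defect = transgression_defect.
  by apply/funext => s; congr transgression_defect; apply/continuousEP => v /=; case: (s v).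
rewrite E1 E2 in h.
have h3 := cpull_coboundary (cfst G EG) (coboundaryB orbJ cst0).
have := coboundaryB h h3.
rewrite !cpullB [_ - _ - cpull _ (cpull (cst e0) _)]addrAC.
by rewrite [X in coboundary (X - _)]subr_subl subr_subl.
Qed.
End Degree.
End Main.

(** * Comparison on the naive quotient of X x EG and commutativity *)

Section Diagram.
Variables (K : realType) (R : comPzRingType).
Variables (G : topologicalGroupType) (X EG BG : topologicalType).
Variables (a : left_action G X) (xi : principal_bundle G EG BG).
Variables (e0 : EG) (F : continuousType (EG * unit_interval K)%type EG).
Variable gam : continuousType (susp K (1%g : G)) BG.
Variable j : continuousType (nquot K a) (nquot K (diag_action a xi)).
Hypothesis F_contracts : contracts_to e0 F.
Hypothesis gam_adjoint : canonical_adjoint xi e0 F gam.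
Hypothesis j_inverse : homotopy_inverse K (nquot_fst K a xi) j.
Local Notation I := (unit_interval K).
Local Notation cochain n X := (cochain K R n X).
Local Notation H n X := (cohomology K R n X).
Local Notation b0 := (pb_proj xi e0).

Lemma cup0l (Z : topologicalType) p q (y : H q Z) : cup (0 : H p Z) y = 0.
Proof.
have [c ->] := coclass_exists y.
have <- : coclass (0 : cocycle K R p Z) = 0 by apply/coclass_eq0; exact: coboundary0.
rewrite cup_coclass; apply/coclass_eq0.
by apply: coboundary_ccupl; [exact: coboundary0|exact: codiff_cocycle].
Qed.

Definition hquot_quotient : continuousType (X * EG)%type (hquot a xi) :=
  mkcts (@tproj_continuous _ _).

Lemma nquot_fst_collapse v : nquot_collapse K a (nquot_fst K a xi (tproj _ v)) =
  match v with
  | inl p => cyl_susp_plus K (G * X)%type ((p.1.1, p.1.2.1), p.2)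
  | inr _ => susp_base K (inr tt)
  end.
Proof.
rewrite [nquot_fst _ _ _ _]tliftE; case: v => [p|p]; exact: nquot_collapse_proj.
Qed.

Section PositiveDegree.
Variables (m q : nat) (cx : cocycle K R m.+1 BG) (cy : cocycle K R q (hquot a xi)).
Hypothesis cx0 : cpull (cst b0 : continuousType unit BG) cx = 0.

Let ccup_fst_snd : cochain (m + q) (G * X)%type :=
  ccup (cpull (cfst G X) (gam_cochain gam cx))
       (cpull (csnd G X) (cpull (hquot_incl a xi e0) cy)).

Let borel_cochain : cochain (m.+1 + q) (hquot a xi) :=
  ccup (cpull (hquot_proj a xi) cx) cy.

Let primitive : cochain (m + q) (X * EG)%type :=
  ccup (cpull (csnd X EG) (transgression xi F cx)) (cpull hquot_quotient cy).

Let codiff_primitive : codiff primitive = cpull hquot_quotient borel_cochain.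
Proof.
rewrite codiff_ccupl; last by rewrite -cpull_codiff codiff_cocycle cpull0.
rewrite -cpull_codiff (codiff_transgression F_contracts cx0) -cpull_comp.
rewrite /borel_cochain cpull_ccup -cpull_comp.
have -> // : cpull (pb_proj xi \o csnd X EG) cx =
    cpull (hquot_proj a xi \o hquot_quotient) cx.
by apply: eq_cpull => p; apply: esym; exact: tliftE.
Qed.

Let G_XE := (G * (X * EG))%type.
Let toGX : continuousType G_XE (G * X)%type :=
  cpair (cfst G (X * EG)%type) (cfst X EG \o csnd G (X * EG)%type).
Let toGE : continuousType G_XE (G * EG)%type :=
  cpair (cfst G (X * EG)%type) (csnd X EG \o csnd G (X * EG)%type).
Let dact := act_map (diag_action a xi).
Let dsnd := snd_map G (X * EG)%type.

(** The factor [cy] is pulled back from the orbit space, so acting does not change it and the whole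
    defect is that of the transgression, cupped with [cy]. What remains is to replace [cy] at [e] by
    [cy] at [e0], which the contraction [F] does. *)
Let primitive_defect :
  coboundary (cpull toGX ccup_fst_snd - (cpull dsnd primitive - cpull dact primitive)).
Proof.
have E1 : cpull dsnd primitive - cpull dact primitive =
    ccup (cpull toGE (transgression_defect xi F cx)) (cpull (hquot_quotient \o dsnd) cy).
  rewrite !cpull_ccup -!cpull_comp /transgression_defect cpullB -!cpull_comp.
  rewrite (eq_cpull (f := hquot_quotient \o dact) (g := hquot_quotient \o dsnd)).
    rewrite (eq_cpull (f := csnd X EG \o dsnd) (g := csnd G EG \o toGE)) //.
    by rewrite (eq_cpull (f := csnd X EG \o dact) (g := inv_act xi \o toGE)) // ccupBl.
  by move=> [g p]; apply/esym/tproj_rel; exists g.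
have E2 : coboundary (cpull toGX (cpull (csnd G X) (cpull (hquot_incl a xi e0) cy)) -
                      cpull (hquot_quotient \o dsnd) cy).
  rewrite -!cpull_comp; apply: coboundary_homotopic (codiff_cocycle cy).
  pose p1 := cfst G_XE I; pose xe := csnd G (X * EG)%type.
  exists (hquot_quotient \o cpair (cfst X EG \o (xe \o p1))
     (F \o cpair (csnd X EG \o (xe \o p1)) (csnd G_XE I))).
  move=> [g [x e]]; split; congr (tproj _ (x, _)); [exact: (F_contracts e).1|].
  exact: (F_contracts e).2.
have dg : codiff (cpull toGX (cpull (cfst G X) (gam_cochain gam cx))) = 0.
  rewrite -!cpull_codiff; have /cocycleP -> := gam_cochain_cocycle gam_adjoint cx0.
  by rewrite !cpull0.
have {E2} E2 := coboundary_ccupr dg E2.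
have E3 := cpull_coboundary toGE (defect_gam_cochain F_contracts gam_adjoint cx0).
have {E3} E3 := coboundary_ccupl E3 (b := cpull (hquot_quotient \o dsnd) cy).
rewrite -cpull_codiff codiff_cocycle cpull0 in E3.
have := coboundaryD E2 (E3 erefl).
rewrite E1 ccupBr cpullB ccupBl /ccup_fst_snd cpull_ccup.
have -> : cpull toGE (cpull (cfst G EG) (gam_cochain gam cx)) =
          cpull toGX (cpull (cfst G X) (gam_cochain gam cx)).
  by rewrite -!cpull_comp; exact: eq_cpull.
by rewrite addrA subrK.
Qed.

Lemma delta_positive_degree :
  delta a (cross (p := m.+1) (gamma_bar gam (coclass cx))
                 (pull (hquot_incl a xi e0) (coclass cy))) =
  pull (borel_map j) (cup (pull (hquot_proj a xi) (coclass cx)) (coclass cy)).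
Proof.
rewrite (gamma_barE gam_adjoint cx0) (pull_coclass (hquot_proj a xi) cx).
rewrite (cup_coclass (zpull (hquot_proj a xi) cx) cy).
rewrite (pull_coclass (hquot_incl a xi e0) cy) /cross.
rewrite (pull_coclass (cfst G X) (Cocycle _)).
rewrite (pull_coclass (csnd G X) (zpull (hquot_incl a xi e0) cy)) cup_coclass.
set s := coclass _; set k := Cocycle _.
have [c [C [z [[sc E] z0 C0 C1 zC]]]] := suspension_suspends s.
(* The identity in cohomology becomes [j^*] after [nquot_fst^*], and [borel_map] is [nquot_orbit]
   after [j]; so the two sides may be compared before applying [j^*]. *)
have jf : homotopic K (nquot_fst K a xi \o j) idfun by have [] := j_inverse.
rewrite -[LHS]pull_id -(homotopic_pull _ jf) pull_comp.
transitivity (pull j (pull (nquot_orbit K (diag_action a xi)) (coclass k)));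
  last by rewrite -pull_comp.
congr (pull _ _); rewrite /delta E (pull_coclass (nquot_collapse K a) z) !pull_coclass.
apply/coclassP.
set w := (X in coboundary X).
pose u : continuousType (G_XE * I)%type (G * X * I)%type :=
  cpair (toGX \o cfst G_XE I) (csnd G_XE I).
pose pr : continuousType (G_XE * I)%type (X * EG)%type := dsnd \o cfst G_XE I.
have pr_end t : cpull (cyl_end G_XE t) (cpull pr primitive) = cpull dsnd primitive.
  by rewrite -cpull_comp; exact: eq_cpull.
have u_end t : cpull (cyl_end G_XE t) (cpull u C) = cpull toGX (cpull (cyl_end (G * X)%type t) C).
  by rewrite -!cpull_comp; exact: eq_cpull.
have zfE (T : topologicalType) (h : continuousType T (nquot K (diag_action a xi))) :
    cpull (nquot_collapse K a \o (nquot_fst K a xi \o h)) z =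
    cpull h (zpull (nquot_fst K a xi) (zpull (nquot_collapse K a) z)).
  by rewrite !cpull_comp.
have ofE (T : topologicalType) (h : continuousType T (nquot K (diag_action a xi))) :
    cpull (nquot_orbit K (diag_action a xi) \o h) borel_cochain =
    cpull h (zpull (nquot_orbit K (diag_action a xi)) k).
  exact: cpull_comp.
(* On the base the delta part of [w] is zero and the Borel part has primitive [- primitive]; on the
   cylinder [C] accounts for the delta part. At time 0 the primitives cancel exactly; at time 1 the
   mismatch is [primitive_defect] with [c] in place of the cohomologous [ccup_fst_snd]. *)
apply: (coboundary_glue_up_to (hc := nquot_hocoequalizer K (diag_action a xi))
  (B := - primitive) (C := cpull u C - cpull pr primitive)).
- by rewrite /w codiffB !codiff_cocycle subrr.
- rewrite /w cpullB codiffN codiff_primitive -[RHS]sub0r; congr (_ - _).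
    by rewrite -zfE; apply: (cpull_cst0 z0) => p; rewrite [LHS]nquot_fst_collapse.
  by rewrite -[LHS]ofE; apply: eq_cpull => p; exact: tliftE.
- rewrite /w cpullB codiffB -[codiff (cpull pr _)]cpull_codiff codiff_primitive.
  rewrite -[codiff (cpull u _)]cpull_codiff -zC -[cpull u _]cpull_comp -zfE.
  congr (_ - _); first by apply: eq_cpull => p; rewrite [LHS]nquot_fst_collapse.
  by rewrite -[LHS]ofE -[RHS]cpull_comp; apply: eq_cpull => p; exact: tliftE.
- rewrite cpullB pr_end u_end C0 cpull0 cpullN opprK sub0r addNr; exact: coboundary0.
- rewrite cpullB pr_end u_end C1 cpullN opprK.
  have cs : coboundary ((c : cochain _ _) - ccup_fst_snd).
    by have /coclassP := esym sc.
  have := coboundaryD (cpull_coboundary toGX cs) primitive_defect.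
  rewrite cpullB addrA subrK opprB.
  by rewrite addrA addrAC.
Qed.
End PositiveDegree.

(** Local triviality makes [pb_proj] surjective, and contracting [EG] makes it homotopic to the
    constant map at the base point. In degree 0 cohomologous cocycles are equal, so the value at
    every point is the value at the base point. *)
Lemma reduced_degree0 (x : H 0 BG) : reduced b0 x -> x = 0.
Proof.
have [c ->] := coclass_exists x; rewrite /reduced pull_coclass.
move=> /coclass_eq0 c0; apply/coclass_eq0/funext => s.
have [U [t [_ [[_ Ut] tU _ _]]]] := pb_locally_trivial xi (s (vertex K ord0)).
have {t tU} [e es] : exists e, pb_proj xi e = s (vertex K ord0).
  by exists (t (s (vertex K ord0))); have [] := tU _ Ut.
have h : homotopic K (cst b0 : continuousType EG BG) (pb_proj xi).
  by exists (pb_proj xi \o F) => y /=; rewrite (F_contracts y).1 (F_contracts y).2.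
have := coboundary_homotopic h (codiff_cocycle c).
rewrite [cpull (cst b0) _](cpull_cst0 c0) // sub0r /= => /eqP.
rewrite oppr_eq0 => /eqP c1.
transitivity (cpull (pb_proj xi) c (cst e : singular K 0 EG)); last by rewrite c1.
(* A 0-simplex is determined by its single point, since the only coordinate is 1. *)
congr (cocycle_val c _); apply/continuousEP => v /=; rewrite es; congr (s _).
apply: val_inj; apply/rowP => k; rewrite (ord1 k).
have := simplex_sum1 v; have := simplex_sum1 (vertex K (ord0 : 'I_1)).
by rewrite !big_ord1 => -> ->.
Qed.

Lemma raddf_morphism (U V : zmodType) (f : U -> V) :
  {morph f : x y / x - y} -> f 0 = 0 /\ {morph f : x y / x + y}.
Proof.
move=> fB; have f0 : f 0 = 0 by rewrite -{1}(subrr 0) fB subrr.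
by split=> // x y; rewrite -{1}[y]opprK fB -[- y]sub0r fB f0 sub0r opprK.
Qed.

(** The composite of beta with alpha is constant at [b0], and a reduced class restricts to zero
    there. *)
Lemma k_pure_in_I n (t : pure_tensor K R a xi e0 n) : pull (hquot_incl a xi e0) (k_pure t) = 0.
Proof.
case: t => p q x y rx /=; rewrite pull_cup -pull_comp.
rewrite (_ : pull _ x = 0) ?cup0l //.
have -> : hquot_proj a xi \o hquot_incl a xi e0 =
    (cst b0 : continuousType unit BG) \o (cst tt : continuousType X unit)
    :> continuousType X BG.
  by apply/continuousEP => v; exact: tliftE.
by rewrite pull_comp [pull (cst b0) x]rx pull0.
Qed.

Lemma delta_tilde_S_pure n (t : pure_tensor K R a xi e0 n) :
  delta a (tilde_S_pure gam t) = pull (borel_map j) (k_pure t).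
Proof.
case: t => -[|m] q x y rx /=.
  (* For [p = 0] the cross product is 0 by convention, its left factor being of degree -1, and the
     other side is zero because [x] is. *)
  by rewrite (reduced_degree0 rx) pull0 cup0l pull0;
    exact: (raddf_morphism (@deltaB K R G X a q)).1.
have [cx [-> cx0]] := reduced_cocycle rx; have [cy ->] := coclass_exists y.
exact: delta_positive_degree.
Qed.

Lemma delta_tilde_S n (t : seq (pure_tensor K R a xi e0 n)) :
  delta a (tilde_S gam t) = pull (borel_map j) (k_map t).
Proof.
have [d0 dD] := raddf_morphism (@deltaB K R G X a n).
have [p0 pD] := raddf_morphism (@pullB K R _ _ (borel_map j) n).
rewrite /tilde_S /k_map; elim: t => [|u t IH]; first by rewrite !big_nil d0 p0.
by rewrite !big_cons dD pD IH delta_tilde_S_pure.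
Qed.

Lemma k_map_in_I n (t : seq (pure_tensor K R a xi e0 n)) : in_I xi e0 (k_map t).
Proof.
have [p0 pD] := raddf_morphism (@pullB K R _ _ (hquot_incl a xi e0) n).
rewrite /in_I /k_map; elim: t => [|u t IH]; first by rewrite big_nil p0.
by rewrite big_cons pD IH k_pure_in_I addr0.
Qed.
End Diagram.

Theorem proposition1p2p14 (K : realType) (R : comPzRingType)
  (G : topologicalGroupType) (X EG BG : topologicalType)
  (a : left_action G X) (xi : principal_bundle G EG BG)
  (e0 : EG) (F : continuousType (EG * unit_interval K)%type EG)
  (gam : continuousType (susp K (1%g : G)) BG)
  (j : continuousType (nquot K a) (nquot K (diag_action a xi))) :
  path_connected K G -> path_connected K X ->
  contracts_to e0 F ->
  canonical_adjoint xi e0 F gam ->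
  homotopy_inverse K (nquot_fst K a xi) j ->
  forall (n : nat) (t : seq (pure_tensor K R a xi e0 n)),
    in_I xi e0 (k_map t) /\ S_map j (k_map t) = mod_M a (tilde_S gam t).
Proof.
move=> _ _ Fc ga ji n t; split; first exact: k_map_in_I.
by apply: S_mapE; exact: (delta_tilde_S Fc ga ji).
Qed.
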